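(* Let $\rho:\Gamma\to GL_3(\mathbb{C})$ be a $T$-determined, $T$-unitarizable representation and $\upsilon$ any multiplier system for $\Gamma$ with cusp parameter $m$. Write the eigenvalues of $\rho(T)$ as $\mathbf{e}(r_1),\mathbf{e}(r_2),\mathbf{e}(r_3)$ with $r_j\in[0,1)$, let $\lambda_j\in[0,1)$ be the unique number with $\lambda_j\equiv r_j+\frac{m}{12}\pmod{\mathbb{Z}}$, $\lambda_0=\lambda_1+\lambda_2+\lambda_3$, and $k_0=4\lambda_0-2$. Suppose $\mathcal{H}(\rho,\upsilon)=\bigoplus_{k\ge0}\mathcal{H}(k_0+2k,\rho,\upsilon)$ and let $F_0\in\mathcal{H}(k_0,\rho,\upsilon)$ be a nonzero vector whose components form a fundamental system of solutions of a third order MLDE in weight $k_0$. Then: (i) $\mathcal{H}(\rho,\upsilon)$ is a free $\mathcal{M}$-module of rank 3 with basis $\{F_0,DF_0,D^2F_0\}$; (ii) $\mathcal{H}(\rho,\upsilon)=\mathcal{R}F_0$ is a cyclic $\mathcal{R}$-module; (iii) for all integers $k\ge0$, $\dim\mathcal{H}(k_0+2k,\rho,\upsilon)=\left[\frac{k}{2}\right]+1$.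
   Context: $\Gamma=SL(2,\mathbb{Z})$ acts on the upper half-plane $\mathbb{H}$ by Möbius transformations; $T=\begin{pmatrix}1&1\\0&1\end{pmatrix}$; $q=e^{2\pi iz}$, $\mathbf{e}(r)=e^{2\pi ir}$; $[x]$ is the greatest integer $\le x$. Complex powers use the principal branch of $\log$. For $k\in\mathbb{R}$, a multiplier system of weight $k$ is a map $\upsilon:\Gamma\to\{|w|=1\}$ such that $\nu(\gamma,z)=\upsilon(\gamma)(cz+d)^k$ ($\gamma=\begin{pmatrix}a&b\\c&d\end{pmatrix}$) satisfies $\nu(\gamma\sigma,z)=\nu(\gamma,\sigma z)\nu(\sigma,z)$; it is then also one of weight $k+n$ for all $n\in\mathbb{Z}$. Its cusp parameter is the $m\in[0,12)$ with $\upsilon(T)=\mathbf{e}(m/12)$. Slash action: $(f|_k^\upsilon\gamma)(z)=\upsilon(\gamma)^{-1}(cz+d)^{-k}f(\gamma z)$. Moderate growth of holomorphic $f$ on $\mathbb{H}$: $|f(x+iy)|\le y^N$ for $y>c$, some $N,c>0$. $\mathcal{H}(k,\rho,\upsilon)$: column vectors $F$ of holomorphic moderate-growth functions with $F|_k^\upsilon\gamma=\rho(\gamma)F$ for all $\gamma\in\Gamma$; $\mathcal{H}(\rho,\upsilon)=\bigoplus_{n\in\mathbb{Z}}\mathcal{H}(k+n,\rho,\upsilon)$. $\mathcal{M}=\bigoplus_j\mathcal{M}_j=\mathbb{C}[E_4,E_6]$ is the graded ring of holomorphic integral-weight modular forms for $\Gamma$ (trivial multiplier), acting by componentwise multiplication.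 $T$-unitarizable: $\rho(T)$ conjugate to a unitary matrix. An irreducible $\rho$ of dimension $d$ is $T$-determined if every indecomposable $\rho':\Gamma\to GL_d(\mathbb{C})$ with $\rho'(T)$ having the same eigenvalues as $\rho(T)$ is irreducible. With $\eta=q^{1/24}\prod_{n\ge1}(1-q^n)$, $P=\frac{i}{\pi}\frac{\eta'}{\eta}$ and $D_kf=\frac{1}{2\pi i}\frac{df}{dz}+kPf$, $D$ acts on $\mathcal{H}(k,\rho,\upsilon)$ componentwise as $D_k$, and $D^n=D_{k+2(n-1)}\circ\cdots\circ D_k$ on weight $k$. An MLDE of order $n$ in weight $k$ is $D_k^nf+M_4D_k^{n-2}f+\cdots+M_{2n}f=0$ with $M_{2j}\in\mathcal{M}_{2j}$; a fundamental system of solutions is a basis of its solution space. $\mathcal{R}$ is the skew polynomial ring $\mathcal{M}[d]$ with $dM=Md+DM$, acting on $\mathcal{H}(\rho,\upsilon)$ by $d\cdot F=DF$; $\mathcal{H}(\rho,\upsilon)=\mathcal{R}F_0$ means every element is a finite sum $\sum_jM_jD^jF_0$, $M_j\in\mathcal{M}$. *)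

(* Defs.v *)
From HB Require Import structures.
From mathcomp Require Import all_boot all_order all_algebra.
From mathcomp Require Import all_classical all_reals all_analysis.
From mathcomp.real_closed Require Import complex.
Import ComplexField.
Import Order.TTheory GRing.Theory Num.Theory.
Import numFieldNormedType.Exports.

Set Implicit Arguments.
Unset Strict Implicit.
Unset Printing Implicit Defensive.

Local Open Scope ring_scope.

Definition CC (R : realType) : numClosedFieldType := R[i].

Definition ReC {R : realType} (z : CC R) : R := complex.Re z.
Definition ImC {R : realType} (z : CC R) : R := complex.Im z.
Definition mkC {R : realType} (x y : R) : CC R := (x +i* y)%C.
Definition ofR {R : realType} (x : R) : CC R := (x%:C)%C.

Definition upper {R : realType} (z : CC R) : Prop := 0 < ImC z.

Definition cis {R : realType} (t : R) : CC R := mkC (cos t) (sin t).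

Definition ee {R : realType} (r : R) : CC R := cis (2 * pi * r).

(* e(z) = exp(2 pi i z) for complex z; q = e(z) *)
Definition eC {R : realType} (z : CC R) : CC R :=
  ofR (expR (- (2 * pi * ImC z))) * ee (ReC z).

(* principal argument, in (-pi, pi] *)
Definition Arg {R : realType} (w : CC R) : R :=
  let x := ReC w in let y := ImC w in
  if 0 < x then atan (y / x)
  else if x < 0 then (if 0 <= y then atan (y / x) + pi else atan (y / x) - pi)
  else if 0 < y then pi / 2 else if y < 0 then - (pi / 2) else 0.

Definition absC {R : realType} (w : CC R) : R :=
  Num.sqrt (ReC w ^+ 2 + ImC w ^+ 2).

(* principal branch of w^s = exp(s Log w), for real s (w <> 0) *)
Definition cpow {R : realType} (w : CC R) (s : R) : CC R :=
  if w == 0 then 0 else ofR (powR (absC w) s) * cis (s * Arg w).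

Definition fracR {R : realType} (x : R) : R := x - (Num.floor x)%:~R.

Definition SL2 (g : 'M[int]_2) : Prop := \det g = 1.

Definition ma (g : 'M[int]_2) : int := g ord0 ord0.
Definition mb (g : 'M[int]_2) : int := g ord0 ord_max.
Definition mc (g : 'M[int]_2) : int := g ord_max ord0.
Definition md (g : 'M[int]_2) : int := g ord_max ord_max.

Definition Tmat : 'M[int]_2 :=
  \matrix_(i < 2, j < 2) (if (i <= j)%N then 1 else 0).

Definition jfac {R : realType} (g : 'M[int]_2) (z : CC R) : CC R :=
  (mc g)%:~R * z + (md g)%:~R.

Definition mobius {R : realType} (g : 'M[int]_2) (z : CC R) : CC R :=
  ((ma g)%:~R * z + (mb g)%:~R) / jfac g z.

Definition is_rep {R : realType} (rho : 'M[int]_2 -> 'M[CC R]_3) : Prop :=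
  (forall g h, SL2 g -> SL2 h -> rho (g *m h) = rho g *m rho h) /\
  (forall g, SL2 g -> rho g \in unitmx).

(* rho acts on column vectors; a subspace is the row space of W, i.e. the
   span of the (transposed) rows of W; it is invariant iff
   rho(g) w^T lies in it for every row w, i.e. W rho(g)^T <= W. *)
Definition rep_invariant {R : realType} (rho : 'M[int]_2 -> 'M[CC R]_3)
  (W : 'M[CC R]_3) : Prop :=
  forall g, SL2 g -> (W *m (rho g)^T <= W)%MS.

Definition rep_irreducible {R : realType} (rho : 'M[int]_2 -> 'M[CC R]_3) : Prop :=
  forall W, rep_invariant rho W -> (W == (0 : 'M[CC R]_3))%MS \/ (W == 1%:M)%MS.

Definition rep_indecomposable {R : realType} (rho : 'M[int]_2 -> 'M[CC R]_3) : Prop :=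
  forall W1 W2, rep_invariant rho W1 -> rep_invariant rho W2 ->
    (W1 + W2 == 1%:M)%MS -> (W1 :&: W2 == (0 : 'M[CC R]_3))%MS ->
    (W1 == (0 : 'M[CC R]_3))%MS \/ (W2 == (0 : 'M[CC R]_3))%MS.

Definition T_determined {R : realType} (rho : 'M[int]_2 -> 'M[CC R]_3) : Prop :=
  rep_irreducible rho /\
  forall rho' : 'M[int]_2 -> 'M[CC R]_3, is_rep rho' ->
    char_poly (rho' Tmat) = char_poly (rho Tmat) ->
    rep_indecomposable rho' -> rep_irreducible rho'.

Definition T_unitarizable {R : realType} (rho : 'M[int]_2 -> 'M[CC R]_3) : Prop :=
  exists P U : 'M[CC R]_3, P \in unitmx /\
    U *m (map_mx Num.conj U)^T = 1%:M /\
    rho Tmat = invmx P *m U *m P.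

Definition nu_fac {R : realType} (ups : 'M[int]_2 -> CC R) (k : R)
  (g : 'M[int]_2) (z : CC R) : CC R := ups g * cpow (jfac g z) k.

Definition is_multiplier {R : realType} (k : R) (ups : 'M[int]_2 -> CC R) : Prop :=
  (forall g, SL2 g -> `|ups g| = 1) /\
  (forall g s z, SL2 g -> SL2 s -> upper z ->
     nu_fac ups k (g *m s) z = nu_fac ups k g (mobius s z) * nu_fac ups k s z).

Definition cusp_param {R : realType} (ups : 'M[int]_2 -> CC R) (m : R) : Prop :=
  0 <= m < 12 /\ ups Tmat = ee (m / 12).

Definition holo {R : realType} (f : CC R -> CC R) : Prop :=
  forall z, upper z -> derivable f z 1.

Definition cderiv {R : realType} (f : CC R -> CC R) (z : CC R) : CC R :=
  'D_1 f z.

Definition mod_growth {R : realType} (f : CC R -> CC R) : Prop :=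
  exists N c : R, 0 < N /\ 0 < c /\
    forall x y : R, c < y -> `|f (mkC x y)| <= ofR (powR y N).

Definition comp {R : realType} (F : CC R -> 'cV[CC R]_3) (i : 'I_3) : CC R -> CC R :=
  fun z => F z i ord0.

Definition eqH {R : realType} {T : Type} (F G : CC R -> T) : Prop :=
  forall z, upper z -> F z = G z.

Definition inHk {R : realType} (k : R) (rho : 'M[int]_2 -> 'M[CC R]_3)
  (ups : 'M[int]_2 -> CC R) (F : CC R -> 'cV[CC R]_3) : Prop :=
  (forall i, holo (comp F i) /\ mod_growth (comp F i)) /\
  (forall g z, SL2 g -> upper z ->
     ((ups g)^-1 * cpow (jfac g z) (- k)) *: F (mobius g z) = rho g *m F z).

(* H(rho, ups) = (+)_{n in Z} H(k+n, rho, ups), for ups of weight k *)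
Definition inH {R : realType} (k : R) (rho : 'M[int]_2 -> 'M[CC R]_3)
  (ups : 'M[int]_2 -> CC R) (F : CC R -> 'cV[CC R]_3) : Prop :=
  exists (s : seq int) (Fs : int -> CC R -> 'cV[CC R]_3),
    (forall n, inHk (k + n%:~R) rho ups (Fs n)) /\
    eqH F (fun z => \sum_(n <- s) Fs n z).

Definition inMj {R : realType} (j : int) (f : CC R -> CC R) : Prop :=
  holo f /\ mod_growth f /\
  (forall g z, SL2 g -> upper z -> f (mobius g z) = (jfac g z) ^ j * f z).

Definition inM {R : realType} (f : CC R -> CC R) : Prop :=
  exists (s : seq int) (fs : int -> CC R -> CC R),
    (forall j, inMj j (fs j)) /\ eqH f (fun z => \sum_(j <- s) fs j z).

Definition eta {R : realType} (z : CC R) : CC R :=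
  eC (z / 24%:R) * limn (fun N : nat => \prod_(1 <= n < N.+1) (1 - eC z ^+ n)).

Definition Pfun {R : realType} (z : CC R) : CC R :=
  ('i / ofR pi) * (cderiv eta z / eta z).

Definition Dk {R : realType} (k : R) (f : CC R -> CC R) : CC R -> CC R :=
  fun z => (ofR (2 * pi) * 'i)^-1 * cderiv f z + (ofR k * Pfun z) * f z.

Fixpoint Dn {R : realType} (k : R) (n : nat) (f : CC R -> CC R) : CC R -> CC R :=
  match n with
  | 0 => f
  | n'.+1 => Dk (k + 2 * n'%:R) (Dn k n' f)
  end.

Definition DnV {R : realType} (k : R) (n : nat) (F : CC R -> 'cV[CC R]_3)
  : CC R -> 'cV[CC R]_3 :=
  fun z => \col_(i < 3) Dn k n (comp F i) z.

Definition mlde3_sol {R : realType} (k : R) (M4 M6 : CC R -> CC R)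
  (f : CC R -> CC R) : Prop :=
  holo f /\
  forall z, upper z -> Dn k 3 f z + M4 z * Dn k 1 f z + M6 z * f z = 0.

Definition fund_system3 {R : realType} (k : R) (F : CC R -> 'cV[CC R]_3) : Prop :=
  exists M4 M6 : CC R -> CC R, inMj 4 M4 /\ inMj 6 M6 /\
    (forall i, mlde3_sol k M4 M6 (comp F i)) /\
    (forall a : 'I_3 -> CC R,
       (forall z, upper z -> \sum_i a i * comp F i z = 0) -> forall i, a i = 0) /\
    (forall f, mlde3_sol k M4 M6 f ->
       exists a : 'I_3 -> CC R, forall z, upper z -> f z = \sum_i a i * comp F i z).

Definition has_dim {R : realType} (P : (CC R -> 'cV[CC R]_3) -> Prop) (d : nat) : Prop :=
  exists B : 'I_d -> CC R -> 'cV[CC R]_3,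
    (forall i, P (B i)) /\
    (forall a : 'I_d -> CC R,
       (forall z, upper z -> \sum_i a i *: B i z = 0) -> forall i, a i = 0) /\
    (forall F, P F -> exists a : 'I_d -> CC R,
       forall z, upper z -> F z = \sum_i a i *: B i z).

(* Main.v *)
Require Import Defs.
From HB Require Import structures.
From mathcomp Require Import all_boot all_order all_algebra.
From mathcomp Require Import all_classical all_reals all_analysis.
From mathcomp.real_closed Require Import complex.
From mathcomp Require Import ring lra zify.
From mathcomp Require Import perm spectral.
Import ComplexField.
Import Order.TTheory GRing.Theory Num.Theory.
Import numFieldNormedType.Exports.
Set Implicit Arguments.
Unset Strict Implicit.
Unset Printing Implicit Defensive.
Local Open Scope ring_scope.

(** Let [W = det (F0, F0', F0'')]. Since the components of [F0] solve a third order MLDE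
    and are linearly independent, [W] has no zero and [W'/W = 24 lam0 eta'/eta] (Abel), so
    [|W| = C |eta|^(24 lam0)].  The behaviour of [F0] under [Gamma] makes [W] transform like
    a modular form; comparing logarithmic derivatives (and [lam0 <> 0], by irreducibility)
    yields the quasi-modularity of [eta'/eta].  From this alone come [eta^24] in [M_12],
    [E4] as the Serre derivative of [eta'/eta], [E6] as that of [E4], and the dimensions of
    all [M_2n], by dividing cusp forms by [eta^24].  For [F] in [H(rho, ups)], Cramer's rule
    writes [F = sum_j M_j D^j F0] with [M_j] a quotient of a determinant by [W]; the
    q-expansions in a basis diagonalizing [rho T] show that this determinant is
    [O(|q|^lam0)], hence that [M_j] is bounded at the cusp. *)

(** The value [k0 = 4 * lam0 - 2] is the one for which 6 (k0 + 2), the coefficient of (eta'/eta) f''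
    once the MLDE is solved for f''', equals 24 lam0. Thus [W], of weight 3 k0 + 6 = 12 lam0, has at
    the cusp precisely the order lam0, and this is the least order that a determinant of three
    elements of H(rho, ups) can have; because of this match no quotient in Cramer's rule has a pole
    there. Two obstacles shape the proof. Weights are real and [cpow] is a power with a branch, so
    real powers and logarithms are handled only through [ln] of squared moduli along segments, and
    logarithmic derivatives are recovered from their real parts in the directions 1 and i. Moreover,
    derivatives of holomorphic functions have to be holomorphic again; this is read off
    q-expansions, which can be differentiated termwise, so that the only Cauchy formula needed is
    the one for functions of period 1. *)

Section MinBounds.
Context {R : realType}.
Lemma minle1 (a b : R) : Num.min a b <= a. Proof. by rewrite ge_min lexx. Qed.
Lemma minle2 (a b : R) : Num.min a b <= b. Proof. by rewrite ge_min lexx orbT. Qed.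
Lemma min_gt0 (a b : R) : 0 < a -> 0 < b -> 0 < Num.min a b.
Proof. by move=> a0 b0; rewrite lt_min a0. Qed.
Lemma normRD (a b : R) : `|a + b| <= `|a| + `|b|. Proof. exact: ler_normD. Qed.
End MinBounds.

(** * Complex derivative and exponential *)

Section ComplexBasics.
Context {R : realType}.
Implicit Types (z w : CC R) (x y : R).

Lemma normCE z : `|z| = ofR (absC z).
Proof. exact: normc_def. Qed.

Lemma ReD z w : ReC (z + w) = ReC z + ReC w. Proof. by case: z; case: w. Qed.
Lemma ImD z w : ImC (z + w) = ImC z + ImC w. Proof. by case: z; case: w. Qed.
Lemma ReN z : ReC (- z) = - ReC z. Proof. by case: z. Qed.
Lemma ImN z : ImC (- z) = - ImC z. Proof. by case: z. Qed.
Lemma ReB z w : ReC (z - w) = ReC z - ReC w. Proof. by rewrite ReD ReN. Qed.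
Lemma ImB z w : ImC (z - w) = ImC z - ImC w. Proof. by rewrite ImD ImN. Qed.
Lemma ReM z w : ReC (z * w) = ReC z * ReC w - ImC z * ImC w.
Proof. by case: z; case: w. Qed.
Lemma ImM z w : ImC (z * w) = ReC z * ImC w + ImC z * ReC w.
Proof. by case: z => a b; case: w. Qed.
Lemma Re_of x : ReC (ofR x) = x. Proof. by []. Qed.
Lemma Im_of x : ImC (ofR x) = 0. Proof. by []. Qed.
Lemma Re_mk x y : ReC (mkC x y) = x. Proof. by []. Qed.
Lemma Im_mk x y : ImC (mkC x y) = y. Proof. by []. Qed.
Lemma Re0 : ReC (0 : CC R) = 0. Proof. by []. Qed.
Lemma Im0 : ImC (0 : CC R) = 0. Proof. by []. Qed.
Lemma Re1 : ReC (1 : CC R) = 1. Proof. by []. Qed.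
Lemma Im1 : ImC (1 : CC R) = 0. Proof. by []. Qed.
Lemma ofR0 : ofR (0 : R) = 0. Proof. by []. Qed.
Lemma ofR1 : ofR (1 : R) = 1. Proof. by []. Qed.
Lemma ofRD x y : ofR (x + y) = ofR x + ofR y. Proof. exact: (rmorphD (real_complex R)). Qed.
Lemma ofRB x y : ofR (x - y) = ofR x - ofR y. Proof. exact: (rmorphB (real_complex R)). Qed.
Lemma ofRM x y : ofR (x * y) = ofR x * ofR y. Proof. exact: (rmorphM (real_complex R)). Qed.
Lemma ofRV x : ofR x^-1 = (ofR x)^-1. Proof. exact: (fmorphV (real_complex R)). Qed.
Lemma ofRn n : ofR (n%:R : R) = n%:R. Proof. exact: (rmorph_nat (real_complex R)). Qed.
Lemma ofRz (n : int) : ofR (n%:~R : R) = n%:~R. Proof. exact: (rmorph_int (real_complex R)). Qed.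
Lemma ofRX x n : ofR (x ^+ n) = ofR x ^+ n. Proof. exact: (rmorphXn (real_complex R)). Qed.
Lemma ofR_inj x y : ofR x = ofR y -> x = y. Proof. by move=> []. Qed.
Lemma ofR_eq0 x : (ofR x == 0) = (x == 0).
Proof. by rewrite -ofR0; apply/eqP/eqP => [/ofR_inj|->]. Qed.
Lemma Re_n n : ReC (n%:R : CC R) = n%:R. Proof. by rewrite -ofRn. Qed.
Lemma Im_n n : ImC (n%:R : CC R) = 0. Proof. by rewrite -ofRn. Qed.
Lemma Re_z (n : int) : ReC (n%:~R : CC R) = n%:~R. Proof. by rewrite -ofRz. Qed.
Lemma Im_z (n : int) : ImC (n%:~R : CC R) = 0. Proof. by rewrite -ofRz. Qed.
Lemma Re_i : ReC ('i : CC R) = 0. Proof. by rewrite -complexiE. Qed.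
Lemma Im_i : ImC ('i : CC R) = 1. Proof. by rewrite -complexiE. Qed.

Lemma eqC z w : ReC z = ReC w -> ImC z = ImC w -> z = w.
Proof. by case: z => a b; case: w => c d /= ; rewrite /ReC /ImC /= => -> ->. Qed.

Lemma mkCE x y : mkC x y = ofR x + 'i * ofR y.
Proof. by apply: eqC; rewrite !(ReD, ImD, ReM, ImM, Re_i, Im_i, Re_of, Im_of, Re_mk, Im_mk); ring. Qed.

Lemma absC_ge0 z : 0 <= absC z. Proof. exact: sqrtr_ge0. Qed.
Lemma absC0 : absC (0 : CC R) = 0.
Proof. by apply: ofR_inj; rewrite -normCE normr0. Qed.
Lemma absC1 : absC (1 : CC R) = 1.
Proof. by apply: ofR_inj; rewrite -normCE normr1. Qed.
Lemma absCM z w : absC (z * w) = absC z * absC w.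
Proof. by apply: ofR_inj; rewrite ofRM -!normCE normrM. Qed.
Lemma absCV z : absC z^-1 = (absC z)^-1.
Proof. by apply: ofR_inj; rewrite ofRV -!normCE normfV. Qed.
Lemma absCX z n : absC (z ^+ n) = absC z ^+ n.
Proof. by apply: ofR_inj; rewrite ofRX -!normCE normrX. Qed.
Lemma absCN z : absC (- z) = absC z.
Proof. by apply: ofR_inj; rewrite -!normCE normrN. Qed.
Lemma absCB z w : absC (z - w) = absC (w - z).
Proof. by rewrite -absCN opprB. Qed.
Lemma absC_of x : absC (ofR x) = `|x|.
Proof. by rewrite /absC Re_of Im_of expr0n addr0 sqrtr_sqr. Qed.
Lemma absC_i : absC ('i : CC R) = 1.
Proof. by rewrite /absC Re_i Im_i expr0n add0r expr1n sqrtr1. Qed.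
Lemma absCn n : absC (n%:R : CC R) = n%:R.
Proof. by rewrite -ofRn absC_of ger0_norm. Qed.
Lemma absC_eq0 z : (absC z == 0) = (z == 0).
Proof. by rewrite -ofR_eq0 -normCE normr_eq0. Qed.
Lemma absC_gt0 z : (0 < absC z) = (z != 0).
Proof. by rewrite lt_def absC_ge0 absC_eq0 andbT. Qed.
Lemma lecE' x y : (ofR x <= ofR y) = (x <= y). Proof. exact: lecR. Qed.
Lemma ltcE' x y : (ofR x < ofR y) = (x < y). Proof. exact: ltcR. Qed.
Lemma absCD z w : absC (z + w) <= absC z + absC w.
Proof. by rewrite -lecE' ofRD -!normCE ler_normD. Qed.
Lemma absCBle z w : absC (z - w) <= absC z + absC w.
Proof. by rewrite (le_trans (absCD _ _))// absCN. Qed.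
Lemma absC_sub z w : absC z - absC w <= absC (z - w).
Proof. by rewrite lerBlDr -{1}[z](subrK w) absCD. Qed.
Lemma absC_sqr z : absC z ^+ 2 = ReC z ^+ 2 + ImC z ^+ 2.
Proof. by rewrite sqr_sqrtr// addr_ge0// sqr_ge0. Qed.
Lemma Re_absC z : `|ReC z| <= absC z.
Proof.
by rewrite -(ler_pXn2r (n := 2))// ?nnegrE ?absC_ge0// absC_sqr real_normK ?num_real// lerDl sqr_ge0.
Qed.
Lemma Im_absC z : `|ImC z| <= absC z.
Proof.
by rewrite -(ler_pXn2r (n := 2))// ?nnegrE ?absC_ge0// absC_sqr real_normK ?num_real// lerDr sqr_ge0.
Qed.
Lemma absC_le_ReIm z : absC z <= `|ReC z| + `|ImC z|.
Proof.
have -> : z = ofR (ReC z) + 'i * ofR (ImC z) by rewrite -mkCE; case: z.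
by rewrite (le_trans (absCD _ _))// absCM absC_i mul1r !absC_of !(ReD,ReM,ImD,ImM,Re_of,Im_of,Re_i,Im_i); rewrite !(mul0r,mulr0,mul1r,addr0,subr0,add0r).
Qed.
Lemma absC_sum (I : Type) (r : seq I) (P : pred I) (f : I -> CC R) :
  absC (\sum_(i <- r | P i) f i) <= \sum_(i <- r | P i) absC (f i).
Proof.
elim/big_ind2: _ => [|a b c d h1 h2|//]; first by rewrite absC0.
by rewrite (le_trans (absCD _ _))// lerD.
Qed.

Lemma upper_nbhs z : upper z -> exists2 d : R, 0 < d & forall w, absC (w - z) < d -> upper w.
Proof.
move=> uz; exists (ImC z) => // w; rewrite /upper => h.
have := le_lt_trans (Im_absC _) h; rewrite ImB ltr_norml => /andP[].
by rewrite -ltrBlDr; lra.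
Qed.

End ComplexBasics.

Definition simpRI {R : realType} := (@ReD R, @ImD R, @ReM R, @ImM R, @ReN R, @ImN R,
  @Re_i R, @Im_i R, @Re_of R, @Im_of R, @Re_mk R, @Im_mk R, @Re_n R, @Im_n R,
  (@Re_z R, @Im_z R, @Re1 R, @Im1 R, @Re0 R, @Im0 R)).

Section Derivative.
Context {R : realType}.
Implicit Types (f g : CC R -> CC R) (z w d : CC R).

Definition hd f z d : Prop := is_derive z 1 f d.

(** The radius of a ball of [CC R] is itself an element of [CC R], and [0 < e] forces it to be real;
    this is the passage to radii in [R]. *)
Lemma nbhs0P (P : CC R -> Prop) :
  (\forall h \near 0, P h) <-> (exists2 d : R, 0 < d & forall h, absC h < d -> P h).
Proof.
split.
  move=> /nbhs_ballP[e /= e0 h].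
  have e1 : 0 < ReC e by move: e0; rewrite ltcE /= => /andP[].
  exists (ReC e) => // k kd; apply: h; rewrite /ball /= sub0r normrN normCE.
  have -> : e = ofR (ReC e).
    by move: e0; rewrite ltcE /= => /andP[/eqP h _]; apply: eqC => //; rewrite Im_of -[RHS]h.
  by rewrite ltcE'.
move=> [d d0 h]; apply/nbhs_ballP; exists (ofR d); first by rewrite /= -ofR0 ltcE'.
by move=> k; rewrite /ball /= sub0r normrN normCE ltcE'; exact: h.
Qed.

(** A form of differentiability without division: [h = 0] needs no separate case, and chain rule,
    power series and contour estimates become plain norm estimates. *)
Lemma hdP f z d : hd f z d <->
  (forall e : R, 0 < e -> exists2 dl : R, 0 < dl &
     forall h, absC h < dl -> absC (f (z + h) - f z - d * h) <= e * absC h).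
Proof.
split.
  move=> [df vd] e e0.
  have : ((fun h : CC R => h^-1 *: ((f \o shift z) (h *: 1) - f z)) @ 0^' --> 'D_1 f z)%classic by exact: df.
  move=> /cvgrPdist_le /(_ (ofR e)); rewrite -ofR0 ltcE' => /(_ e0).
  rewrite /at_right /dnbhs /within /= => /nbhs0P[dl dl0 H]; exists dl => // h hd1.
  have [->|h0] := eqVneq h 0; first by rewrite addr0 subrr mulr0 subrr absC0 mulr0.
  have := H h hd1 h0.
  rewrite vd normCE lecE' /= /GRing.scale /= mulr1 [h + z]addrC => le1.
  have -> : f (z + h) - f z - d * h = - (d - h^-1 * (f (z + h) - f z)) * h.
    by field.
  by rewrite absCM absCN ler_wpM2r// absC_ge0.
move=> H.
have cv : ((fun h : CC R => h^-1 *: ((f \o shift z) (h *: 1) - f z)) @ 0^' --> d)%classic.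
  apply/cvgrPdist_le => e e0.
  have e1 : 0 < ReC e by move: e0; rewrite ltcE /= => /andP[].
  have eE : e = ofR (ReC e).
    by move: e0; rewrite ltcE /= => /andP[/eqP h _]; apply: eqC => //; rewrite Im_of -[RHS]h.
  have [dl dl0 H'] := H _ e1.
  rewrite /dnbhs /within /=; apply/nbhs0P; exists dl => // h hdl h0.
  rewrite normCE eE lecE' /= /GRing.scale /= mulr1 [h + z]addrC.
  have h1 : 0 < absC h by rewrite absC_gt0.
  rewrite -(ler_pM2r h1) -absCM; apply: le_trans (H' _ hdl).
  rewrite -absCN le_eqVlt; apply/orP; left; apply/eqP; congr absC.
  by field.
have df : derivable f z 1 by apply/cvg_ex; exists d.
apply: DeriveDef df _; rewrite /derive; exact: (cvg_lim (@norm_hausdorff _ _) cv).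
Qed.

Lemma hd_derivable f z d : hd f z d -> derivable f z 1.
Proof. by case. Qed.
Lemma hd_val f z d : hd f z d -> cderiv f z = d.
Proof. by case. Qed.
Lemma derivable_hd f z : derivable f z 1 -> hd f z (cderiv f z).
Proof. by move=> h; split. Qed.
Lemma hd_unique f z d d' : hd f z d -> hd f z d' -> d = d'.
Proof. by move=> [_ <-] [_ <-]. Qed.

Lemma hd_near f g z d : (exists2 e : R, 0 < e & forall h, absC h < e -> f (z + h) = g (z + h)) ->
  hd f z d -> hd g z d.
Proof.
move=> [e e0 E] /hdP H; apply/hdP => e1 /H[dl dl0 H'].
exists (Num.min e dl); first by rewrite lt_min e0.
move=> h; rewrite lt_min => /andP[he hdl].
by rewrite -E// -[z]addr0 -E ?absC0// addr0 H'.
Qed.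

Lemma hd_upper f g z d : upper z -> (forall w, upper w -> f w = g w) -> hd f z d -> hd g z d.
Proof.
move=> /upper_nbhs[e e0 U] E; apply: hd_near; exists e => // h he; apply: E; apply: U.
by rewrite addrC addKr.
Qed.

Lemma hd_eq f z d d' : hd f z d -> d = d' -> hd f z d'.
Proof. by move=> h <-. Qed.

Lemma hd_cst (c z : CC R) : hd (fun _ => c) z 0.
Proof. exact: is_derive_cst. Qed.
Lemma hd_id z : hd (fun w => w) z 1.
Proof. exact: is_derive_id. Qed.
Lemma hdD f g z d d' : hd f z d -> hd g z d' -> hd (fun w => f w + g w) z (d + d').
Proof. exact: is_deriveD. Qed.
Lemma hdB f g z d d' : hd f z d -> hd g z d' -> hd (fun w => f w - g w) z (d - d').
Proof. exact: is_deriveB. Qed.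
Lemma hdM f g z d d' : hd f z d -> hd g z d' -> hd (fun w => f w * g w) z (d * g z + f z * d').
Proof.
move=> h1 h2; have := is_deriveM h1 h2 => h; apply: (hd_eq h).
by rewrite /GRing.scale /= addrC [g z * _]mulrC.
Qed.
Lemma hdZ (c : CC R) f z d : hd f z d -> hd (fun w => c * f w) z (c * d).
Proof. by move=> h; apply: (hd_eq (hdM (hd_cst c z) h)); rewrite mul0r add0r. Qed.
Lemma hdX f n z d : hd f z d -> hd (fun w => f w ^+ n) z (n%:R * f z ^+ n.-1 * d).
Proof.
move=> h; elim: n => [|n IH]; first by rewrite !mul0r; exact: hd_cst.
rewrite (_ : (fun w => _) = fun w => f w * f w ^+ n); last by apply/funext => w; rewrite exprS.
apply: (hd_eq (hdM h IH)); case: n {IH} => [|n]; first by rewrite /= expr0; ring.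
by rewrite /= [n.+2%:R]mulrS exprS; ring.
Qed.
Lemma hd_sum n (F : 'I_n -> CC R -> CC R) (D : 'I_n -> CC R) z :
  (forall i, hd (F i) z (D i)) -> hd (fun w => \sum_(i < n) F i w) z (\sum_(i < n) D i).
Proof.
move=> h; have := is_derive_sum h => h1; rewrite /hd.
by rewrite (_ : (fun w => _) = \sum_(i < n) F i)//; apply/funext => w; rewrite fct_sumE.
Qed.

Lemma hd_lip f z d : hd f z d -> exists2 e : R, 0 < e &
  forall h, absC h < e -> absC (f (z + h) - f z) <= (absC d + 1) * absC h.
Proof.
move=> /hdP/(_ 1 ltr01)[e e0 H]; exists e => // h /H; rewrite mul1r => h1.
rewrite -[f (z+h) - f z](subrK (d * h)) (le_trans (absCD _ _))// absCM.
by rewrite mulrDl mul1r addrC lerD2l.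
Qed.

Lemma hd_comp f g z d d' : hd f (g z) d -> hd g z d' -> hd (fun w => f (g w)) z (d * d').
Proof.
move=> /hdP F G; have /hdP G1 := G; have [e1 e10 L] := hd_lip G; apply/hdP => e e0.
pose K := absC d' + 1; have K0 : 0 < K by rewrite ltr_wpDl ?absC_ge0.
have [dl1 dl10 F'] := F (e / 2 / K) (divr_gt0 (divr_gt0 e0 (ltr0Sn R 1)) K0).
have D0 : 0 < absC d + 1 by rewrite ltr_wpDl ?absC_ge0.
have [dl2 dl20 G'] := G1 (e / 2 / (absC d + 1)) (divr_gt0 (divr_gt0 e0 (ltr0Sn R 1)) D0).
exists (Num.min e1 (Num.min dl2 (dl1 / K))); first by rewrite !lt_min e10 dl20 divr_gt0.
move=> h; rewrite !lt_min => /and3P[h1 h2 h3].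
have Lh := L h h1.
have small : absC (g (z + h) - g z) < dl1.
  by rewrite (le_lt_trans Lh)// mulrC -ltr_pdivlMr.
have := F' _ small; rewrite [g z + _]addrC subrK => A.
have B := G' _ h2.
rewrite (_ : _ - _ - _ = (f (g (z + h)) - f (g z) - d * (g (z + h) - g z)) +
   d * (g (z + h) - g z - d' * h)); last by ring.
rewrite (le_trans (absCD _ _))// absCM.
have -> : e * absC h = e / 2 / K * (K * absC h) + (absC d + 1) * (e / 2 / (absC d + 1) * absC h).
  by field; rewrite !gt_eqF.
apply: lerD; first by rewrite (le_trans A)// ler_wpM2l// ltW// !divr_gt0.
by rewrite ler_pM ?absC_ge0// lerDl.
Qed.

Lemma hdV f z d : f z != 0 -> hd f z d -> hd (fun w => (f w)^-1) z (- d / f z ^+ 2).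
Proof.
move=> f0 h; have [h1 h2] := h.
split; first exact: (derivableV f0 h1).
have := deriveV f0 h1; rewrite h2 => ->; rewrite /GRing.scale /=.
by rewrite mulrC mulNr mulrN.
Qed.

Lemma hd_div f g z d d' : g z != 0 -> hd f z d -> hd g z d' ->
  hd (fun w => f w / g w) z ((d * g z - f z * d') / g z ^+ 2).
Proof.
move=> g0 h1 h2; apply: (hd_eq (hdM h1 (hdV g0 h2))).
by field.
Qed.

End Derivative.

Section RealDerivative.
Context {R : realType}.
Implicit Types (f g : R -> R) (t d : R).

Lemma rdP f t d : is_derive t 1 f d <->
  (forall e : R, 0 < e -> exists2 dl : R, 0 < dl &
     forall h, `|h| < dl -> `|f (t + h) - f t - d * h| <= e * `|h|).
Proof.
split.
  move=> [df vd] e e0.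
  have : ((fun h : R => h^-1 *: ((f \o shift t) (h *: 1) - f t)) @ 0^' --> 'D_1 f t)%classic by exact: df.
  move=> /cvgrPdist_le /(_ e e0); rewrite /dnbhs /within /= => /nbhs_ballP[dl /= dl0 H].
  exists dl => // h hd1.
  have [->|h0] := eqVneq h 0; first by rewrite addr0 subrr mulr0 subrr normr0 mulr0.
  have := H h; rewrite /ball /= sub0r normrN => /(_ hd1 h0).
  rewrite vd /GRing.scale /= mulr1 [h + t]addrC => le1.
  have -> : f (t + h) - f t - d * h = - (d - h^-1 * (f (t + h) - f t)) * h.
    by field.
  by rewrite normrM normrN ler_wpM2r.
move=> H.
have cv : ((fun h : R => h^-1 *: ((f \o shift t) (h *: 1) - f t)) @ 0^' --> d)%classic.
  apply/cvgrPdist_le => e e0.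
  have [dl dl0 H'] := H _ e0.
  rewrite /dnbhs /within /=; apply/nbhs_ballP; exists dl => //= h.
  rewrite /ball /= sub0r normrN => hdl h0.
  rewrite /GRing.scale /= mulr1 [h + t]addrC.
  have h1 : 0 < `|h| by rewrite normr_gt0.
  rewrite -(ler_pM2r h1) -normrM; apply: le_trans (H' _ hdl).
  rewrite -normrN le_eqVlt; apply/orP; left; apply/eqP; congr (`| _ |).
  by field.
have df : derivable f t 1 by apply/cvg_ex; exists d.
apply: DeriveDef df _; rewrite /derive; exact: (cvg_lim (@norm_hausdorff _ _) cv).
Qed.

End RealDerivative.

(** * The exponential e(z) *)

Section Exponential.
Lemma triangle_bounds {R : realType} (n a r1 p : R) : `|a| <= n -> `|r1| <= p -> n <= 1 -> p <= n ->
  `|1 + a + r1| <= 3.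
Proof. by have := normRD (1 + a) r1; have := normRD 1 a; rewrite normr1; lra. Qed.
Lemma triangle_bounds2 {R : realType} (n a r1 p e : R) : `|a| <= n -> `|r1| <= p -> n < e -> p <= n ->
  `|a + r1| <= 2 * e.
Proof. by have := normRD a r1; lra. Qed.
Context {R : realType}.
Implicit Types (z w : CC R) (x y t : R).

Definition tpi : R := 2 * pi.
Definition tpii : CC R := ofR (2 * pi) * 'i.

Lemma pi0 : 0 < pi :> R. Proof. exact: pi_gt0. Qed.
Lemma tpi0 : 0 < tpi. Proof. by rewrite /tpi mulr_gt0 ?pi0. Qed.
Lemma tpii0 : tpii != 0.
Proof. by rewrite -absC_gt0 /tpii absCM absC_i mulr1 absC_of gtr0_norm ?tpi0. Qed.
Lemma absC_tpii : absC tpii = tpi.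
Proof. by rewrite /tpii absCM absC_i mulr1 absC_of gtr0_norm ?tpi0. Qed.

Lemma cisD x y : cis (x + y) = cis x * cis y :> CC R.
Proof. by apply: eqC; rewrite /cis !simpRI ?cosD ?sinD; ring. Qed.
Lemma absC_cis x : absC (cis x : CC R) = 1.
Proof. by rewrite /absC /cis !simpRI cos2Dsin2 sqrtr1. Qed.
Lemma cis0 : cis 0 = 1 :> CC R.
Proof. by apply: eqC; rewrite /cis !simpRI ?cos0 ?sin0. Qed.
Lemma cisN x : cis (- x) = (cis x)^-1 :> CC R.
Proof.
have : cis x * cis (- x) = 1 :> CC R by rewrite -cisD subrr cis0.
by move=> h; exact/esym/mulr1_eq.
Qed.
Lemma cis_nat x n : cis (n%:R * x) = cis x ^+ n :> CC R.
Proof.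
elim: n => [|n IH]; first by rewrite mul0r cis0.
by rewrite mulrS mulrDl mul1r cisD IH exprS.
Qed.
Lemma cis_2pi : cis (2 * pi) = 1 :> CC R.
Proof. by apply: eqC; rewrite /cis !simpRI mulr_natl ?cos2pi ?sin2pi. Qed.

Lemma eeD x y : ee (x + y) = ee x * ee y :> CC R.
Proof. by rewrite /ee mulrDr cisD. Qed.
Lemma ee1 : ee 1 = 1 :> CC R. Proof. by rewrite /ee mulr1 cis_2pi. Qed.
Lemma ee0 : ee 0 = 1 :> CC R. Proof. by rewrite /ee mulr0 cis0. Qed.
Lemma absC_ee x : absC (ee x : CC R) = 1. Proof. exact: absC_cis. Qed.
Lemma ee_neq0 x : ee x != 0 :> CC R.
Proof. by rewrite -absC_gt0 absC_ee. Qed.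
Lemma eeN x : ee (- x) = (ee x)^-1 :> CC R.
Proof. by rewrite /ee mulrN cisN. Qed.
Lemma ee_int (n : int) : ee (n%:~R) = 1 :> CC R.
Proof.
case: n => n; last rewrite NegzE rmorphN /= eeN; rewrite -?pmulrn.
  by rewrite /ee mulrC cis_nat cis_2pi expr1n.
by rewrite /ee mulrC cis_nat cis_2pi expr1n invr1.
Qed.

Lemma eCD z w : eC (z + w) = eC z * eC w.
Proof. by rewrite /eC !simpRI eeD mulrDr opprD expRD ofRM; ring. Qed.
Lemma eC0 : eC (0 : CC R) = 1.
Proof. by rewrite /eC !simpRI mulr0 oppr0 expR0 ee0 mulr1. Qed.
Lemma absC_eC z : absC (eC z) = expR (- (tpi * ImC z)).
Proof. by rewrite /eC absCM absC_ee mulr1 absC_of ger0_norm ?expR_ge0. Qed.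
Lemma eC_neq0 z : eC z != 0.
Proof. by rewrite -absC_gt0 absC_eC expR_gt0. Qed.
Lemma eCN z : eC (- z) = (eC z)^-1.
Proof.
have : eC z * eC (- z) = 1 by rewrite -eCD subrr eC0.
by move=> h; exact/esym/mulr1_eq.
Qed.
Lemma eCB z w : eC (z - w) = eC z / eC w.
Proof. by rewrite eCD eCN. Qed.
Lemma eC_real x : eC (ofR x) = ee x.
Proof. by rewrite /eC !simpRI mulr0 oppr0 expR0 mul1r. Qed.
Lemma eC1 : eC (1 : CC R) = 1. Proof. by rewrite -ofR1 eC_real ee1. Qed.
Lemma eC_nat z n : eC (n%:R * z) = eC z ^+ n.
Proof.
elim: n => [|n IH]; first by rewrite mul0r eC0.
by rewrite mulrS mulrDl mul1r eCD IH exprS.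
Qed.

(** Only the point 0 needs estimates; the addition formula carries the result elsewhere. There exp,
    cos and sin are replaced by [1 + a], [1] and [b], with errors at most [e1 * n], and the real and
    imaginary parts are bounded separately. *)
Lemma hd_eC0 : hd eC 0 tpii.
Proof.
apply/hdP => e e0.
(* The errors add up to at most [9 * (e1 * n)], 4 from the real and 5 from the imaginary part; the
   factor 10 absorbs them. *)
pose e1 : R := Num.min (1 : R) (e / (10 * tpi)).
have t0 := tpi0.
have e10 : 0 < e1 by apply: min_gt0; rewrite ?divr_gt0// mulr_gt0.
have e11 : e1 <= 1 by exact: minle1.
have e1e : e1 * (10 * tpi) <= e.
  rewrite -ler_pdivlMr; first exact: minle2.
  exact: mulr_gt0.
clearbody e1.
have /rdP/(_ _ e10)[d1 d10 X1] : is_derive (0 : R) 1 expR 1.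
  by have := @is_derive_expR R 0; rewrite expR0.
have /rdP/(_ _ e10)[d2 d20 X2] : is_derive (0 : R) 1 cos 0.
  by have := @is_derive_cos R 0; rewrite sin0 oppr0.
have /rdP/(_ _ e10)[d3 d30 X3] : is_derive (0 : R) 1 sin 1.
  by have := @is_derive_sin R 0; rewrite cos0.
pose dl : R := Num.min e1 (Num.min d1 (Num.min d2 d3)).
have dl0 : 0 < dl by do !apply: min_gt0.
exists (dl / tpi); first by rewrite divr_gt0.
move=> h; rewrite ltr_pdivlMr// => hd1.
pose a := - (tpi * ImC h); pose b := tpi * ReC h.
have ha : `|a| <= tpi * absC h.
  by rewrite /a normrN normrM gtr0_norm// ler_pM2l// Im_absC.
have hb : `|b| <= tpi * absC h.
  by rewrite /b normrM gtr0_norm// ler_pM2l// Re_absC.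
pose n := tpi * absC h; rewrite -/n in ha hb.
have n0 : 0 <= n by rewrite mulr_ge0 ?absC_ge0// ltW.
have ndl : n < dl by rewrite /n mulrC.
have n1 : n < e1 by apply: lt_le_trans ndl (minle1 _ _).
have n2 : n < d1 by apply: lt_le_trans ndl (le_trans (minle2 _ _) (minle1 _ _)).
have n34 := le_trans (minle2 e1 (Num.min d1 (Num.min d2 d3))) (minle2 _ _).
have n3 : n < d2 by apply: lt_le_trans ndl (le_trans n34 (minle1 _ _)).
have n4 : n < d3 by apply: lt_le_trans ndl (le_trans n34 (minle2 _ _)).
have := X1 a (le_lt_trans ha n2); rewrite add0r expR0 mul1r => A1.
have := X2 b (le_lt_trans hb n3); rewrite add0r cos0 mul0r subr0 => A2.
have := X3 b (le_lt_trans hb n4); rewrite add0r sin0 mul1r subr0 => A3.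
have eE : eC h = ofR (expR a) * cis b by [].
rewrite add0r eC0 (le_trans (absC_le_ReIm _))//.
have -> : ReC (eC h - 1 - tpii * h) = expR a * cos b - 1 - a.
  by rewrite eE /cis !simpRI /a /tpi; ring.
have -> : ImC (eC h - 1 - tpii * h) = expR a * sin b - b.
  by rewrite eE /cis !simpRI /b /tpi; ring.
have nE : n = tpi * absC h by [].
clearbody n.
move: A1 A2 A3; set r1 := expR a - 1 - a; set r2 := cos b - 1; set r3 := sin b - b => A1 A2 A3.
have -> : expR a = 1 + a + r1 by rewrite /r1; ring.
have -> : cos b = 1 + r2 by rewrite /r2; ring.
have -> : sin b = b + r3 by rewrite /r3; ring.
have B1 : `|r1| <= e1 * n by rewrite (le_trans A1)// ler_pM2l.
have B2 : `|r2| <= e1 * n by rewrite (le_trans A2)// ler_pM2l.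
have B3 : `|r3| <= e1 * n by rewrite (le_trans A3)// ler_pM2l.
have n1' : n <= 1 by rewrite (le_trans (ltW n1)).
have en : e1 * n <= n by rewrite ler_piMl.
have C1 : `|1 + a + r1| <= 3 by apply: (triangle_bounds ha B1).
have -> : (1 + a + r1) * (1 + r2) - 1 - a = r1 + (1 + a + r1) * r2 by ring.
have -> : (1 + a + r1) * (b + r3) - b = (a + r1) * b + (1 + a + r1) * r3 by ring.
have D1 : `|(1 + a + r1) * r2| <= 3 * (e1 * n) by rewrite normrM ler_pM.
have D2 : `|(1 + a + r1) * r3| <= 3 * (e1 * n) by rewrite normrM ler_pM.
have D3 : `|(a + r1) * b| <= (2 * e1) * n.
  by rewrite normrM ler_pM//; apply: (triangle_bounds2 ha B1 n1).
have := normRD r1 ((1 + a + r1) * r2).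
have := normRD ((a + r1) * b) ((1 + a + r1) * r3).
have : e * absC h >= 10 * (e1 * n).
  rewrite nE (_ : 10 * _ = e1 * (10 * tpi) * absC h); last by ring.
  by rewrite ler_wpM2r ?absC_ge0.
have : 0 <= e1 * n by rewrite mulr_ge0// ltW.
lra.
Qed.

Lemma hd_eC z : hd eC z (tpii * eC z).
Proof.
have h1 : hd (fun w => w - z) z 1.
  by apply: (hd_eq (hdB (hd_id z) (hd_cst z z))); rewrite subr0.
have h2 : hd eC (z - z) tpii by rewrite subrr; exact: hd_eC0.
have h3 := hdZ (eC z) (@hd_comp _ eC (fun w => w - z) z _ _ h2 h1).
rewrite (_ : eC = fun w => eC z * eC (w - z)); last first.
  by apply/funext => w; rewrite -eCD addrC subrK.
by apply: (hd_eq h3); rewrite subrr eC0 !mulr1 mulrC.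
Qed.

Lemma hd_eCl (c : CC R) z : hd (fun w => eC (c * w)) z (tpii * c * eC (c * z)).
Proof.
have h := @hd_comp _ eC (fun w => c * w) z _ _ (hd_eC (c * z)) (hdZ c (hd_id z)).
by apply: (hd_eq h); ring.
Qed.

(** The modulus forces [ImC z = 0]; then the absolute value of the angle is at most pi, where cos is
    injective. *)
Lemma eC_eq1 z : `|ReC z| <= 1 / 2 -> eC z = 1 -> z = 0.
Proof.
move=> rz e1; have t0 := tpi0.
have im0 : ImC z = 0.
  have := absC_eC z; rewrite e1 absC1 => /esym/eqP; rewrite -expR0 => /eqP/expR_inj/eqP.
  by rewrite oppr_eq0 mulf_eq0 gt_eqF//= => /eqP.
apply: eqC => //; move: e1; rewrite /eC im0 mulr0 oppr0 expR0 mul1r /ee => c1.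
have c2 : cos (2 * pi * ReC z) = 1 by rewrite -[LHS]/(ReC (cis _)) c1.
have c3 : cos `|2 * pi * ReC z| = cos 0.
  by rewrite cos0; case: (ler0P (2 * pi * ReC z)) => _; rewrite ?cosN.
have nn : `|2 * pi * ReC z| = tpi * `|ReC z| by rewrite normrM gtr0_norm.
have /eqP : `|2 * pi * ReC z| = 0.
  apply: cos_inj c3; rewrite in_itv /= ?lexx ?pi_ge0// normr_ge0 nn /=.
  by rewrite (le_trans (ler_wpM2l (ltW t0) rz))// /tpi; have := pi0; lra.
by rewrite normr_eq0 mulf_eq0 gt_eqF//= => /eqP ->.
Qed.

End Exponential.

(** * Integrals and Goursat's theorem *)

Section Primitive.
Context {R : realType}.
Implicit Types (f g F G : R -> R).

Lemma is_derive_cont F (x d : R) : is_derive x 1 F d -> {for x, continuous F}.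
Proof. by move=> h; apply: differentiable_continuous; apply/derivable1_diffP; case: h. Qed.

Lemma mvt_diff F f (a b : R) : a < b -> (forall x : R, a <= x <= b -> is_derive x 1 F (f x)) ->
  exists2 c, a <= c <= b & F b - F a = f c * (b - a).
Proof.
move=> ab dF; have [|x|c + ->] := @MVT R F f a b ab.
- by move=> x; rewrite in_itv /= => /andP[h1 h2]; apply: dF; rewrite !ltW.
- apply: continuous_in_subspaceT => {}x; rewrite inE /= in_itv /= => h.
  exact: (is_derive_cont (dF x h)).
- by rewrite in_itv /= => /andP[h1 h2]; exists c => //; rewrite !ltW.
Qed.

Lemma derive0_const F (a b : R) : (forall x : R, a <= x <= b -> is_derive x 1 F 0) -> a <= b -> F b = F a.
Proof.
move=> h; rewrite le_eqVlt => /predU1P[->//|ab].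
have [c _ /eqP] := @mvt_diff F (fun _ => 0) a b ab h.
by rewrite mul0r subr_eq0 => /eqP.
Qed.

Lemma prim_right f (A : R) : continuous f -> exists G, forall x : R, A < x -> is_derive x 1 G (f x).
Proof.
move=> cf; exists (fun x => \int[lebesgue_measure]_(t in [set` `[A, x]]) f t)%R => x Ax.
have [||h1 h2] := @continuous_FTC1_closed R f A x (x + 1) _ _ Ax (cf x).
- by rewrite ltrDl.
- apply: continuous_compact_integrable; first exact: segment_compact.
  by apply: continuous_subspaceT.
- by apply: DeriveDef h1 _; rewrite -derive1E; exact: h2.
Qed.

Lemma is_derive_refl F (x d : R) : is_derive (- x) 1 F d -> is_derive x 1 (fun t => - F (- t)) d.
Proof.
move=> /rdP H; apply/rdP => e /H[dl dl0 H']; exists dl => // h hd.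
rewrite -(normrN h) in hd *.
have := H' _ hd; have -> : F (- x + - h) - F (- x) - d * - h = - (- F (- (x + h)) - - F (- x) - d * h).
  by rewrite [- (x + h)]opprD; ring.
by rewrite !normrN.
Qed.

(** The fundamental theorem gives a primitive to the right of a base point, and reflection gives one
    to the left. Both are normalized to vanish at 0, so they agree on (-1, 1) and can be glued
    there. *)
Lemma prim_ex f : continuous f -> exists G, forall x : R, is_derive x 1 G (f x).
Proof.
move=> cf; have [G1 h1] := prim_right (-1) cf.
have cf' : continuous (fun x : R => f (- x)).
  by move=> x; apply: (@continuous_comp _ _ _ -%R f); [exact: opp_continuous|exact: cf].
have [G2 h2] := prim_right (-1) cf'.
pose H1 x := G1 x - G1 0; pose H2 x := - (G2 (- x) - G2 0).
have d1 (x : R) : -1 < x -> is_derive x 1 H1 (f x).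
  by move=> /h1 h; apply: is_derive_eq; rewrite subr0.
have d2 (x : R) : x < 1 -> is_derive x 1 H2 (f x).
  move=> x1; have h : is_derive (- x) 1 (fun y => G2 y - G2 0) (f x).
    have := h2 (- x); rewrite ltrN2 opprK => /(_ x1) h.
    by apply: is_derive_eq; rewrite subr0.
  exact: (is_derive_refl h).
have e12 (x : R) : -1 < x < 1 -> H1 x = H2 x.
  have key (a b : R) : -1 < a -> b < 1 -> a <= b -> H1 b - H2 b = H1 a - H2 a.
    move=> ha hb; apply: (@derive0_const (fun x => H1 x - H2 x)) => y /andP[y1 y2].
    have h3 := d1 y (lt_le_trans ha y1); have h4 := d2 y (le_lt_trans y2 hb).
    by apply: is_derive_eq; rewrite subrr.
  have z0 : H1 0 - H2 0 = 0 by rewrite /H1 /H2 oppr0 !subrr oppr0 subrr.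
  move=> /andP[x1 x2]; apply/eqP; rewrite -subr_eq0; apply/eqP.
  case: (leP 0 x) => x0; first by rewrite (key 0 x).
  by rewrite -(key x 0)// ltW.
exists (fun x => if x < 0 then H2 x else H1 x) => x.
case: (ltP x 0) => x0.
  have /rdP h := d2 x (lt_trans x0 ltr01).
  apply/rdP => e /h[dl dl0 H]; exists (Num.min dl (- x)); first by rewrite min_gt0 ?oppr_gt0.
  move=> k; rewrite lt_min => /andP[k1 k2].
  have k3 : x + k < 0 by move: k2; rewrite ltr_norml => /andP[]; lra.
  by rewrite x0 k3; exact: H.
have /rdP h := d1 x (lt_le_trans (ltrN10 R) x0).
apply/rdP => e /h[dl dl0 H]; exists (Num.min dl 1); first by rewrite min_gt0.
move=> k; rewrite lt_min => /andP[k1 k2].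
rewrite [x < 0]ltNge x0 /=; case: ifP => k3; last exact: H.
rewrite -e12; first exact: H.
by move: k2; rewrite ltr_norml => /andP[]; lra.
Qed.

Definition isprim F f := forall x : R, is_derive x 1 F (f x).

(* Integrals are only needed for continuous integrands: a difference of values of any primitive. *)
Definition rint f a b : R := let G := get [set G | isprim G f]%classic in G b - G a.

Lemma prim_uniq F G f a b : isprim F f -> isprim G f -> F b - F a = G b - G a.
Proof.
move=> hF hG; have key (x y : R) : x <= y -> F y - G y = F x - G x.
  apply: (@derive0_const (fun x => F x - G x)) => z _.
  have h1 := hF z; have h2 := hG z.
  by apply: is_derive_eq; rewrite subrr.
by case: (leP a b) => [/key|/ltW/key]; lra.
Qed.

Lemma rintE F f a b : isprim F f -> rint f a b = F b - F a.
Proof.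
move=> hF; rewrite /rint; refine (prim_uniq _ _ _ hF).
have := @getPex _ [set G | isprim G f]%classic; apply; exists F; exact: hF.
Qed.

Lemma rint_bound f a b M : continuous f -> a <= b -> (forall t, a <= t <= b -> `|f t| <= M) ->
  `|rint f a b| <= M * (b - a).
Proof.
move=> /prim_ex[F hF] ab h; rewrite (rintE _ _ hF).
move: ab; rewrite le_eqVlt => /predU1P[->|ab]; first by rewrite !subrr normr0 mulr0.
have [c cab ->] := mvt_diff ab (fun x _ => hF x).
by rewrite normrM (gtr0_norm (_ : 0 < b - a)) ?subr_gt0// ler_pM2r ?subr_gt0// h.
Qed.

End Primitive.

Section ComplexIntegral.
Context {R : realType}.
Implicit Types (f g F G : R -> CC R) (a b c t : R).

Definition cprim F f := isprim (fun t => ReC (F t)) (fun t => ReC (f t)) /\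
  isprim (fun t => ImC (F t)) (fun t => ImC (f t)).
Definition ccont f := continuous (fun t => ReC (f t)) /\ continuous (fun t => ImC (f t)).
Definition cint f a b : CC R := mkC (rint (fun t => ReC (f t)) a b) (rint (fun t => ImC (f t)) a b).

Lemma cprim_ex f : ccont f -> exists F, cprim F f.
Proof.
move=> [/prim_ex[F hF] /prim_ex[G hG]]; exists (fun t => mkC (F t) (G t)).
by split.
Qed.

Lemma cintE F f a b : cprim F f -> cint f a b = F b - F a.
Proof.
move=> [h1 h2]; rewrite /cint (rintE _ _ h1) (rintE _ _ h2).
by apply: eqC; rewrite !simpRI.
Qed.

Lemma cint_split f a b c : ccont f -> cint f a c = cint f a b + cint f b c.
Proof. by move=> /cprim_ex[F h]; rewrite !(cintE _ _ h); ring. Qed.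

Lemma cprimD F f G g : cprim F f -> cprim G g -> cprim (fun t => F t + G t) (fun t => f t + g t).
Proof.
move=> [h1 h2] [h3 h4]; split => t.
  have k1 := h1 t; have k2 := h3 t.
  rewrite (_ : (fun t => _) = (fun t => ReC (F t) + ReC (G t))); last by apply/funext => s; rewrite ReD.
  by apply: is_derive_eq; rewrite ReD.
have k1 := h2 t; have k2 := h4 t.
rewrite (_ : (fun t => _) = (fun t => ImC (F t) + ImC (G t))); last by apply/funext => s; rewrite ImD.
by apply: is_derive_eq; rewrite ImD.
Qed.

Lemma cprimZ (k : CC R) F f : cprim F f -> cprim (fun t => k * F t) (fun t => k * f t).
Proof.
move=> [h1 h2]; split => t.
  have k1 := h1 t; have k2 := h2 t.
  rewrite (_ : (fun t => _) = (fun t => ReC k * ReC (F t) - ImC k * ImC (F t))); last by apply/funext => s; rewrite ReM.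
  have k3 : is_derive t 1 (fun t => ReC k * ReC (F t)) (ReC k * ReC (f t)) by exact: (is_deriveZ (ReC k) k1).
  have k4 : is_derive t 1 (fun t => ImC k * ImC (F t)) (ImC k * ImC (f t)) by exact: (is_deriveZ (ImC k) k2).
  by rewrite ReM; exact: (is_deriveB k3 k4).
have k1 := h1 t; have k2 := h2 t.
rewrite (_ : (fun t => _) = (fun t => ReC k * ImC (F t) + ImC k * ReC (F t))); last by apply/funext => s; rewrite ImM.
have k3 : is_derive t 1 (fun t => ReC k * ImC (F t)) (ReC k * ImC (f t)) by exact: (is_deriveZ (ReC k) k2).
have k4 : is_derive t 1 (fun t => ImC k * ReC (F t)) (ImC k * ReC (f t)) by exact: (is_deriveZ (ImC k) k1).
by rewrite ImM; exact: (is_deriveD k3 k4).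
Qed.

Lemma cintD f g a b : ccont f -> ccont g -> cint (fun t => f t + g t) a b = cint f a b + cint g a b.
Proof.
move=> /cprim_ex[F h1] /cprim_ex[G h2].
by rewrite (cintE _ _ (cprimD h1 h2)) (cintE _ _ h1) (cintE _ _ h2); ring.
Qed.

Lemma cintZ k f a b : ccont f -> cint (fun t => k * f t) a b = k * cint f a b.
Proof.
move=> /cprim_ex[F h1].
by rewrite (cintE _ _ (cprimZ k h1)) (cintE _ _ h1); ring.
Qed.

(** The factor 2 is the price for bounding real and imaginary parts separately; every later use has
    room for it. *)
Lemma cint_bound f a b M : ccont f -> a <= b -> (forall t, a <= t <= b -> absC (f t) <= M) ->
  absC (cint f a b) <= 2 * M * (b - a).
Proof.
move=> [c1 c2] ab h; rewrite (le_trans (absC_le_ReIm _))// /cint Re_mk Im_mk.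
rewrite -mulrA [_ * (M * _)]mulr_natl mulr2n; apply: lerD; apply: rint_bound => // t ht;
  rewrite (le_trans _ (h t ht))//; [exact: Re_absC|exact: Im_absC].
Qed.

Lemma ccontD f g : ccont f -> ccont g -> ccont (fun t => f t + g t).
Proof.
move=> [h1 h2] [h3 h4]; split => t.
  rewrite (_ : (fun t => _) = (fun t => ReC (f t) + ReC (g t))); last by apply/funext => s; rewrite ReD.
  by apply: cvgD; [exact: h1|exact: h3].
rewrite (_ : (fun t => _) = (fun t => ImC (f t) + ImC (g t))); last by apply/funext => s; rewrite ImD.
by apply: cvgD; [exact: h2|exact: h4].
Qed.

Lemma ccontP f : (forall t (e : R), 0 < e -> exists2 d : R, 0 < d &
  forall s, `|s - t| < d -> absC (f s - f t) <= e) -> ccont f.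
Proof.
move=> H; split => t; apply/cvgrPdist_le => e e0; have [d d0 H'] := H t e e0;
  apply/nbhs_ballP; exists d => //= s; rewrite /ball /= distrC => /H' h.
  by rewrite -ReB (le_trans (Re_absC _))// absCB.
by rewrite -ImB (le_trans (Im_absC _))// absCB.
Qed.

Lemma ccont_eps f : ccont f -> (forall t (e : R), 0 < e -> exists2 d : R, 0 < d &
  forall s, `|s - t| < d -> absC (f s - f t) <= e).
Proof.
move=> [h1 h2] t e e0; have e2 : 0 < e / 2 by rewrite divr_gt0.
have := h1 t; move=> /cvgrPdist_le/(_ _ e2)/nbhs_ballP[d1 /= d10 H1].
have := h2 t; move=> /cvgrPdist_le/(_ _ e2)/nbhs_ballP[d2 /= d20 H2].
exists (Num.min d1 d2); first exact: min_gt0.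
move=> s; rewrite lt_min => /andP[s1 s2].
have {}H1 := H1 s; have {}H2 := H2 s; rewrite /ball /= distrC in H1 H2.
rewrite (le_trans (absC_le_ReIm _))// ReB ImB distrC [X in _ + X]distrC.
by have := H1 s1; have := H2 s2; lra.
Qed.

Lemma ccont_cst (c : CC R) : ccont (fun _ => c).
Proof. by apply: ccontP => t e e0; exists 1 => // s _; rewrite subrr absC0 ltW. Qed.

Lemma ccontM f g : ccont f -> ccont g -> ccont (fun t => f t * g t).
Proof.
move=> [h1 h2] [h3 h4]; split => t.
  rewrite (_ : (fun t => _) = (fun t => ReC (f t) * ReC (g t) - ImC (f t) * ImC (g t))); last by apply/funext => s; rewrite ReM.
  by apply: cvgB; apply: cvgM; [exact: h1|exact: h3|exact: h2|exact: h4].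
rewrite (_ : (fun t => _) = (fun t => ReC (f t) * ImC (g t) + ImC (f t) * ReC (g t))); last by apply/funext => s; rewrite ImM.
by apply: cvgD; apply: cvgM; [exact: h1|exact: h4|exact: h2|exact: h3].
Qed.

End ComplexIntegral.

(** * Goursat's theorem on rectangles *)

Section Goursat.
Context {R : realType}.
Implicit Types (F : CC R -> CC R) (z w v : CC R) (a b c d t : R).

Lemma hd_line F z v t (D : CC R) : hd F (z + ofR t * v) D ->
  is_derive t 1 (fun s => ReC (F (z + ofR s * v))) (ReC (D * v)) /\
  is_derive t 1 (fun s => ImC (F (z + ofR s * v))) (ImC (D * v)).
Proof.
have [->|v0] := eqVneq v 0.
  move=> _; rewrite mulr0 Re0 Im0.
  under eq_fun do rewrite mulr0 addr0.
  by under [X in _ /\ is_derive _ _ X _]eq_fun do rewrite mulr0 addr0; split; exact: is_derive_cst.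
have v1 : 0 < absC v by rewrite absC_gt0.
move=> /hdP H.
have key (e : R) : 0 < e -> exists2 dl : R, 0 < dl & forall h : R, `|h| < dl ->
   absC (F (z + ofR (t + h) * v) - F (z + ofR t * v) - D * v * ofR h) <= e * `|h|.
  move=> e0; have [dl dl0 H'] := H (e / absC v) (divr_gt0 e0 v1).
  exists (dl / absC v); first exact: divr_gt0.
  move=> h; rewrite ltr_pdivlMr// => hd1.
  have := H' (ofR h * v); rewrite absCM absC_of => /(_ hd1).
  rewrite (_ : z + ofR t * v + ofR h * v = z + ofR (t + h) * v); last by rewrite ofRD; ring.
  rewrite (_ : D * (ofR h * v) = D * v * ofR h); last by ring.
  by rewrite (_ : e / absC v * (`|h| * absC v) = e * `|h|)//; field; rewrite gt_eqF.
split; apply/rdP => e /key[dl dl0 H']; exists dl => // h /H' h1; apply: le_trans h1.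
  rewrite (_ : _ - _ - _ = ReC (F (z + ofR (t + h) * v) - F (z + ofR t * v) - D * v * ofR h)).
    exact: Re_absC.
  by rewrite !ReD !ReN [in RHS]ReM Re_of Im_of mulr0 subr0.
rewrite (_ : _ - _ - _ = ImC (F (z + ofR (t + h) * v) - F (z + ofR t * v) - D * v * ofR h)).
  exact: Im_absC.
by rewrite !ImD !ImN [in RHS]ImM Re_of Im_of mulr0 add0r.
Qed.

Lemma hline F (G : CC R -> CC R) y : (forall w, hd F w (G w)) ->
  cprim (fun t => F (mkC t y)) (fun t => G (mkC t y)).
Proof.
move=> H; have E t : mkC t y = mkC 0 y + ofR t * 1.
  by apply: eqC; rewrite !simpRI; ring.
have -> : (fun t => F (mkC t y)) = fun t => F (mkC 0 y + ofR t * 1).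
  by apply/funext => t; rewrite E.
by split => t /=; rewrite (E t) -[G _]mulr1; case: (hd_line (H (mkC 0 y + ofR t * 1))).
Qed.

Lemma vline F (G : CC R -> CC R) x : (forall w, hd F w (G w)) ->
  cprim (fun t => F (mkC x t)) (fun t => 'i * G (mkC x t)).
Proof.
move=> H; have E t : mkC x t = mkC x 0 + ofR t * 'i.
  by apply: eqC; rewrite !simpRI; ring.
have -> : (fun t => F (mkC x t)) = fun t => F (mkC x 0 + ofR t * 'i).
  by apply/funext => t; rewrite E.
by split => t /=; rewrite (E t) ['i * _]mulrC; case: (hd_line (H (mkC x 0 + ofR t * 'i))).
Qed.

Variable f : R -> R -> CC R.
Hypothesis cx : forall y, ccont (fun x => f x y).
Hypothesis cy : forall x, ccont (fun y => f x y).

(** The integral of g dz along the positively oriented boundary; the factor ['i] comes from dz = i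
    dy on the vertical sides. *)
Definition rectint (g : R -> R -> CC R) a b c d : CC R :=
  cint (fun x => g x c) a b + 'i * cint (fun y => g b y) c d
  - cint (fun x => g x d) a b - 'i * cint (fun y => g a y) c d.

Lemma rectint_quarters a m b c k d : rectint f a b c d =
  rectint f a m c k + rectint f m b c k + rectint f a m k d + rectint f m b k d.
Proof.
rewrite /rectint (cint_split a m b (cx c)) (cint_split a m b (cx d)).
by rewrite (cint_split c k d (cy a)) (cint_split c k d (cy b)); ring.
Qed.

(** The affine function [B + A * (w - mkC p q)] has a primitive, so its boundary integral vanishes
    and only the error of the approximation contributes. *)
Lemma rectint_approx a b c d p q (A B : CC R) (eta : R) : a <= b -> c <= d ->
  (forall x y, a <= x <= b -> c <= y <= d ->
     absC (f x y - B - A * mkC (x - p) (y - q)) <= eta) ->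
  absC (rectint f a b c d) <= 4 * eta * ((b - a) + (d - c)).
Proof.
move=> ab cd H.
pose G w := B + A * (w - mkC p q).
pose F w := B * w + A * ((w - mkC p q) ^+ 2 / 2).
have FG w : hd F w (G w).
  have h0 := hdB (hd_id w) (hd_cst (mkC p q) w).
  have h1 := hdZ B (hd_id w).
  have h2 := hdZ A (hdM (hdX 2 h0) (hd_cst (2^-1) w)).
  by apply: (hd_eq (hdD h1 h2)); rewrite /G /=; field.
pose g x y := f x y - G (mkC x y).
have gE x y : f x y = g x y + G (mkC x y) by rewrite /g subrK.
have cGx y : ccont (fun x => G (mkC x y)).
  apply: ccontP => t e e0; have /hd_lip[d1 d10 L] : hd G (mkC t y) A.
    have h0 := hdB (hd_id (mkC t y)) (hd_cst (mkC p q) (mkC t y)).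
    by apply: (hd_eq (hdD (hd_cst B (mkC t y)) (hdZ A h0))); ring.
  have K0 : 0 < absC A + 1 by rewrite ltr_wpDl ?absC_ge0.
  exists (Num.min d1 (e / (absC A + 1))); first by rewrite min_gt0 ?divr_gt0.
  move=> s; rewrite lt_min ltr_pdivlMr// => /andP[s1 s2].
  have := L (ofR (s - t)); rewrite absC_of => /(_ s1).
  rewrite (_ : mkC t y + ofR (s - t) = mkC s y); last by apply: eqC; rewrite !simpRI; ring.
  by move=> /le_trans; apply; rewrite mulrC ltW.
have cGy x : ccont (fun y => G (mkC x y)).
  apply: ccontP => t e e0; have /hd_lip[d1 d10 L] : hd G (mkC x t) A.
    have h0 := hdB (hd_id (mkC x t)) (hd_cst (mkC p q) (mkC x t)).
    by apply: (hd_eq (hdD (hd_cst B (mkC x t)) (hdZ A h0))); ring.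
  have K0 : 0 < absC A + 1 by rewrite ltr_wpDl ?absC_ge0.
  exists (Num.min d1 (e / (absC A + 1))); first by rewrite min_gt0 ?divr_gt0.
  move=> s; rewrite lt_min ltr_pdivlMr// => /andP[s1 s2].
  have := L ('i * ofR (s - t)); rewrite absCM absC_i mul1r absC_of => /(_ s1).
  rewrite (_ : mkC x t + 'i * ofR (s - t) = mkC x s); last by apply: eqC; rewrite !simpRI; ring.
  by move=> /le_trans; apply; rewrite mulrC ltW.
have cN (h : R -> CC R) : ccont h -> ccont (fun t => - h t).
  move=> ch; rewrite (_ : (fun t => - h t) = fun t => (-1) * h t); last by apply/funext => t; rewrite mulN1r.
  exact: ccontM (ccont_cst _) ch.
have cgx y : ccont (fun x => g x y) by apply: ccontD (cx y) (cN _ (cGx y)).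
have cgy x : ccont (fun y => g x y) by apply: ccontD (cy x) (cN _ (cGy x)).
have split1 : rectint f a b c d = rectint g a b c d + rectint (fun x y => G (mkC x y)) a b c d.
  have hx y : cint (fun x => f x y) a b = cint (fun x => g x y) a b + cint (fun x => G (mkC x y)) a b.
    by rewrite -cintD//; congr cint; apply/funext => x; rewrite gE.
  have hy x : cint (fun y => f x y) c d = cint (fun y => g x y) c d + cint (fun y => G (mkC x y)) c d.
    by rewrite -cintD//; congr cint; apply/funext => y; rewrite gE.
  by rewrite /rectint !hx !hy; ring.
have zero : rectint (fun x y => G (mkC x y)) a b c d = 0.
  rewrite /rectint -!cintZ// !(cintE _ _ (hline _ FG)) !(cintE _ _ (vline _ FG)); ring.
rewrite split1 zero addr0.
have bd x y : a <= x <= b -> c <= y <= d -> absC (g x y) <= eta.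
  move=> h1 h2; have := H x y h1 h2; congr (absC _ <= _).
  rewrite /g /G (_ : mkC (x - p) (y - q) = mkC x y - mkC p q); first by ring.
  by apply: eqC; rewrite !simpRI.
have baa : a <= b <= b by rewrite ab lexx.
have aab : a <= a <= b by rewrite ab lexx.
have cdd : c <= d <= d by rewrite cd lexx.
have ccd : c <= c <= d by rewrite cd lexx.
have i1 : absC (cint (fun x => g x c) a b) <= 2 * eta * (b - a) by apply: cint_bound => // t ht; apply: bd.
have i2 : absC (cint (fun x => g x d) a b) <= 2 * eta * (b - a) by apply: cint_bound => // t ht; apply: bd.
have i3 : absC (cint (fun y => g a y) c d) <= 2 * eta * (d - c) by apply: cint_bound => // t ht; apply: bd.
have i4 : absC (cint (fun y => g b y) c d) <= 2 * eta * (d - c) by apply: cint_bound => // t ht; apply: bd.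
rewrite /rectint.
have t1 := absCBle (cint (g^~ c) a b + 'i * cint (g b) c d - cint (g^~ d) a b) ('i * cint (g a) c d).
have t2 := absCBle (cint (g^~ c) a b + 'i * cint (g b) c d) (cint (g^~ d) a b).
have t3 := absCD (cint (g^~ c) a b) ('i * cint (g b) c d).
move: t1 t2 t3; rewrite !absCM !absC_i !mul1r => t1 t2 t3.
by rewrite (_ : 4 * eta * (b - a + (d - c)) = 2 * eta * (b - a) + 2 * eta * (b - a)
   + 2 * eta * (d - c) + 2 * eta * (d - c)); [lra|ring].
Qed.

Lemma nested_point (u v : nat -> R) : (forall n, u n <= u n.+1) -> (forall n, v n.+1 <= v n) ->
  (forall n, u n <= v n) -> exists p, forall n, u n <= p <= v n.
Proof.
move=> hu hv uv.
have mu m n : (m <= n)%N -> u m <= u n.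
  by apply: (homo_leq (r := fun x y => x <= y)) => //; exact: le_trans.
have mv m n : (m <= n)%N -> v n <= v m.
  by apply: (homo_leq (r := fun x y => y <= x)) => // x y z h1 h2; exact: le_trans h2 h1.
have ub n : ubound (range u) (v n).
  move=> _ [m _ <-]; have [mn|/ltnW nm] := leqP m n.
    exact: le_trans (mu _ _ mn) (uv n).
  exact: le_trans (uv m) (mv _ _ nm).
exists (sup (range u)) => n; apply/andP; split.
  by apply: ub_le_sup; [exists (v 0%N); exact: ub|exists n].
by apply: ge_sup; [exists (u 0%N), 0%N|exact: ub].
Qed.

Lemma half_pow_small (L dl : R) : 0 < dl -> exists n, L / 2 ^+ n < dl.
Proof.
move=> dl0; have [L0|L0] := leP L 0.
  exists 0%N; rewrite expr0 divr1; exact: le_lt_trans L0 dl0.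
have h := archi_boundP (ltW (divr_gt0 L0 dl0)).
exists (Num.bound (L / dl)); rewrite ltr_pdivrMr ?exprn_gt0// mulrC -ltr_pdivrMr//.
by rewrite (lt_trans h)// -natrX ltr_nat ltn_expl.
Qed.

Variables (a0 b0 c0 d0 : R).
Hypotheses (ab0 : a0 < b0) (cd0 : c0 < d0).
(** Differentiability is relative to the closed rectangle: the functions used later are extended
    past it by clamping and need not be differentiable across its boundary. *)
Hypothesis dif : forall p q, a0 <= p <= b0 -> c0 <= q <= d0 -> exists A : CC R,
  forall e : R, 0 < e -> exists2 dl : R, 0 < dl &
    forall x y, a0 <= x <= b0 -> c0 <= y <= d0 -> `|x - p| < dl -> `|y - q| < dl ->
    absC (f x y - f p q - A * mkC (x - p) (y - q)) <= e * (`|x - p| + `|y - q|).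

Record rect := Rect { ra : R; rb : R; rc : R; rd : R }.
Let J r := rectint f (ra r) (rb r) (rc r) (rd r).
Let area r := (rb r - ra r) * (rd r - rc r).
Let child r s := [/\ ra r <= ra s, rb s <= rb r, rc r <= rc s & rd s <= rd r] /\
  (rb s - ra s = (rb r - ra r) / 2 /\ rd s - rc s = (rd r - rc r) / 2).

(** By bisection: if the integral is nonzero, some quarter keeps the same lower bound for integral
    per area. The nested quarters shrink to a point, where the affine approximation makes the
    integral too small. *)
Lemma goursat : rectint f a0 b0 c0 d0 = 0.
Proof.
apply/eqP; rewrite -absC_eq0; apply/negPn/negP => J0.
have hba : b0 - a0 != 0 by rewrite gt_eqF ?subr_gt0.
have hdc : d0 - c0 != 0 by rewrite gt_eqF ?subr_gt0.
pose r0 := Rect a0 b0 c0 d0.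
have ar0 : 0 < area r0 by rewrite mulr_gt0 ?subr_gt0.
have j0 : 0 < absC (J r0) by rewrite lt_def J0 absC_ge0.
pose e := absC (J r0) / (2 * area r0).
have e0 : 0 < e by rewrite divr_gt0// mulr_gt0.
(* The ratio of integral to area is the invariant, since it passes to a quarter with the same [e];
   [e] is half the initial ratio, so the inequality starts out strict. *)
pose bad r := [/\ ra r < rb r, rc r < rd r & e * area r < absC (J r)].
have bad0 : bad r0.
  split => //; rewrite /e (_ : _ * _ = absC (J r0) / 2); last by field; rewrite (gt_eqF ar0).
  by rewrite ltr_pdivrMr// mulr_natr mulr2n ltrDl.
(* The existence is stated for every rectangle, with the badness inside, so that [choice] returns a
   total function to iterate. *)
have step r : exists s, bad r -> child r s /\ bad s.
  have [hr|nr] := pselect (bad r); last by exists r => h; case: nr.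
  case: r hr => a b c d [/= ab cd hb].
  pose m := (a + b) / 2; pose k := (c + d) / 2.
  have am : a < m by rewrite /m; lra.
  have mb : m < b by rewrite /m; lra.
  have ck : c < k by rewrite /k; lra.
  have kd : k < d by rewrite /k; lra.
  apply: contrapT => no.
  have small s : child (Rect a b c d) s -> ra s < rb s -> rc s < rd s ->
      absC (J s) <= e * ((b - a) * (d - c) / 4).
    move=> ch h1 h2; rewrite leNgt; apply/negP => h3; apply: no; exists s => _; split => //.
    split => //; case: ch => _ /= [e1 e2]; apply: le_lt_trans h3.
    by rewrite /area e1 e2 /= (_ : _ / 2 * _ = (b - a) * (d - c) / 4)//; field.
  have q1 := small (Rect a m c k); have q2 := small (Rect m b c k).
  have q3 := small (Rect a m k d); have q4 := small (Rect m b k d).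
  move: hb; rewrite /J /= (rectint_quarters a m b c k d) ltNge => /negP; apply.
  have {}q1 : absC (rectint f a m c k) <= e * ((b - a) * (d - c) / 4).
    by apply: q1 => //; split; [split => /=; rewrite ?lexx ?ltW|split; rewrite /= /m /k; field].
  have {}q2 : absC (rectint f m b c k) <= e * ((b - a) * (d - c) / 4).
    by apply: q2 => //; split; [split => /=; rewrite ?lexx ?ltW|split; rewrite /= /m /k; field].
  have {}q3 : absC (rectint f a m k d) <= e * ((b - a) * (d - c) / 4).
    by apply: q3 => //; split; [split => /=; rewrite ?lexx ?ltW|split; rewrite /= /m /k; field].
  have {}q4 : absC (rectint f m b k d) <= e * ((b - a) * (d - c) / 4).
    by apply: q4 => //; split; [split => /=; rewrite ?lexx ?ltW|split; rewrite /= /m /k; field].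
  rewrite /area /=.
  have t1 := absCD (rectint f a m c k + rectint f m b c k + rectint f a m k d) (rectint f m b k d).
  have t2 := absCD (rectint f a m c k + rectint f m b c k) (rectint f a m k d).
  have t3 := absCD (rectint f a m c k) (rectint f m b c k).
  lra.
have [nxt nxtP] := choice step.
pose s n := iter n nxt r0.
have sbad n : bad (s n) by elim: n => [//|n IH]; case: (nxtP _ IH).
have sch n : child (s n) (s n.+1) by case: (nxtP _ (sbad n)).
have wx n : rb (s n) - ra (s n) = (b0 - a0) / 2 ^+ n.
  elim: n => [|n IH]; first by rewrite expr0 divr1.
  by case: (sch n) => _ [-> _]; rewrite IH exprS; field; rewrite expf_neq0.
have wy n : rd (s n) - rc (s n) = (d0 - c0) / 2 ^+ n.
  elim: n => [|n IH]; first by rewrite expr0 divr1.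
  by case: (sch n) => _ [_ ->]; rewrite IH exprS; field; rewrite expf_neq0.
have [p hp] : exists p, forall n, ra (s n) <= p <= rb (s n).
  apply: nested_point => n; last by case: (sbad n) => /ltW.
    by case: (sch n) => -[].
  by case: (sch n) => -[].
have [q hq] : exists p, forall n, rc (s n) <= p <= rd (s n).
  apply: nested_point => n; last by case: (sbad n) => _ /ltW.
    by case: (sch n) => -[].
  by case: (sch n) => -[].
have ins n : [/\ a0 <= ra (s n), rb (s n) <= b0, c0 <= rc (s n) & rd (s n) <= d0].
  elim: n => [|n [h1 h2 h3 h4]]; first by split.
  by case: (sch n) => -[k1 k2 k3 k4] _; split; [apply: le_trans k1|apply: le_trans k2 _|apply: le_trans k3|apply: le_trans k4 _].
have [A hA] := dif (hp 0%N) (hq 0%N).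
pose L := (b0 - a0) + (d0 - c0).
have L0 : 0 < L by rewrite addr_gt0 ?subr_gt0.
have L20 : 0 < 4 * L ^+ 2 by rewrite mulr_gt0// exprn_gt0.
(* Chosen so that [4 * e' * L ^+ 2] is half of [e * area r0]. *)
pose e' := e * area r0 / (2 * (4 * L ^+ 2)).
have e'0 : 0 < e' by apply: divr_gt0; apply: mulr_gt0.
have [dl dl0 H] := hA e' e'0.
have [n hn] := half_pow_small L dl0.
have P0 : 0 < 2 ^+ n :> R by rewrite exprn_gt0.
have [sx sy sb] := sbad n.
move: sb; rewrite ltNge => /negP; apply.
have [i1 i2 i3 i4] := ins n.
have wxL : rb (s n) - ra (s n) <= L / 2 ^+ n.
  by rewrite wx ler_pM2r ?invr_gt0// lerDl ltW// subr_gt0.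
have wyL : rd (s n) - rc (s n) <= L / 2 ^+ n.
  by rewrite wy ler_pM2r ?invr_gt0// lerDr ltW// subr_gt0.
have /andP[q1 q2] := hq n; have /andP[p1 p2] := hp n.
apply: le_trans (@rectint_approx _ _ _ _ p q A (f p q) (e' * (L / 2 ^+ n)) (ltW sx) (ltW sy) _) _.
  move=> x y /andP[x1 x2] /andP[y1 y2].
  have dx : `|x - p| <= (b0 - a0) / 2 ^+ n by rewrite -wx ler_norml; lra.
  have dy : `|y - q| <= (d0 - c0) / 2 ^+ n by rewrite -wy ler_norml; lra.
  have dxL : `|x - p| <= L / 2 ^+ n by rewrite (le_trans dx)// -wx.
  have dyL : `|y - q| <= L / 2 ^+ n by rewrite (le_trans dy)// -wy.
  apply: le_trans (H x y _ _ (le_lt_trans dxL hn) (le_lt_trans dyL hn)) _.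
  - by rewrite (le_trans i1 x1) (le_trans x2 i2).
  - by rewrite (le_trans i3 y1) (le_trans y2 i4).
  by rewrite ler_pM2l// /L mulrDl lerD.
rewrite /area wx wy -mulrDl -/L.
have -> : 4 * (e' * (L / 2 ^+ n)) * (L / 2 ^+ n) = e * area r0 / 2 / (2 ^+ n) ^+ 2.
  by rewrite /e'; field; rewrite ?(gt_eqF L0) ?(gt_eqF P0).
have -> : e * ((b0 - a0) / 2 ^+ n * ((d0 - c0) / 2 ^+ n)) = e * area r0 / (2 ^+ n) ^+ 2.
  by rewrite /area /=; field; rewrite ?(gt_eqF P0).
rewrite ler_pM2r ?invr_gt0 ?exprn_gt0// ler_pdivrMr// mulr_natr mulr2n lerDl ltW// mulr_gt0//.
Qed.

End Goursat.

(** * Power series and q-expansions *)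

Section PowerSeries.
Context {R : realType}.
Implicit Types (u v : nat -> CC R) (b : nat -> CC R) (q l a h : CC R) (r : R).

Definition ccvg u l := forall e : R, 0 < e -> exists N, forall n, (N <= n)%N -> absC (u n - l) <= e.

Lemma ccvg_uniq u l l' : ccvg u l -> ccvg u l' -> l = l'.
Proof.
move=> h1 h2; apply/eqP; rewrite -subr_eq0 -absC_eq0; apply/negPn/negP => n0.
have d0 : 0 < absC (l - l') by rewrite lt_def n0 absC_ge0.
have e0 : 0 < absC (l - l') / 4 by rewrite divr_gt0.
have [N1 H1] := h1 _ e0; have [N2 H2] := h2 _ e0.
have := H1 _ (leq_maxl N1 N2); have := H2 _ (leq_maxr N1 N2).
set w := u _ => A B; have := absCD (l - w) (w - l').
by rewrite addrA subrK absCB; lra.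
Qed.

Lemma ccvg_bound u l a (K : R) N0 : ccvg u l -> (forall n, (N0 <= n)%N -> absC (u n - a) <= K) ->
  absC (l - a) <= K.
Proof.
move=> h1 H; apply/ler_addgt0Pr => e e0; have [N1 H1] := h1 _ e0.
have := H1 _ (leq_maxr N0 N1); have := H _ (leq_maxl N0 N1).
set w := u _ => A B; have := absCD (l - w) (w - a).
by rewrite addrA subrK absCB; lra.
Qed.

Lemma ccvg_cst l : ccvg (fun=> l) l.
Proof. by move=> e e0; exists 0%N => n _; rewrite subrr absC0 ltW. Qed.

Lemma ccvg_eq u v l : (forall n, u n = v n) -> ccvg u l -> ccvg v l.
Proof. by move=> E h e /h[N H]; exists N => n /H; rewrite E. Qed.

Lemma ccvgD u v l l' : ccvg u l -> ccvg v l' -> ccvg (fun n => u n + v n) (l + l').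
Proof.
move=> h1 h2 e e0; have e2 : 0 < e / 2 by rewrite divr_gt0.
have [N1 H1] := h1 _ e2; have [N2 H2] := h2 _ e2.
exists (maxn N1 N2) => n; rewrite geq_max => /andP[/H1 A /H2 B].
have := absCD (u n - l) (v n - l'); rewrite (_ : u n - l + (v n - l') = u n + v n - (l + l')); last by ring.
by lra.
Qed.

Lemma ccvgZ (c : CC R) u l : ccvg u l -> ccvg (fun n => c * u n) (c * l).
Proof.
move=> h1 e e0; have c0 : 0 < absC c + 1 by rewrite ltr_wpDl ?absC_ge0.
have [N1 H1] := h1 _ (divr_gt0 e0 c0).
exists N1 => n /H1; rewrite -mulrBr absCM => A.
rewrite (le_trans (ler_wpM2l (absC_ge0 c) A))// mulrCA ler_piMr ?(ltW e0)//.
by rewrite ler_pdivrMr// mul1r lerDl.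
Qed.

Lemma ccvg_shift u l : ccvg (fun n => u n.+1) l -> ccvg u l.
Proof. by move=> h e /h[N H]; exists N.+1 => -[//|n] /H. Qed.

Lemma ccvg_limn u l : ccvg u l -> limn u = l.
Proof.
move=> h; apply: (cvg_lim (@norm_hausdorff _ _)).
apply/cvgrPdist_le => e e0.
have e1 : 0 < ReC e by move: e0; rewrite ltcE /= => /andP[].
have eE : e = ofR (ReC e).
  by move: e0; rewrite ltcE /= => /andP[/eqP h' _]; apply: eqC => //; rewrite Im_of -[RHS]h'.
have [N H] := h _ e1; exists N => // n /= /H.
by rewrite normCE eE lecE' absCB.
Qed.

Lemma norm_series_cvg u : cvgn (series (fun n => absC (u n))) ->
  exists l, ccvg (fun N => \sum_(n < N) u n) l.
Proof.
move=> h.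
have cR : cvgn (series (fun n => ReC (u n))).
  apply: normed_cvg; apply: (series_le_cvg _ _ _ h) => n //=; [exact: absC_ge0|exact: Re_absC].
have cI : cvgn (series (fun n => ImC (u n))).
  apply: normed_cvg; apply: (series_le_cvg _ _ _ h) => n //=; [exact: absC_ge0|exact: Im_absC].
have sR N : ReC (\sum_(n < N) u n) = series (fun n => ReC (u n)) N.
  by rewrite /series /= big_mkord; elim/big_ind2: _ => // x1 x2 y1 y2 <- <-; rewrite ReD.
have sI N : ImC (\sum_(n < N) u n) = series (fun n => ImC (u n)) N.
  by rewrite /series /= big_mkord; elim/big_ind2: _ => // x1 x2 y1 y2 <- <-; rewrite ImD.
move/cvg_ex: cR => [a /= ha]; move/cvg_ex: cI => [b /= hb].
exists (mkC a b) => e e0; have e2 : 0 < e / 2 by rewrite divr_gt0.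
move/cvgrPdist_le: ha => /(_ _ e2)[N1 _ H1]; move/cvgrPdist_le: hb => /(_ _ e2)[N2 _ H2].
exists (maxn N1 N2) => n; rewrite geq_max => /andP[/H1 A /H2 B].
rewrite (le_trans (absC_le_ReIm _))// ReB ImB sR sI Re_mk Im_mk distrC [X in _ + X]distrC.
by move: A B => /= A B; lra.
Qed.

Lemma geo_sum_le r N : 0 <= r < 1 -> \sum_(n < N) r ^+ n <= (1 - r)^-1.
Proof.
move=> /andP[r0 r1]; have d0 : 0 < 1 - r by rewrite subr_gt0.
rewrite -(ler_pM2l d0) mulfV ?gt_eqF//.
have -> : (1 - r) * \sum_(n < N) r ^+ n = 1 - r ^+ N.
  elim: N => [|N IH]; first by rewrite big_ord0 expr0; ring.
  by rewrite big_ord_recr /= mulrDr IH exprS; ring.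
by rewrite gerBl exprn_ge0.
Qed.

Lemma geo_cvg r (C : R) : 0 <= r < 1 -> cvgn (series (fun n => C * r ^+ n)).
Proof. by move=> /andP[r0 r1]; apply: is_cvg_geometric_series; rewrite ger0_norm. Qed.

(* The power series has radius of convergence at least 1. *)
Definition adm b := forall r, 0 < r < 1 -> exists C : R, forall n, absC (b n) * r ^+ n <= C.

Definition ps b q : CC R := get [set l | ccvg (fun N => \sum_(n < N) b n * q ^+ n) l]%classic.

Lemma between (x : R) : x < 1 -> 0 <= x -> exists r, x < r < 1 /\ 0 < r.
Proof. by move=> x1 x0; exists ((x + 1) / 2); lra. Qed.

Lemma adm_bound b r r' : adm b -> 0 < r < 1 -> 0 <= r' ->
  exists C : R, 0 <= C /\ forall n, absC (b n) * r' ^+ n <= C * (r' / r) ^+ n.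
Proof.
move=> hb hr r'0; have [C H] := hb _ hr; exists C; split.
  by apply: le_trans (H 0%N); rewrite mulr_ge0 ?absC_ge0// exprn_ge0// ltW//; case/andP: hr.
move=> n; have r0 : 0 < r by case/andP: hr.
have -> : absC (b n) * r' ^+ n = (absC (b n) * r ^+ n) * (r' / r) ^+ n.
  by rewrite expr_div_n; field; rewrite expf_neq0 ?gt_eqF.
by rewrite ler_wpM2r ?H// exprn_ge0// divr_ge0// ltW.
Qed.

Lemma ps_cvg b q : adm b -> absC q < 1 -> ccvg (fun N => \sum_(n < N) b n * q ^+ n) (ps b q).
Proof.
move=> hb q1; have [r [/andP[qr r1] r0]] := between q1 (absC_ge0 q).
have hr0 : 0 < r < 1 by rewrite r0.
have [C [C0 H]] := adm_bound hb hr0 (absC_ge0 q).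
have hr : 0 <= absC q / r < 1 by rewrite divr_ge0 ?absC_ge0 1?ltW//= ltr_pdivrMr// mul1r.
have [l hl] : exists l, ccvg (fun N => \sum_(n < N) b n * q ^+ n) l.
  apply: (@norm_series_cvg (fun n => b n * q ^+ n)).
  have h1 n : 0 <= absC (b n * q ^+ n) by exact: absC_ge0.
  have h2 n : 0 <= C * (absC q / r) ^+ n by rewrite mulr_ge0// exprn_ge0//; case/andP: hr.
  have h3 n : absC (b n * q ^+ n) <= C * (absC q / r) ^+ n by rewrite absCM absCX.
  exact: (series_le_cvg h1 h2 h3 (geo_cvg hr)).
by rewrite /ps; have := @getPex _ [set l | ccvg (fun N => \sum_(n < N) b n * q ^+ n) l]%classic; apply; exists l.
Qed.

Lemma psE b q l : ccvg (fun N => \sum_(n < N) b n * q ^+ n) l -> ps b q = l.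
Proof.
move=> h; apply: (ccvg_uniq _ h).
by have := @getPex _ [set l | ccvg (fun N => \sum_(n < N) b n * q ^+ n) l]%classic; apply; exists l.
Qed.

Lemma ps_bound b r : adm b -> 0 < r < 1 -> exists K : R, 0 <= K /\
  (forall q, absC q <= r -> absC (ps b q) <= K) /\
  (forall q N, absC q <= r -> \sum_(n < N) absC (b n) * absC q ^+ n <= K).
Proof.
move=> hb /andP[r0 r1]; have [s [/andP[rs s1] s0]] := between r1 (ltW r0).
have hs0 : 0 < s < 1 by rewrite s0.
have [C [C0 H]] := adm_bound hb hs0 (ltW r0).
have hr : 0 <= r / s < 1 by rewrite divr_ge0 ?ltW//= ltr_pdivrMr// mul1r.
have K0 : 0 < 1 - r / s by rewrite subr_gt0; case/andP: hr.
have key q N : absC q <= r -> \sum_(n < N) absC (b n) * absC q ^+ n <= C / (1 - r / s).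
  move=> qr; apply: le_trans (_ : \sum_(n < N) C * (r / s) ^+ n <= _).
    apply: ler_sum => n _; apply: le_trans (H n); rewrite ler_wpM2l ?absC_ge0//.
    by rewrite lerXn2r// nnegrE ?absC_ge0// ltW.
  by rewrite -mulr_sumr ler_wpM2l// geo_sum_le.
exists (C / (1 - r / s)); split; first by rewrite divr_ge0// ltW.
split => // q qr; rewrite -[ps b q]subr0; apply: (@ccvg_bound _ _ _ _ 0 (ps_cvg hb _)).
  exact: le_lt_trans qr r1.
move=> N _; rewrite subr0 (le_trans (absC_sum _ _ _))//; apply: le_trans (key q N qr).
by apply: ler_sum => n _; rewrite absCM absCX.
Qed.

(** Each of the n powers [s ^+ k] with [k < n] is at least [s ^+ n], and their sum is a geometric
    one. *)
Lemma nat_pow_le (s : R) n : 0 <= s < 1 -> n%:R * s ^+ n <= (1 - s)^-1.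
Proof.
move=> hs; apply: le_trans (geo_sum_le n hs).
rewrite (_ : n%:R * s ^+ n = \sum_(k < n) s ^+ n); last by rewrite sumr_const card_ord mulr_natl.
apply: ler_sum => k _; case/andP: hs => s0 s1.
by apply: ler_wiXn2l => //; [exact: ltW|exact: ltnW].
Qed.

Lemma adm_nat b : adm b -> adm (fun n => n%:R * b n).
Proof.
move=> hb r /andP[r0 r1]; have [s [/andP[rs s1] s0]] := between r1 (ltW r0).
have hs0 : 0 < s < 1 by rewrite s0.
have [C [C0 H]] := adm_bound hb hs0 (ltW r0).
have hr : 0 <= r / s < 1 by rewrite divr_ge0 ?ltW//= ltr_pdivrMr// mul1r.
exists (C * (1 - r / s)^-1) => n; rewrite absCM absCn -mulrA.
apply: le_trans (ler_wpM2l (ler0n _ n) (H n)) _.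
by rewrite mulrCA ler_wpM2l// nat_pow_le.
Qed.

Lemma adm_shift b : adm b -> adm (fun n => b n.+1).
Proof.
move=> hb r hr; have [C H] := hb r hr; have r0 : 0 < r by case/andP: hr.
exists (C / r) => n; rewrite ler_pdivlMr// -mulrA -exprSr; exact: H.
Qed.

Lemma admZ (c : CC R) b : adm b -> adm (fun n => c * b n).
Proof.
move=> hb r hr; have [C H] := hb r hr; exists (absC c * C) => n.
by rewrite absCM -mulrA ler_wpM2l ?absC_ge0.
Qed.

Lemma psZ (c : CC R) b q : adm b -> absC q < 1 -> ps (fun n => c * b n) q = c * ps b q.
Proof.
move=> hb q1; apply: psE; apply: ccvg_eq (ccvgZ c (ps_cvg hb q1)) => N.
by rewrite mulr_sumr; apply: eq_bigr => n _; rewrite mulrA.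
Qed.

Lemma ps_shift b q : adm b -> absC q < 1 -> q * ps (fun n => b n.+1) q = ps b q - b 0%N.
Proof.
move=> hb q1; apply/eqP; rewrite eq_sym subr_eq; apply/eqP; apply: psE.
apply: ccvg_shift; apply: ccvg_eq (ccvgD (ccvgZ q (ps_cvg (adm_shift hb) q1)) (ccvg_cst (b 0%N))) => N.
rewrite big_ord_recl expr0 mulr1 addrC; congr (_ + _).
by rewrite mulr_sumr; apply: eq_bigr => n _; rewrite exprS; ring.
Qed.

(** The second order Taylor remainder of a power. Multiplying by [rho ^+ 2] avoids the exponent n -
    2 and lets the induction start at 0. *)
Lemma pow_taylor (rho : R) q h n : absC q <= rho -> absC (q + h) <= rho ->
  absC ((q + h) ^+ n - q ^+ n - n%:R * q ^+ n.-1 * h) * rho ^+ 2 <= n%:R ^+ 2 * rho ^+ n * absC h ^+ 2.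
Proof.
move=> q1 q2; have rho0 : 0 <= rho := le_trans (absC_ge0 _) q1.
elim: n => [|n IH].
  by rewrite !expr0 subrr !mul0r subr0 absC0 expr0n /= !mul0r.
have -> : (q + h) ^+ n.+1 - q ^+ n.+1 - n.+1%:R * q ^+ n.+1.-1 * h =
  (q + h) * ((q + h) ^+ n - q ^+ n - n%:R * q ^+ n.-1 * h) + n%:R * q ^+ n.-1 * h ^+ 2.
  case: n {IH} => [|n]; first by rewrite /= !expr0 !expr1; ring.
  by rewrite /= !exprS [n.+2%:R]mulrS; ring.
set D := _ - _ in IH *.
rewrite (le_trans (ler_wpM2r (exprn_ge0 2 rho0) (absCD _ _)))// mulrDl.
have A : absC ((q + h) * D) * rho ^+ 2 <= rho * (n%:R ^+ 2 * rho ^+ n * absC h ^+ 2).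
  by rewrite absCM -mulrA ler_pM ?absC_ge0// mulr_ge0 ?absC_ge0 ?exprn_ge0.
have B : absC (n%:R * q ^+ n.-1 * h ^+ 2) * rho ^+ 2 <= n%:R * rho ^+ n.+1 * absC h ^+ 2.
  case: n {IH A D} => [|n]; first by rewrite !mul0r absC0 mul0r.
  rewrite !absCM !absCX absCn /=.
  have qn : absC q ^+ n <= rho ^+ n by rewrite lerXn2r// nnegrE ?absC_ge0.
  have -> : n.+1%:R * absC q ^+ n * absC h ^+ 2 * rho ^+ 2 =
    (n.+1%:R * (rho ^+ 2 * absC h ^+ 2)) * absC q ^+ n by ring.
  have -> : n.+1%:R * rho ^+ n.+2 * absC h ^+ 2 =
    (n.+1%:R * (rho ^+ 2 * absC h ^+ 2)) * rho ^+ n by rewrite !exprS expr0; ring.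
  by rewrite ler_wpM2l// mulr_ge0 ?ler0n// mulr_ge0 ?exprn_ge0 ?absC_ge0.
apply: le_trans (lerD A B) _.
have X0 : 0 <= rho ^+ n.+1 * absC h ^+ 2 by rewrite mulr_ge0 ?exprn_ge0 ?absC_ge0.
have -> : rho * (n%:R ^+ 2 * rho ^+ n * absC h ^+ 2) = n%:R ^+ 2 * (rho ^+ n.+1 * absC h ^+ 2).
  by rewrite [rho ^+ n.+1]exprS; ring.
rewrite -[n%:R * _ * _]mulrA -[n.+1%:R ^+ 2 * _ * _]mulrA -natr1.
by move: X0; set X := rho ^+ n.+1 * _ => X0; have := mulr_ge0 (ler0n R n) X0; lra.
Qed.

(** The Taylor remainders of the terms sum to at most [K / r ^+ 2 * absC h ^+ 2], where [K] bounds
    the partial sums of [n ^ 2 * absC (b n) * r ^+ n]. *)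
Lemma hd_ps b q : adm b -> absC q < 1 -> hd (ps b) q (ps (fun n => n.+1%:R * b n.+1) q).
Proof.
move=> hb q1; have [r [/andP[qr r1] r0]] := between q1 (absC_ge0 q).
have hr : 0 < r < 1 by rewrite r0.
have hb1 := adm_nat hb; have hb2 := adm_nat hb1.
have [K [K0 [_ HK]]] := ps_bound hb2 hr.
have r20 : 0 < r ^+ 2 by rewrite exprn_gt0.
have key h : absC h < r - absC q ->
    absC (ps b (q + h) - ps b q - ps (fun n => n.+1%:R * b n.+1) q * h) <= K / r ^+ 2 * absC h ^+ 2.
  move=> hh; have qh : absC (q + h) <= r by have := absCD q h; lra.
  have qh1 : absC (q + h) < 1 := le_lt_trans qh r1.
  have c1 := ps_cvg hb qh1; have c2 := ps_cvg hb q1; have c3 := ps_cvg (adm_shift hb1) q1; rewrite /= in c3.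
  have c1' : ccvg (fun N => \sum_(n < N.+1) b n * (q + h) ^+ n) (ps b (q + h)).
    by move=> e /c1[N H]; exists N => n /leqW/H.
  have c2' : ccvg (fun N => \sum_(n < N.+1) b n * q ^+ n) (ps b q).
    by move=> e /c2[N H]; exists N => n /leqW/H.
  have c := ccvgD (ccvgD c1' (ccvgZ (-1) c2')) (ccvgZ (-h) c3).
  move: (ps b (q + h)) (ps b q) (ps (fun n => n.+1%:R * b n.+1) q) c => s1 s2 s3 c.
  have -> : s1 - s2 - s3 * h = s1 + -1 * s2 + - h * s3 - 0 by ring.
  apply: (ccvg_bound (N0 := 0%N) c) => N _; rewrite subr0.
  have -> : \sum_(n < N.+1) b n * (q + h) ^+ n + -1 * (\sum_(n < N.+1) b n * q ^+ n) +
     - h * \sum_(n < N) n.+1%:R * b n.+1 * q ^+ n =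
     \sum_(n < N.+1) b n * ((q + h) ^+ n - q ^+ n - n%:R * q ^+ n.-1 * h).
    have -> : - h * (\sum_(n < N) n.+1%:R * b n.+1 * q ^+ n) =
        \sum_(n < N.+1) - (b n * (n%:R * q ^+ n.-1 * h)).
      rewrite big_ord_recl /= !mul0r mulr0 oppr0 add0r mulr_sumr; apply: eq_bigr => n _.
      by rewrite /bump /= add1n; ring.
    rewrite [-1 * _]mulr_sumr -!big_split /=; apply: eq_bigr => n _; ring.
  rewrite (le_trans (absC_sum _ _ _))// mulrAC ler_pdivlMr// mulr_suml.
  apply: le_trans (_ : (\sum_(n < N.+1) absC (n%:R * (n%:R * b n)) * absC (ofR r) ^+ n) * absC h ^+ 2 <= _).
    rewrite mulr_suml; apply: ler_sum => n _.
    rewrite [absC (b n * _)]absCM -[leLHS]mulrA.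
    have T := pow_taylor n (ltW qr) qh.
    apply: le_trans (ler_wpM2l (absC_ge0 (b n)) T) _.
    by rewrite !absCM !absCn absC_of (gtr0_norm r0) le_eqVlt; apply/orP; left; apply/eqP; ring.
  by rewrite ler_wpM2r ?exprn_ge0 ?absC_ge0// HK// absC_of (gtr0_norm r0).
apply/hdP => e e0; have L0 : 0 < K / r ^+ 2 + 1 by rewrite ltr_wpDl// divr_ge0// ltW.
exists (Num.min (r - absC q) (e / (K / r ^+ 2 + 1))); first by rewrite min_gt0 ?divr_gt0 ?subr_gt0.
move=> h; rewrite lt_min => /andP[/key h1 h2]; apply: le_trans h1 _.
rewrite expr2 mulrA ler_wpM2r ?absC_ge0//.
move: h2; rewrite ltr_pdivlMr// => h2; have := absC_ge0 h; nra.
Qed.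

End PowerSeries.

Section Clamp.
Context {R : realType}.
Implicit Types (a b x y : R).

(** Projection onto [a, b]. Composing with it makes a function given on a rectangle continuous in
    each variable on the whole line, as the integrals require, without changing it on the
    rectangle. *)
Definition clamp a b x := Num.max a (Num.min x b).

Lemma clamp_in a b x : a <= b -> a <= clamp a b x <= b.
Proof. by move=> ab; rewrite /clamp le_max lexx ge_max ab ge_min lexx orbT. Qed.
Lemma clamp_id a b x : a <= x <= b -> clamp a b x = x.
Proof. by move=> /andP[h1 h2]; rewrite /clamp min_l// max_r. Qed.
Lemma clamp_lip a b x y : a <= b -> `|clamp a b x - clamp a b y| <= `|x - y|.
Proof.
move=> ab; rewrite /clamp.
have key u v : u <= v -> 0 <= Num.max a (Num.min v b) - Num.max a (Num.min u b) <= v - u.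
  move=> uv; have m1 : Num.min u b <= Num.min v b by rewrite le_min !ge_min uv lexx orbT.
  have m2 : Num.min v b - Num.min u b <= v - u.
    by case: (leP u b) => h1; case: (leP v b) => h2; lra.
  move: m1 m2; move: (Num.min u b) (Num.min v b) => p q m1 m2.
  by case: (leP a p) => h3; case: (leP a q) => h4; lra.
case: (leP y x) => [h|/ltW h].
  by have /andP[h1 h2] := key _ _ h; rewrite !ger0_norm// subr_ge0.
by rewrite distrC [`|x - y|]distrC; have /andP[h1 h2] := key _ _ h; rewrite !ger0_norm// subr_ge0.
Qed.

End Clamp.

(** * Contour integrals over a period strip *)

Section Strip.
Context {R : realType}.
Implicit Types (H g : CC R -> CC R) (a b c d x y t : R).

Definition ccontinuous_at H (w : CC R) := forall e : R, 0 < e -> exists2 dl : R, 0 < dl &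
  forall h, absC h < dl -> absC (H (w + h) - H w) <= e.

Lemma hd_cont H w D : hd H w D -> ccontinuous_at H w.
Proof.
move=> /hd_lip[d d0 L] e e0; have K0 : 0 < absC D + 1 by rewrite ltr_wpDl ?absC_ge0.
exists (Num.min d (e / (absC D + 1))); first by rewrite min_gt0 ?divr_gt0.
move=> h; rewrite lt_min ltr_pdivlMr// => /andP[/L h1 h2].
by apply: le_trans h1 _; rewrite mulrC ltW.
Qed.

Lemma ccont_comp H (l : R -> CC R) : (forall t, ccontinuous_at H (l t)) ->
  (forall s t, absC (l s - l t) <= `|s - t|) -> ccont (fun t => H (l t)).
Proof.
move=> ch lip; apply: ccontP => t e e0; have [d d0 K] := ch t e e0; exists d => // s sd.
have := K (l s - l t); rewrite [l t + _]addrC subrK; apply; exact: le_lt_trans (lip s t) sd.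
Qed.

Lemma absC_mk0 x : absC (mkC x 0) = `|x|.
Proof. by rewrite -absC_of; congr absC; apply: eqC; rewrite !simpRI. Qed.
Lemma absC_0mk x : absC (mkC 0 x) = `|x|.
Proof. by rewrite -(mul1r `|x|) -absC_i -absC_of -absCM; congr absC; apply: eqC; rewrite !simpRI; ring. Qed.
Lemma mkCBx x x' y : mkC x y - mkC x' y = mkC (x - x') 0.
Proof. by apply: eqC; rewrite !simpRI; ring. Qed.
Lemma mkCBy x y y' : mkC x y - mkC x y' = mkC 0 (y - y').
Proof. by apply: eqC; rewrite !simpRI; ring. Qed.

Lemma goursat_rect H a b c d : a < b -> c < d ->
  (forall x y, a <= x <= b -> c <= y <= d -> exists D, hd H (mkC x y) D) ->
  rectint (fun x y => H (mkC (clamp a b x) (clamp c d y))) a b c d = 0.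
Proof.
move=> ab cd hH; apply: goursat => //.
- move=> y; apply: (ccont_comp (l := fun x => mkC (clamp a b x) (clamp c d y))).
    move=> t; have [D /hd_cont] := hH _ _ (clamp_in t (ltW ab)) (clamp_in y (ltW cd)); exact.
  by move=> s t; rewrite mkCBx absC_mk0 clamp_lip// ltW.
- move=> x; apply: (ccont_comp (l := fun y => mkC (clamp a b x) (clamp c d y))).
    move=> t; have [D /hd_cont] := hH _ _ (clamp_in x (ltW ab)) (clamp_in t (ltW cd)); exact.
  by move=> s t; rewrite mkCBy absC_0mk clamp_lip// ltW.
move=> p q hp hq; have [D /hdP hD] := hH p q hp hq; exists D => e e0; have [dl dl0 K] := hD e e0.
exists (dl / 2); first by rewrite divr_gt0.
move=> x y hx hy xp yq; rewrite !clamp_id//.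
have le1 : absC (mkC (x - p) (y - q)) <= `|x - p| + `|y - q| by rewrite (le_trans (absC_le_ReIm _)).
have := K (mkC (x - p) (y - q)); rewrite (_ : mkC p q + _ = mkC x y); last first.
  by apply: eqC; rewrite !simpRI; ring.
move=> K'; apply: le_trans (K' _) _; first by apply: le_lt_trans le1 _; lra.
by rewrite ler_pM2l.
Qed.

Lemma cint_diff_bound (f g : R -> CC R) a b (M : R) : ccont f -> ccont g -> a <= b ->
  (forall t, a <= t <= b -> absC (f t - g t) <= M) ->
  absC (cint f a b - cint g a b) <= 2 * M * (b - a).
Proof.
move=> cf cg ab h.
have -> : cint f a b - cint g a b = cint (fun t => f t + (-1) * g t) a b.
  rewrite cintD ?cintZ//; first by ring.
  exact: ccontM (ccont_cst _) cg.
apply: cint_bound => //; first exact: ccontD cf (ccontM (ccont_cst _) cg).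
by move=> t ht; rewrite mulN1r h.
Qed.

Lemma cint_ext (f g : R -> CC R) a b : ccont f -> ccont g -> a <= b ->
  (forall t, a <= t <= b -> f t = g t) -> cint f a b = cint g a b.
Proof.
move=> cf cg ab h; apply/eqP; rewrite -subr_eq0 -absC_eq0 eq_le absC_ge0 andbT.
apply: le_trans (cint_diff_bound (M := 0) cf cg ab _) _; last by rewrite mulr0 mul0r.
by move=> t /h ->; rewrite subrr absC0.
Qed.

Definition hint H x0 y : CC R := cint (fun t => H (mkC (clamp x0 (x0 + 1) t) y)) x0 (x0 + 1).

(** The vertical sides of the rectangle cancel by periodicity, so Goursat's theorem equates the two
    horizontal ones. *)
Lemma strip_const H x0 c d : c < d ->
  (forall x y, x0 <= x <= x0 + 1 -> c <= y <= d -> exists D, hd H (mkC x y) D) ->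
  (forall y, c <= y <= d -> H (mkC (x0 + 1) y) = H (mkC x0 y)) ->
  hint H x0 c = hint H x0 d.
Proof.
move=> cd hH per; have x1 : x0 < x0 + 1 by rewrite ltrDl.
have := goursat_rect x1 cd hH; rewrite /rectint.
rewrite (clamp_id (x := c)) ?lexx ?ltW// (clamp_id (x := d)) ?lexx ?ltW//.
rewrite (clamp_id (x := x0)) ?lexx ?ltW// (clamp_id (x := x0 + 1)) ?lexx ?ltW//.
under [X in cint X c d]eq_fun do rewrite (per _ (clamp_in _ (ltW cd))).
rewrite /hint; move/eqP; rewrite (_ : _ - _ - _ =
  cint (fun x : R => H (mkC (clamp x0 (x0 + 1) x) c)) x0 (x0 + 1) -
  cint (fun x : R => H (mkC (clamp x0 (x0 + 1) x) d)) x0 (x0 + 1)); last by ring.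
by rewrite subr_eq0 => /eqP.
Qed.

Lemma periodic_int (p : R -> CC R) a : ccont p -> (forall t, p (t + 1) = p t) ->
  cint p a (a + 1) = cint p 0 1.
Proof.
move=> cp per; have [P hP] := cprim_ex cp; rewrite !(cintE _ _ hP).
have sh (G g : R -> R) : isprim G g -> isprim (fun t => G (t + 1)) (fun t => g (t + 1)).
  move=> h x; have /rdP h' := h (x + 1); apply/rdP => e /h'[d d0 K]; exists d => // k /K.
  by rewrite [x + k + 1]addrAC.
have key (G g : R -> R) : isprim G g -> (forall t, g (t + 1) = g t) -> forall s, G (s + 1) - G s = G 1 - G 0.
  move=> h1 h2 s; have h3 := sh _ _ h1; have h4 : isprim (fun t => G (t + 1)) g by move=> t; rewrite -h2; exact: h3.
  by have := prim_uniq 0 s h4 h1; rewrite add0r; lra.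
have [hr hi] := hP; apply: eqC.
  by rewrite !ReB (key _ _ hr)// => t; rewrite per.
by rewrite !ImB (key _ _ hi)// => t; rewrite per.
Qed.

End Strip.

(** * Cauchy's formula for functions of period 1 *)

Section PeriodicCauchy.
Context {R : realType}.
Implicit Types (w h : CC R) (x y t e : R).
Variable g : CC R -> CC R.
Hypothesis hg : holo g.
Hypothesis per : forall w, upper w -> g (w + 1) = g w.
(** That is, g = o(1/|q|) at the cusp, which excludes negative powers of q. *)
Hypothesis small : forall e : R, 0 < e -> exists Y : R, forall x y, Y < y ->
  absC (g (mkC x y)) <= e * expR (tpi * y).

Lemma g_line_cont y (c : CC R) : 0 < y -> ccont (fun t => g (mkC t y) * eC (c * mkC t y)).
Proof.
move=> y0; apply: (ccont_comp (H := fun w => g w * eC (c * w)) (l := fun t => mkC t y)).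
  move=> t; have h1 := derivable_hd (hg (y0 : upper (mkC t y))).
  exact: hd_cont (hdM h1 (hd_eCl c _)).
by move=> s t; rewrite mkCBx absC_mk0.
Qed.

Lemma g_line_cont0 y : 0 < y -> ccont (fun t => g (mkC t y)).
Proof.
move=> y0; apply: (ccont_comp (H := g) (l := fun t => mkC t y)).
  by move=> t; have h1 := derivable_hd (hg (y0 : upper (mkC t y))); exact: hd_cont h1.
by move=> s t; rewrite mkCBx absC_mk0.
Qed.

(** The coefficient of q^n. The full complex factor q^(-n) stays under the integral, which makes the
    value independent of the height [y]. *)
Definition bcoef (n : nat) y : CC R :=
  cint (fun t => g (mkC t y) * eC (- n%:R * mkC t y)) 0 1.

Lemma mkC1 x y : mkC (x + 1) y = mkC x y + 1.
Proof. by apply: eqC; rewrite !simpRI; ring. Qed.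

Lemma eC_period (n : nat) (w : CC R) : eC (- n%:R * (w + 1)) = eC (- n%:R * w).
Proof. by rewrite mulrDr eCD mulr1 eCN -(mulr1 n%:R) eC_nat eC1 expr1n invr1 !mulr1. Qed.

Lemma bcoef_shift n y a : 0 < y ->
  cint (fun t => g (mkC t y) * eC (- n%:R * mkC t y)) a (a + 1) = bcoef n y.
Proof.
move=> y0; apply: (periodic_int (p := fun t => g (mkC t y) * eC (- n%:R * mkC t y))).
  exact: g_line_cont.
by move=> t; rewrite mkC1 per// eC_period.
Qed.

Lemma bcoef_const n y y' : 0 < y -> 0 < y' -> bcoef n y = bcoef n y'.
Proof.
have key c d : 0 < c -> c < d -> bcoef n c = bcoef n d.
  move=> c0 cd; pose H (w : CC R) := g w * eC (- n%:R * w).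
  have E z : 0 < z -> hint H 0 z = bcoef n z.
    move=> z0; rewrite /hint add0r; apply: cint_ext => //.
    - apply: (ccont_comp (H := H) (l := fun t => mkC (clamp 0 1 t) z)).
        move=> t; have h1 := derivable_hd (hg (z0 : upper (mkC (clamp 0 1 t) z))).
        exact: hd_cont (hdM h1 (hd_eCl _ _)).
      by move=> s t; rewrite mkCBx absC_mk0 clamp_lip.
    - exact: g_line_cont.
    - by move=> t ht; rewrite clamp_id.
  rewrite -!E//; last exact: lt_trans cd.
  apply: strip_const => //.
    move=> x z _ /andP[cz _]; have z0 := lt_le_trans c0 cz; eexists.
    exact: (hdM (derivable_hd (hg (z0 : upper (mkC x z)))) (hd_eCl _ _)).
  move=> z /andP[cz _]; have z0 := lt_le_trans c0 cz.
  by rewrite /H mkC1 per// eC_period.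
move=> h1 h2; case: (ltgtP y y') => [|hh|->//]; first exact: key.
by rewrite (key y' y).
Qed.

Variable z : CC R.
Hypothesis uz : upper z.

(** The limit of the kernel at [z], since [1 - eC (z - w)] is asymptotic to [tpii * (w - z)]. *)
Let K0 : CC R := cderiv g z / tpii.
(* The integral of [kern] over a period is zero on both sides of [z], which gives Cauchy's formula
   for [g z] on summing the geometric series of [1 / (1 - eC (z - w))]. *)
Definition kern w : CC R := if w == z then K0 else (g w - g z) / (1 - eC (z - w)).

Lemma kern_den w : `|ReC (w - z)| <= 1 / 2 -> w != z -> 1 - eC (z - w) != 0.
Proof.
move=> h wz; apply: contra wz; rewrite subr_eq0 eq_sym => /eqP e1.
rewrite -subr_eq0 -oppr_eq0 opprB; apply/eqP; apply: eC_eq1 e1.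
by rewrite -normrN -ReN opprB.
Qed.

Lemma kern_hd w : upper w -> w != z -> 1 - eC (z - w) != 0 -> exists D, hd kern w D.
Proof.
move=> uw wz den.
have h1 := hdB (derivable_hd (hg uw)) (hd_cst (g z) w).
have hzw : hd (fun w => z - w) w (0 - 1) by apply: hdB (hd_cst z w) (hd_id w).
have h2 := hdB (hd_cst 1 w) (@hd_comp _ eC (fun w => z - w) w _ _ (hd_eC (z - w)) hzw).
have h3 := hd_div (g := fun w => 1 - eC (z - w)) den h1 h2.
eexists; apply: hd_near h3; exists (absC (w - z)); first by rewrite absC_gt0 subr_eq0.
move=> h hh; rewrite /kern; case: eqP => // E.
by move: hh; rewrite -E opprD addrA subrr add0r absCN ltxx.
Qed.

Lemma kern_cont w : upper w -> `|ReC (w - z)| <= 1 / 2 -> ccontinuous_at kern w.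
Proof.
move=> uw hw; have [wz|wz] := eqVneq w z; last first.
  have [D h] := kern_hd uw wz (kern_den hw wz); exact: hd_cont h.
rewrite wz => e e0; pose g' := cderiv g z.
have t0 := @tpi0 R.
(* The bound [tpi / 2] keeps the denominator above [tpi / 2 * absC h]; the other bound makes the
   numerator at most [e] times that. *)
pose ep := Num.min (e * (tpi / 2) / (1 + absC g' / tpi)) (tpi / 2).
have A0 : 0 < 1 + absC g' / tpi by rewrite ltr_wpDr// divr_ge0 ?absC_ge0// ltW.
have ep0 : 0 < ep by rewrite min_gt0 ?divr_gt0// mulr_gt0// divr_gt0.
have /hdP/(_ _ ep0)[d1 d10 H1] := derivable_hd (hg uz).
have /hdP/(_ _ ep0)[d2 d20 H2] := @hd_eC0 R.
exists (Num.min d1 d2); first exact: min_gt0.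
move=> h; rewrite lt_min => /andP[/H1 B1 hd2].
have := H2 (- h); rewrite absCN => /(_ hd2); rewrite add0r eC0 => B2.
have [->|h0] := eqVneq h 0; first by rewrite addr0 subrr absC0 ltW.
have zh : (z + h == z) = false by rewrite -subr_eq0 addrC addKr; exact/negbTE.
rewrite /kern zh eqxx (_ : z - (z + h) = - h); last by ring.
have hp : 0 < absC h by rewrite absC_gt0.
move: B1 B2; rewrite -/g'; set r1 := _ - _ - _ => B1; set r2 := _ - _ - _ => B2.
have -> : g (z + h) - g z = g' * h + r1 by rewrite /r1; ring.
have M1 : 1 - eC (- h) = tpii * h - r2 by rewrite /r2; ring.
have Mlow : tpi / 2 * absC h <= absC (1 - eC (- h)).
  rewrite M1; have := absC_sub (tpii * h) r2; rewrite absCM absC_tpii => L.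
  have : ep * absC h <= tpi / 2 * absC h by rewrite ler_wpM2r ?absC_ge0// minle2.
  lra.
have M0 : 1 - eC (- h) != 0.
  by rewrite -absC_gt0 (lt_le_trans _ Mlow)// mulr_gt0// divr_gt0.
have -> : (g' * h + r1) / (1 - eC (- h)) - K0 = (r1 + g' / tpii * r2) / (1 - eC (- h)).
  have t1 := @tpii0 R.
  apply: (mulIf M0); rewrite mulrBl !divfK// M1 /K0 -/g'; field.
  by rewrite t1.
rewrite absCM absCV ler_pdivrMr ?(lt_le_trans _ Mlow)//; last by rewrite mulr_gt0// divr_gt0.
apply: le_trans (ler_wpM2l (ltW e0) Mlow).
have T : absC (r1 + g' / tpii * r2) <= (1 + absC g' / tpi) * (ep * absC h).
  rewrite (le_trans (absCD _ _))// mulrDl mul1r !absCM absCV absC_tpii lerD//.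
  by rewrite ler_wpM2l// divr_ge0 ?absC_ge0// ltW.
apply: le_trans T _; rewrite !(mulrA _ _ (absC h)) ler_wpM2r ?absC_ge0// mulrC.
rewrite -ler_pdivlMr//; exact: minle1.
Qed.

(** The strip of width 1 centred at [z], in which [z] is the only zero of the denominator of the
    kernel. *)
Let a0 : R := ReC z - 1 / 2.

Lemma in_strip x : a0 <= x <= a0 + 1 -> forall y, `|ReC (mkC x y - z)| <= 1 / 2.
Proof. by move=> h y; rewrite ReB Re_mk ler_norml; rewrite /a0 in h *; lra. Qed.

Lemma kern_line_cont y : 0 < y -> ccont (fun t => kern (mkC (clamp a0 (a0 + 1) t) y)).
Proof.
move=> y0; apply: (ccont_comp (H := kern) (l := fun t => mkC (clamp a0 (a0 + 1) t) y)).
  move=> t; apply: kern_cont => //; apply: in_strip; apply: clamp_in; lra.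
by move=> s t; rewrite mkCBx absC_mk0 clamp_lip//; lra.
Qed.

Lemma im_ne x y : y != ImC z -> mkC x y != z.
Proof. by apply: contra => /eqP <-. Qed.

(** Differentiability of the kernel is available only away from [z], so heights are compared on one
    side of [ImC z] at a time. *)
Lemma kern_int_const c d : 0 < c -> c < d -> (d < ImC z) || (ImC z < c) ->
  hint kern a0 c = hint kern a0 d.
Proof.
move=> c0 cd hz; have ne y : c <= y <= d -> y != ImC z.
  move=> /andP[h1 h2]; apply/eqP => E; case/orP: hz => hz; move: h1 h2 hz; rewrite -E; lra.
apply: strip_const => //.
  move=> x y hx hy; have y0 : 0 < y by case/andP: hy => /(lt_le_trans c0).
  have wz := im_ne x (ne y hy).
  by apply: kern_hd => //; apply: kern_den => //; exact: in_strip.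
move=> y hy; have y0 : 0 < y by case/andP: hy => /(lt_le_trans c0).
rewrite /kern !(negbTE (im_ne _ (ne y hy))) mkC1 per//.
have -> : z - (mkC a0 y + 1) = z - mkC a0 y + (- 1) by ring.
by rewrite eCD (eCN 1) eC1 invr1 mulr1.
Qed.

(** Continuity at the critical height joins the two sides. Compactness of the segment makes the
    estimate uniform in the abscissa. *)
Lemma kern_int_cont e : 0 < e -> exists2 dl : R, 0 < dl & forall y, 0 < y -> `|y - ImC z| < dl ->
  absC (hint kern a0 y - hint kern a0 (ImC z)) <= e.
Proof.
move=> e0; have e2 : 0 < e / 2 / 2 by rewrite !divr_gt0.
have K : (compact (`[a0, a0 + 1]%classic : set R)) by exact: segment_compact.
pose P (y x : R) := absC (kern (mkC x y) - kern (mkC x (ImC z))) <= e / 2.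
have near1 : \forall y \near (ImC z : R), (`[a0, a0 + 1] `<=` P y)%classic.
  have /compact_near_coveringP cK := K.
  apply: (cK R (nbhs (ImC z : R)) P).
  move=> x; rewrite /= in_itv /= => hx.
  have ux : upper (mkC x (ImC z)) by [].
  have [d d0 C] := kern_cont ux (in_strip hx _) e2.
  have d20 : 0 < d / 2 by rewrite divr_gt0.
  exists (ball x (d / 2), ball (ImC z) (d / 2)).
    by split; apply: nbhsx_ballx.
  move=> [x' y'] /= []; rewrite /ball /= => bx by'.
  have C1 := C (mkC (x' - x) (y' - ImC z)); have C2 := C (mkC (x' - x) 0).
  have s1 : absC (mkC (x' - x) (y' - ImC z)) < d.
    by apply: le_lt_trans (absC_le_ReIm _) _; rewrite Re_mk Im_mk distrC [X in _ + X]distrC; lra.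
  have s2 : absC (mkC (x' - x) 0) < d by rewrite absC_mk0 distrC; lra.
  have := C1 s1; have := C2 s2.
  rewrite (_ : mkC x (ImC z) + mkC (x' - x) 0 = mkC x' (ImC z)); last by apply: eqC; rewrite !simpRI; ring.
  rewrite (_ : mkC x (ImC z) + mkC (x' - x) (y' - ImC z) = mkC x' y'); last by apply: eqC; rewrite !simpRI; ring.
  rewrite /P; move: (kern (mkC x' y')) (kern (mkC x' (ImC z))) (kern (mkC x (ImC z))) => p q s h1 h2.
  have := absCD (p - s) (s - q); rewrite addrA subrK [absC (s - q)]absCB; lra.
move: near1 => /nbhs_ballP[d /= d0 H]; exists d => // y y0 yd.
have := H y; rewrite /ball /= distrC => /(_ yd) Hy.
rewrite /hint; apply: le_trans (cint_diff_bound (M := e / 2) (kern_line_cont y0) (kern_line_cont uz) _ _) _.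
- lra.
- by move=> t ht; rewrite !clamp_id//; apply: Hy; rewrite /= in_itv.
- lra.
Qed.

Lemma kern_int_all y : 0 < y -> hint kern a0 y = hint kern a0 (ImC z).
Proof.
move=> y0; apply/eqP; rewrite -subr_eq0 -absC_eq0 eq_le absC_ge0 andbT.
apply/ler_addgt0Pr => e e0; rewrite add0r; have [d d0 H] := kern_int_cont e0.
have [yz|yz|->] := ltgtP y (ImC z); last by rewrite subrr absC0 ltW.
  pose y' := Num.max ((y + ImC z) / 2) (ImC z - d / 2).
  have h1 : y < y' by rewrite lt_max; apply/orP; left; lra.
  have h2 : y' < ImC z by rewrite gt_max; apply/andP; split; lra.
  have h3 : ImC z - d / 2 <= y' by rewrite le_max lexx orbT.
  rewrite (@kern_int_const y y')// ?h2//; apply: H; first exact: lt_trans h1.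
  by rewrite ltr_norml; lra.
pose y' := Num.min ((y + ImC z) / 2) (ImC z + d / 2).
have h1 : y' < y by rewrite gt_min; apply/orP; left; lra.
have h2 : ImC z < y' by rewrite lt_min; apply/andP; split; lra.
have h3 : y' <= ImC z + d / 2 by rewrite ge_min lexx orbT.
have y'0 : 0 < y' := lt_trans uz h2.
rewrite -(@kern_int_const y' y)// ?h2 ?orbT//; apply: H => //.
by rewrite ltr_norml; lra.
Qed.

(** The integral does not depend on the height, and it tends to 0 as the height grows: the
    denominator has size [expR (tpi * y)], while [g] is of smaller order. *)
Lemma kern_int0 y : 0 < y -> hint kern a0 y = 0.
Proof.
move=> y0; apply/eqP; rewrite -absC_eq0 eq_le absC_ge0 andbT.
apply/ler_addgt0Pr => e e0; rewrite add0r.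
have t0 := @tpi0 R; have p2 : 2 <= pi :> R := pi_ge2 R.
pose E0 := expR (tpi * ImC z); have E00 : 0 < E0 by exact: expR_gt0.
(* The pointwise target for the kernel is [e / 2], the denominator is at least
   [expR (tpi * y1) / (2 * E0)], and the numerator has two terms: hence the 8. *)
have e1 : 0 < e / (8 * E0) by rewrite divr_gt0// mulr_gt0.
have [Y HY] := small e1.
pose c := absC (g z).
(* High enough for the growth bound, at least 1 above [z] so that the denominator is not small, and
   such that the constant [absC (g z)] is absorbed. *)
pose y1 := Num.max (Num.max (Y + 1) (ImC z + 1)) (c / (e / (8 * E0)) / tpi).
have b1 : Y < y1 by rewrite !lt_max ltrDl ltr01.
have b2 : ImC z + 1 <= y1 by rewrite !le_max lexx orbT.
have b3 : c <= e / (8 * E0) * expR (tpi * y1).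
  rewrite -ler_pdivrMl// mulrC; apply: le_trans (expR_ge1Dx _).
  by rewrite ler_wpDl// [tpi * _]mulrC -ler_pdivrMr// le_max lexx orbT.
have y10 : 0 < y1 by have : 0 < ImC z := uz; lra.
have -> : hint kern a0 y = hint kern a0 y1 by rewrite (kern_int_all y0) (kern_int_all y10).
have E1 : 0 < expR (tpi * y1) by exact: expR_gt0.
have den x : expR (tpi * y1) / (2 * E0) <= absC (1 - eC (z - mkC x y1)).
  rewrite absCB; apply: le_trans (absC_sub _ _); rewrite absC1 absC_eC ImB Im_mk.
  have -> : - (tpi * (ImC z - y1)) = tpi * y1 + - (tpi * ImC z) by ring.
  rewrite expRD expRN -/E0.
  have : 2 <= expR (tpi * y1) / E0.
    rewrite /E0 -expRN -expRD; apply: le_trans (expR_ge1Dx _).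
    have : 1 <= tpi * (y1 - ImC z); last by lra.
    by rewrite /tpi; nra.
  by rewrite invfM mulrCA [_^-1 * _]mulrC; set X := _ / E0; lra.
apply: le_trans (cint_bound (M := e / 2) (kern_line_cont y10) _ _) _; [lra| |lra].
move=> t ht; set x := clamp _ _ _.
have nz : mkC x y1 == z = false by apply/negbTE/im_ne; rewrite gt_eqF//; lra.
rewrite /kern nz absCM absCV ler_pdivrMr; last first.
  by apply: lt_le_trans (den x); rewrite divr_gt0// mulr_gt0.
apply: le_trans (ler_wpM2l _ (den x)); last by rewrite divr_ge0// ltW.
apply: le_trans (absCBle _ _) _; have := HY x y1 b1; rewrite -/c => h.
rewrite (_ : e / 2 * (expR (tpi * y1) / (2 * E0)) = 2 * (e / (8 * E0) * expR (tpi * y1))); first by lra.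
by field; rewrite gt_eqF.
Qed.

End PeriodicCauchy.

(** * Fourier expansions *)

Section QExpansion.
Context {R : realType}.
Implicit Types (w z : CC R) (x y t e : R).

Lemma ccont_bounded (f : R -> CC R) a b : ccont f -> a <= b ->
  exists M : R, 0 <= M /\ forall t, a <= t <= b -> absC (f t) <= M.
Proof.
move=> cf ab.
have cn : {within `[a, b], continuous (fun t => absC (f t))}%classic.
  apply: continuous_subspaceT => t; apply/cvgrPdist_le => e e0.
  have [d d0 H] := ccont_eps cf t e0.
  apply/nbhs_ballP; exists d => //= s; rewrite /ball /= distrC => /H h; apply: le_trans h.
  have := absC_sub (f s) (f t); have := absC_sub (f t) (f s); rewrite [absC (f t - f s)]absCB.
  by rewrite ler_norml; lra.
have [c _ H] := EVT_max ab cn; exists (absC (f c)); split; first exact: absC_ge0.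
by move=> t ht; apply: H; rewrite in_itv.
Qed.

Lemma cint_eqf (f f' : R -> CC R) a b : f =1 f' -> cint f a b = cint f' a b.
Proof. by move=> /funext ->. Qed.

Lemma ccont_sum (f : nat -> R -> CC R) N : (forall n, ccont (f n)) ->
  ccont (fun t => \sum_(n < N) f n t).
Proof.
move=> cf; elim: N => [|N IH].
  by rewrite (_ : (fun t => _) = fun=> 0); [exact: ccont_cst|apply/funext => t; rewrite big_ord0].
rewrite (_ : (fun t => _) = fun t => \sum_(n < N) f n t + f N t); first exact: ccontD.
by apply/funext => t; rewrite big_ord_recr.
Qed.

Lemma cint_sum (f : nat -> R -> CC R) N a b : (forall n, ccont (f n)) ->
  cint (fun t => \sum_(n < N) f n t) a b = \sum_(n < N) cint (f n) a b.
Proof.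
move=> cf; elim: N => [|N IH].
  rewrite big_ord0 (@cint_eqf _ (fun=> 0)); last by move=> t; rewrite big_ord0.
  by rewrite (@cintE _ (fun=> 0)) ?subrr//; split => t; exact: is_derive_cst.
rewrite big_ord_recr /= -IH -(cintD _ _ (ccont_sum N cf) (cf N)).
by apply: cint_eqf => t; rewrite big_ord_recr.
Qed.

Section Expand.
Variable g : CC R -> CC R.
Hypothesis hg : holo g.
Hypothesis per : forall w, upper w -> g (w + 1) = g w.
Hypothesis small : forall e : R, 0 < e -> exists Y : R, forall x y, Y < y ->
  absC (g (mkC x y)) <= e * expR (tpi * y).

Lemma ccont_eCl (c : CC R) y : ccont (fun t => eC (c * mkC t y)).
Proof.
apply: (ccont_comp (H := fun w => eC (c * w)) (l := fun t => mkC t y)).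
  by move=> t; exact: hd_cont (hd_eCl c _).
by move=> s t; rewrite mkCBx absC_mk0.
Qed.

Lemma int_eC n y a : cint (fun t => eC (- n%:R * mkC t y)) a (a + 1) = (n == 0%N)%:R.
Proof.
case: n => [|n].
  rewrite (_ : (fun t => _) = fun=> 1); last by apply/funext => t; rewrite oppr0 mul0r eC0.
  rewrite (@cintE _ (fun t => ofR t)).
    by rewrite -ofRB addrAC subrr add0r ofR1.
  split => t; [exact: is_derive_id|exact: is_derive_cst].
have FG' (c w : CC R) : c != 0 -> hd (fun w => eC (c * w) / (tpii * c)) w (eC (c * w)).
  move=> c0; have h := hdM (hd_eCl c w) (hd_cst (tpii * c)^-1 w).
  apply: (hd_eq h); have t1 := @tpii0 R; rewrite mulr0 addr0; field.
  by rewrite c0 t1.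
have c0 : - n.+1%:R != 0 :> CC R by rewrite oppr_eq0 pnatr_eq0.
have FG w := FG' _ w c0.
by rewrite (cintE _ _ (hline y FG)) -mulrBl mkC1 eC_period subrr mul0r.
Qed.

Lemma bcoef_bound y : 0 < y -> exists M : R, 0 <= M /\ forall n, absC (bcoef g n y) * expR (- (tpi * y)) ^+ n <= M.
Proof.
move=> y0; have [M [M0 HM]] := ccont_bounded (g_line_cont0 hg y0) ler01.
exists (2 * M); split; first by rewrite mulr_ge0.
move=> k; rewrite -ler_pdivlMr ?exprn_gt0 ?expR_gt0// /bcoef.
have := cint_bound (M := M / expR (- (tpi * y)) ^+ k) (g_line_cont hg (- k%:R) y0) ler01.
rewrite subr0 mulr1 mulrA; apply => t ht.
by rewrite absCM mulNr eCN absCV eC_nat absCX absC_eC Im_mk ler_wpM2r ?HM//.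
Qed.

(** On a line below [z] the quantity [u = eC (z - w)] has constant modulus [rho < 1], so
    [1 / (1 - u)] is a geometric series. Integrating it against [g w - g z] gives the terms of the
    expansion, with [g z] subtracted at n = 0; the total is zero because the kernel integrates to
    zero. *)
Lemma bcoef_sum z y : upper z -> 0 < y -> y < ImC z ->
  ccvg (fun N => \sum_(n < N) bcoef g n y * eC z ^+ n) (g z).
Proof.
move=> uz y0 yz; pose a : R := ReC z - 1 / 2.
have a1 : a <= a + 1 by rewrite lerDl.
have k0 := kern_int0 hg per small uz y0.
pose u t := eC (z - mkC t y).
pose rho := expR (- (tpi * (ImC z - y))).
have uE t : absC (u t) = rho by rewrite absC_eC ImB.
have rho1 : rho < 1.
  by rewrite -expR0 ltr_expR oppr_lt0 mulr_gt0 ?tpi0 ?subr_gt0.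
have rho0 : 0 < rho by exact: expR_gt0.
have nz t : mkC t y != z by apply: contraTneq yz => <-; rewrite ltxx.
pose cl := clamp a (a + 1).
pose D t := g (mkC t y) - g z.
have cg := g_line_cont0 hg y0.
have cD : ccont D.

  exact: ccontD cg (ccont_cst _).
have [G [G0 HG]] := ccont_bounded cD a1.
have cu : ccont u.
  rewrite (_ : u = fun t => eC z * eC (- 1%:R * mkC t y)).
    exact: ccontM (ccont_cst _) (ccont_eCl _ _).
  by apply/funext => t; rewrite /u eCD mulN1r.
have cun n : ccont (fun t => u t ^+ n).
  elim: n => [|n IH].
    by rewrite (_ : (fun t => _) = fun=> 1); [exact: ccont_cst|apply/funext].
  rewrite (_ : (fun t => _) = fun t => u t * u t ^+ n); last by apply/funext => t; rewrite exprS.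
  exact: ccontM cu IH.
have kE t : kern g z (mkC t y) = D t / (1 - u t) by rewrite /kern (negbTE (nz t)).
have den t : 1 - u t != 0.
  rewrite -absC_gt0 (lt_le_trans _ (absC_sub _ _))// absC1 uE subr_gt0//.
have denl t : 1 - rho <= absC (1 - u t) by have := absC_sub 1 (u t); rewrite absC1 uE.
have geo t N : D t / (1 - u t) = (\sum_(n < N) D t * u t ^+ n) + D t * u t ^+ N / (1 - u t).
  elim: N => [|N IH]; first by rewrite big_ord0 add0r expr0 mulr1.
  rewrite big_ord_recr /= -addrA IH; congr (_ + _); rewrite exprS.
  by field; exact: den.
have cS N : ccont (fun t => \sum_(n < N) D t * u t ^+ n).
  by apply: (@ccont_sum (fun n t => D t * u t ^+ n)) => n; exact: ccontM cD (cun n).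
have ck : ccont (fun t => kern g z (mkC (cl t) y)) := kern_line_cont hg uz y0.
have term n : cint (fun t => D t * u t ^+ n) a (a + 1) = (bcoef g n y - (n == 0%N)%:R * g z) * eC z ^+ n.
  rewrite (_ : (fun t => _) = fun t => eC z ^+ n * (g (mkC t y) * eC (- n%:R * mkC t y)) +
      (- (g z * eC z ^+ n)) * eC (- n%:R * mkC t y)).
    have c1 := g_line_cont hg (- n%:R) y0; have c2 := ccont_eCl (- n%:R) y.
    rewrite cintD; [|exact: ccontM (ccont_cst _) c1|exact: ccontM (ccont_cst _) c2].
    rewrite (cintZ _ _ _ c1) (cintZ _ _ _ c2) (bcoef_shift hg per)// int_eC; ring.
  apply/funext => t; rewrite /u.
  have -> : eC (z - mkC t y) ^+ n = eC z ^+ n * eC (- n%:R * mkC t y).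
    by rewrite eCB expr_div_n mulNr eCN eC_nat.
  by rewrite /D; move: (eC (- _ * _)) (g (mkC t y)) (g z) (eC z ^+ n) => p1 p2 p3 p4; ring.
have sumE N : cint (fun t => \sum_(n < N) D t * u t ^+ n) a (a + 1) =
    \sum_(n < N) (bcoef g n y - (nat_of_ord n == 0%N)%:R * g z) * eC z ^+ n.
  rewrite (@cint_sum (fun n t => D t * u t ^+ n)); last by move=> n; exact: ccontM cD (cun n).
  by apply: eq_bigr => n _; exact: term.
have bd N : absC (\sum_(n < N) (bcoef g n y - (nat_of_ord n == 0%N)%:R * g z) * eC z ^+ n) <=
    2 * G / (1 - rho) * rho ^+ N.
  have Z : cint (fun t => kern g z (mkC (cl t) y)) a (a + 1) = 0 by exact: k0.
  have B := @cint_diff_bound R _ _ a (a + 1) (G / (1 - rho) * rho ^+ N) (cS N) ck a1.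
  rewrite Z subr0 sumE in B; apply: le_trans (B _) _.
    move=> t ht; rewrite /cl clamp_id// kE (geo t N) opprD addrA subrr add0r absCN.
    rewrite !absCM absCX uE absCV mulrAC ler_wpM2r ?exprn_ge0 ?(ltW rho0)//.
    rewrite ler_pM ?absC_ge0 ?invr_ge0 ?absC_ge0 ?HG// lef_pV2 ?posrE//.
      by rewrite (lt_le_trans _ (denl t))// subr_gt0.
    by rewrite subr_gt0.
  by rewrite addrAC subrr add0r mulr1 !mulrA.
move=> e e0; have K0 : 0 <= 2 * G / (1 - rho) by rewrite divr_ge0 ?mulr_ge0// subr_ge0 ltW.
have cg0 : ((fun n : nat => rho ^+ n) @ \oo --> (0 : R))%classic by apply: cvg_expr; rewrite gtr0_norm.
have e1 : 0 < e / (2 * G / (1 - rho) + 1) by rewrite divr_gt0// ltr_wpDl.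
move/cvgrPdist_le: cg0 => /(_ _ e1)[N0 _ HN0].
(* At least one summand must be present, for the subtracted [g z] belongs to the term of index 0. *)
exists N0.+1 => -[//|n] nN.
have -> : \sum_(k < n.+1) bcoef g k y * eC z ^+ k - g z =
    \sum_(k < n.+1) (bcoef g k y - (nat_of_ord k == 0%N)%:R * g z) * eC z ^+ k.
  rewrite !big_ord_recl /= !expr0 mul1r !mulr1 addrAC; congr (_ + _).
  by apply: eq_bigr => k _; rewrite mul0r subr0.
apply: le_trans (bd _) _.
have := HN0 n.+1 (ltnW nN); rewrite sub0r normrN ger0_norm ?exprn_ge0 ?(ltW rho0)// => h.
apply: le_trans (ler_wpM2l K0 h) _.
by rewrite mulrCA ler_piMr ?(ltW e0)// ler_pdivrMr ?mul1r ?lerDl// ltr_wpDl.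
Qed.

Lemma qexp_per : exists b, adm b /\ forall z, upper z -> g z = ps b (eC z).
Proof.
exists (fun n => bcoef g n 1); split.
  (* The height at which |q| equals [r]: bounding the integral there gives the bound for the
     coefficients times powers of [r]. *)
  move=> r /andP[r0 r1]; pose y := - (ln r / tpi).
  have y0 : 0 < y by rewrite oppr_gt0 pmulr_llt0 ?invr_gt0 ?tpi0// ln_lt0// r0.
  have [M [_ HM]] := bcoef_bound y0; exists M => n; have := HM n.
  rewrite (bcoef_const hg per n y0 ltr01) /y mulrN opprK mulrCA mulfV ?gt_eqF ?tpi0// mulr1.
  by rewrite lnK.
move=> z uz; have zz : 0 < ImC z := uz; have y0 : 0 < ImC z / 2 by rewrite divr_gt0.
apply/esym/psE; have h : ImC z / 2 < ImC z by rewrite ltr_pdivrMr//; lra.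
apply: ccvg_eq (bcoef_sum uz y0 h) => N.
by apply: eq_bigr => n _; rewrite (bcoef_const hg per n y0 ltr01).
Qed.

End Expand.

(** With [a = N / d], from [ln (y / a) <= y / a - 1]: multiplied by [N], the linear term is exactly
    [d * y]. *)
Lemma powR_small (N d : R) : 0 < N -> 0 < d -> exists K : R, 0 < K /\
  forall y, 0 < y -> powR y N <= K * expR (d * y).
Proof.
move=> N0 d0; pose a := N / d; have a0 : 0 < a by rewrite divr_gt0.
exists (expR (N * ln a)); split; first exact: expR_gt0.
move=> y y0; rewrite /powR gt_eqF// -expRD ler_expR.
have := le_ln1Dx (_ : -1 < y / a - 1).
have -> : 1 + (y / a - 1) = y / a by ring.
rewrite ln_div ?posrE// => h.
have h1 : -1 < y / a - 1 by have := divr_gt0 y0 a0; lra.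
have h2 : ln y <= ln a + y / a by have := h h1; lra.
apply: le_trans (ler_wpM2l (ltW N0) h2) _; rewrite mulrDr lerD2l.
by rewrite le_eqVlt; apply/orP; left; apply/eqP; rewrite /a; field; rewrite !gt_eqF.
Qed.

Theorem qexp (f : CC R -> CC R) (lam : R) : holo f -> mod_growth f -> 0 <= lam < 1 ->
  (forall z, upper z -> f (z + 1) = ee lam * f z) ->
  exists b, adm b /\ forall z, upper z -> f z = eC (ofR lam * z) * ps b (eC z).
Proof.
move=> hf [N [c [N0 [c0 H]]]] /andP[l0 l1] per.
pose g w := f w * eC (- ofR lam * w).
have [|||b [hb E]] := @qexp_per g.
- move=> z uz; exact: hd_derivable (hdM (derivable_hd (hf _ uz)) (hd_eCl _ _)).
- move=> z uz; rewrite /g per// mulrDr eCD mulr1.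
  have -> : eC (- ofR lam) = (ee lam)^-1 by rewrite eCN eC_real.
  by field; exact: ee_neq0.
- move=> e e0; have t0 := @tpi0 R.
  (* Half of the gap between the growth of [eC (- ofR lam * w)] and that of 1/|q|: one half absorbs
     the power of [y], the other one yields the small factor [e]. *)
  pose d := tpi * (1 - lam) / 2.
  have d0 : 0 < d by apply: divr_gt0 => //; apply: mulr_gt0 => //; rewrite subr_gt0.
  have [K [K0 HK]] := powR_small N0 d0.
  exists (Num.max c (K / e / d)) => x y; rewrite gt_max => /andP[cy dy].
  have y0 : 0 < y := lt_trans c0 cy.
  have := H x y cy; rewrite normCE lecE' => h1.
  rewrite /g absCM absC_eC.
  have -> : ImC (- ofR lam * mkC x y) = - lam * y by rewrite !simpRI; ring.
  apply: le_trans (ler_wpM2r (expR_ge0 _) (le_trans h1 (HK y y0))) _.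
  rewrite -mulrA -expRD.
  have -> : d * y + - (tpi * (- lam * y)) = tpi * y + - (d * y) by rewrite /d; field.
  rewrite expRD mulrCA mulrC ler_wpM2r ?expR_ge0// expRN ler_pdivrMr ?expR_gt0// -ler_pdivrMl//.
  apply: le_trans (expR_ge1Dx _); rewrite ler_wpDl// mulrC [d * y]mulrC -ler_pdivrMr//; exact: ltW.
exists b; split => // z uz; rewrite -E// /g mulNr eCN.
by field; exact: eC_neq0.
Qed.

End QExpansion.

(** * Order at the cusp *)

Section Order.
Context {R : realType}.
Implicit Types (f g : CC R -> CC R) (z w : CC R) (mu nu lam : R).

(* [f = O(|q|^mu)] at the cusp. *)
Definition ford mu f := exists K : R, 0 <= K /\ forall z, 1 <= ImC z ->
  absC (f z) <= K * expR (- (tpi * (mu * ImC z))).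

Lemma ford_ext mu f g : (forall z, upper z -> f z = g z) -> ford mu f -> ford mu g.
Proof.
move=> E [K [K0 H]]; exists K; split => // z z1; rewrite -E ?H//.
exact: lt_le_trans ltr01 z1.
Qed.

Lemma fordM mu nu f g : ford mu f -> ford nu g -> ford (mu + nu) (fun z => f z * g z).
Proof.
move=> [K [K0 H]] [L [L0 H']]; exists (K * L); split; first exact: mulr_ge0.
move=> z z1; rewrite absCM mulrDl mulrDr opprD expRD mulrACA.
by rewrite ler_pM ?absC_ge0 ?H ?H'.
Qed.

Lemma fordD mu f g : ford mu f -> ford mu g -> ford mu (fun z => f z + g z).
Proof.
move=> [K [K0 H]] [L [L0 H']]; exists (K + L); split; first exact: addr_ge0.
by move=> z z1; rewrite (le_trans (absCD _ _))// mulrDl lerD ?H ?H'.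
Qed.

Lemma fordZ mu (c : CC R) f : ford mu f -> ford mu (fun z => c * f z).
Proof.
move=> [K [K0 H]]; exists (absC c * K); split; first by rewrite mulr_ge0 ?absC_ge0.
by move=> z z1; rewrite absCM -mulrA ler_wpM2l ?absC_ge0 ?H.
Qed.

Lemma fordN mu f : ford mu f -> ford mu (fun z => - f z).
Proof. by move=> [K [K0 H]]; exists K; split => // z z1; rewrite absCN H. Qed.

Lemma fordB mu f g : ford mu f -> ford mu g -> ford mu (fun z => f z - g z).
Proof. by move=> h1 h2; apply: fordD h1 (fordN h2). Qed.

Lemma ford_cst (c : CC R) : ford 0 (fun _ => c).
Proof.
exists (absC c); split; first exact: absC_ge0.
by move=> z _; rewrite mul0r mulr0 oppr0 expR0 mulr1.
Qed.

Lemma ford0 mu : ford mu (fun _ : CC R => 0).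
Proof. by exists 0; split => // z _; rewrite absC0 mul0r. Qed.

Lemma ford_le mu nu f : mu <= nu -> ford nu f -> ford mu f.
Proof.
move=> h [K [K0 H]]; exists K; split => // z z1; apply: le_trans (H z z1) _.
have y0 : 0 <= ImC z := le_trans ler01 z1.
by rewrite ler_wpM2l// ler_expR lerN2 ler_wpM2l ?(ltW tpi0)// ler_wpM2r.
Qed.

Lemma ford_sum (I : Type) (r : seq I) (F : I -> CC R -> CC R) mu :
  (forall i, ford mu (F i)) -> ford mu (fun z => \sum_(i <- r) F i z).
Proof.
move=> h; elim: r => [|i r IH].
  by apply: ford_ext (ford0 mu) => z _; rewrite big_nil.
by apply: ford_ext (fordD (h i) IH) => z _; rewrite big_cons.
Qed.

Lemma fordX mu f n : ford mu f -> ford (n%:R * mu) (fun z => f z ^+ n).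
Proof.
move=> h; elim: n => [|n IH]; first by rewrite mul0r; exact: ford_cst.
by rewrite mulrS mulrDl mul1r; apply: ford_ext (fordM h IH) => z _; rewrite exprS.
Qed.

Lemma ford_growth f : ford 0 f -> mod_growth f.
Proof.
move=> [K [K0 H]]; exists 1, (Num.max 1 K); split; first exact: ltr01.
split; first by rewrite lt_max ltr01.
move=> x y; rewrite gt_max => /andP[y1 yK]; rewrite normCE lecE' powRr1; last first.
  exact: le_trans ler01 (ltW y1).
have := H (mkC x y) (ltW y1); rewrite mul0r mulr0 oppr0 expR0 mulr1 => h.
exact: le_trans h (ltW yK).
Qed.

Definition qform lam f := exists b, adm b /\ forall z, upper z -> f z = eC (ofR lam * z) * ps b (eC z).

Lemma eC_lt1 z : upper z -> absC (eC z) < 1.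
Proof. by move=> uz; rewrite absC_eC -expR0 ltr_expR oppr_lt0 mulr_gt0 ?tpi0. Qed.

Lemma eC_le z : 1 <= ImC z -> absC (eC z) <= expR (- tpi).
Proof. by move=> z1; rewrite absC_eC ler_expR lerN2 ler_peMr// ltW// tpi0. Qed.

Lemma expNtpi : 0 < expR (- tpi : R) < 1.
Proof. by rewrite expR_gt0 -expR0 ltr_expR oppr_lt0 tpi0. Qed.

Lemma absC_eCl lam z : absC (eC (ofR lam * z)) = expR (- (tpi * (lam * ImC z))).
Proof. by rewrite absC_eC; congr (expR (- (_ * _))); rewrite !simpRI; ring. Qed.

Lemma qform_ford lam f : qform lam f -> ford lam f.
Proof.
move=> [b [hb E]]; have [K [K0 [HK _]]] := ps_bound hb expNtpi.
exists K; split => // z z1; rewrite E; last exact: lt_le_trans ltr01 z1.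
rewrite absCM absC_eCl.
by rewrite [leLHS]mulrC ler_wpM2r ?expR_ge0// HK// eC_le.
Qed.

Lemma qform_lim f : qform 0 f -> exists a : CC R, ford 1 (fun z => f z - a).
Proof.
move=> [b [hb E]]; exists (b 0%N).
have [K [K0 [HK _]]] := ps_bound (adm_shift hb) expNtpi.
exists K; split => // z z1; have uz : upper z := lt_le_trans ltr01 z1.
rewrite E// ofR0 mul0r eC0 mul1r -ps_shift ?eC_lt1// absCM absC_eC mul1r [leLHS]mulrC.
by rewrite ler_wpM2r ?expR_ge0// HK// eC_le.
Qed.

Lemma hd_ps_eC b z : adm b -> upper z ->
  hd (fun w => ps b (eC w)) z (tpii * ps (fun n => n%:R * b n) (eC z)).
Proof.
move=> hb uz; have q1 := eC_lt1 uz.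
have := @hd_comp _ (ps b) eC z _ _ (hd_ps hb q1) (hd_eC z) => h; apply: (hd_eq h).
have := ps_shift (adm_nat hb) q1; rewrite mul0r subr0 => <-.
by move: (ps _ _) => s; ring.
Qed.

(** Termwise differentiation stays within q^lam times a power series; this is how derivatives are
    seen to be holomorphic again. *)
Lemma qform_hd lam f z : qform lam f -> upper z -> exists2 g, qform lam g & forall z, upper z -> hd f z (g z).
Proof.
move=> [b [hb E]] uz.
pose b' n := tpii * (ofR lam * b n) + tpii * (n%:R * b n).
have hb1 := admZ tpii (admZ (ofR lam) hb); have hb2 := admZ tpii (adm_nat hb).
have hb' : adm b'.
  move=> r hr; have [C1 H1] := hb1 r hr; have [C2 H2] := hb2 r hr; exists (C1 + C2) => n.
  have r0 : 0 <= r by case/andP: hr => /ltW.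
  rewrite /b' (le_trans (ler_wpM2r (exprn_ge0 n r0) (absCD _ _)))// mulrDl.
  exact: lerD.
exists (fun z => eC (ofR lam * z) * ps b' (eC z)); first by exists b'.
move=> {uz z} z uz; have q1 := eC_lt1 uz.
have E' w : upper w -> eC (ofR lam * w) * ps b (eC w) = f w by move=> uw; rewrite E.
apply: (hd_upper uz E'); apply: (hd_eq (hdM (hd_eCl _ z) (hd_ps_eC hb uz))).
have -> : ps b' (eC z) = tpii * (ofR lam * ps b (eC z)) + tpii * ps (fun n => n%:R * b n) (eC z).
  apply: psE; apply: ccvg_eq (ccvgD (ccvgZ tpii (ccvgZ (ofR lam) (ps_cvg hb q1))) (ccvgZ tpii (ps_cvg (adm_nat hb) q1))) => N.
  rewrite !mulr_sumr -big_split /=; apply: eq_bigr => n _; rewrite /b'; ring.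
by move: (ps _ _) (ps _ _) => s s'; ring.
Qed.

Lemma qform_holo lam f : qform lam f -> holo f.
Proof.
move=> h z uz; have [g _ H] := qform_hd h uz; exact: hd_derivable (H z uz).
Qed.

Lemma qform_ext lam f g : (forall z, upper z -> f z = g z) -> qform lam f -> qform lam g.
Proof. by move=> E [b [hb H]]; exists b; split => // z uz; rewrite -E// H. Qed.

Lemma qform_deriv lam f : qform lam f -> qform lam (cderiv f).
Proof.
move=> h; have ui : upper ('i : CC R) by rewrite /upper Im_i.
have [g hg H] := qform_hd h ui.
by apply: qform_ext hg => z uz; rewrite (hd_val (H z uz)).
Qed.

(** Differentiation kills the constant term. *)
Lemma qform_deriv_cusp f : qform 0 f -> ford 1 (cderiv f).
Proof.
move=> [b [hb E]].
have [K [K0 [HK _]]] := ps_bound (adm_shift (admZ tpii (adm_nat hb))) expNtpi.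
exists K; split => // z z1; have uz : upper z := lt_le_trans ltr01 z1.
have E' w : upper w -> ps b (eC w) = f w by move=> uw; rewrite E// ofR0 mul0r eC0 mul1r.
rewrite (hd_val (hd_upper uz E' (hd_ps_eC hb uz))).
have := ps_shift (admZ tpii (adm_nat hb)) (eC_lt1 uz).
rewrite (psZ _ (adm_nat hb) (eC_lt1 uz)) mul0r mulr0 subr0 => <-.
rewrite absCM absC_eC mul1r [leLHS]mulrC.
by rewrite ler_wpM2r ?expR_ge0// HK// eC_le.
Qed.

Lemma periodic_qform f : holo f -> mod_growth f -> (forall z, upper z -> f (z + 1) = f z) -> qform 0 f.
Proof.
move=> h1 h2 h3; apply: (qexp h1 h2 _ _) => [|z uz]; first by rewrite lexx ltr01.
by rewrite ee0 mul1r h3.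
Qed.

End Order.

(** * The eta function *)

Section Eta.
Context {R : realType}.
Implicit Types (z : CC R) (q : CC R) (r : R).

(* [ec N j] is the coefficient of [q^j] in [prod_(n <= N) (1 - q^n)]; [en] majorizes it. *)
Fixpoint ec (N j : nat) : CC R :=
  if N is N'.+1 then ec N' j - (if (N'.+1 <= j)%N then ec N' (j - N'.+1) else 0)
  else (j == 0%N)%:R.

Fixpoint en (N j : nat) : R :=
  if N is N'.+1 then en N' j + (if (N'.+1 <= j)%N then en N' (j - N'.+1) else 0)
  else (j == 0%N)%:R.

Lemma en_ge0 N j : 0 <= en N j.
Proof. by elim: N j => [|N IH] j /=; rewrite ?ler0n// addr_ge0//; case: ifP. Qed.

Lemma ec_le_en N j : absC (ec N j) <= en N j.
Proof.
elim: N j => [|N IH] j /=; first by rewrite absCn.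
rewrite (le_trans (absCBle _ _))// lerD//; case: ifP => // _; by rewrite absC0.
Qed.

Lemma sum_shift (f : nat -> R) N B : (forall j, 0 <= f j) ->
  \sum_(j < B) (if (N <= j)%N then f (j - N)%N else 0) <= \sum_(j < B) f j.
Proof.
move=> f0; have [NB|BN] := leqP N B; last first.
  rewrite big1 ?sumr_ge0// => j _; rewrite leqNgt (ltn_trans _ BN)//.
rewrite -(big_mkord xpredT (fun j => if (N <= j)%N then f (j - N)%N else 0)) -(big_mkord xpredT f).
rewrite (big_cat_nat _ (n := N))//=.
rewrite big1_seq ?add0r; last by move=> j; rewrite mem_index_iota /= => jN; rewrite leqNgt jN.
rewrite -{1}(add0n N) big_addn [leRHS](big_cat_nat _ (n := (B - N)%N)) ?leq_subr//=.
rewrite (eq_big_nat _ _ (F2 := f)); first by rewrite lerDl sumr_ge0.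
by move=> j _; rewrite leq_addl addnK.
Qed.

Lemma en_sum N B r : 0 < r < 1 -> \sum_(j < B) en N j * r ^+ j <= \prod_(n < N) (1 + r ^+ n.+1).
Proof.
move=> /andP[r0 r1]; have rn n : 0 <= r ^+ n by rewrite exprn_ge0// ltW.
elim: N => [|N IH].
  rewrite big_ord0; case: B => [|B]; first by rewrite big_ord0.
  rewrite big_ord_recl /= expr0 mulr1 big1 ?addr0// => j _; by rewrite mul0r.
rewrite big_ord_recr /= mulrDr mulr1.
have -> : \sum_(j < B) (en N j + (if (N < j)%N then en N (j - N.+1) else 0)) * r ^+ j =
  \sum_(j < B) en N j * r ^+ j + r ^+ N.+1 * \sum_(j < B) (if (N.+1 <= j)%N then (en N (j - N.+1) * r ^+ (j - N.+1)) else 0).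
  rewrite mulr_sumr -big_split /=; apply: eq_bigr => j _; rewrite mulrDl; congr (_ + _).
  case: ifP => h; last by rewrite mul0r mulr0.
  by rewrite mulrCA -exprD addnC subnK.
apply: lerD => //; rewrite mulrC ler_wpM2r//; apply: le_trans IH.
by apply: (sum_shift (f := fun j => en N j * r ^+ j)) => j; rewrite mulr_ge0 ?en_ge0.
Qed.

(** A bound for the products of the [1 + r ^+ n] that is uniform in the number of factors, from
    [1 + x <= expR x] and the geometric series. *)
Definition eta_bound r := expR ((1 - r)^-1).

Lemma prod_bound N r : 0 < r < 1 -> \prod_(n < N) (1 + r ^+ n.+1) <= eta_bound r.
Proof.
move=> /andP[r0 r1]; have rn n : 0 <= r ^+ n by rewrite exprn_ge0// ltW.
apply: le_trans (_ : expR (\sum_(n < N) r ^+ n) <= _); last first.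
  by rewrite ler_expR geo_sum_le// (ltW r0).
elim: N => [|N IH]; first by rewrite !big_ord0 expR0.
rewrite !big_ord_recr /= expRD ler_pM//.
- by apply: prodr_ge0 => n _; rewrite addr_ge0.
- by rewrite addr_ge0.
- apply: le_trans (expR_ge1Dx _); rewrite lerD2l exprS ler_piMl// ltW//.
Qed.

Lemma en_bound N j r : 0 < r < 1 -> en N j * r ^+ j <= eta_bound r.
Proof.
move=> hr; apply: le_trans (le_trans (en_sum N j.+1 hr) (prod_bound N hr)).
rewrite big_ord_recr /= lerDr sumr_ge0// => i _; rewrite mulr_ge0 ?en_ge0// exprn_ge0//.
by case/andP: hr => /ltW.
Qed.

Lemma ec_bound N j r : 0 < r < 1 -> absC (ec N j) * r ^+ j <= eta_bound r.
Proof.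
move=> hr; apply: le_trans (en_bound N j hr); rewrite ler_wpM2r ?ec_le_en// exprn_ge0//.
by case/andP: hr => /ltW.
Qed.

Lemma ec_stable N j : (j <= N)%N -> ec N j = ec j j.
Proof.
elim: N => [|N IH]; first by rewrite leqn0 => /eqP ->.
rewrite leq_eqVlt => /predU1P[->//|]; rewrite ltnS => jN /=.
by rewrite ltnNge jN /= subr0 IH.
Qed.

(** Later factors no longer touch the coefficient of q^j, so the diagonal gives the coefficients of
    the infinite product. *)
Definition ecoef j := ec j j.

Lemma adm_ec N : adm (ec N).
Proof. by move=> r hr; exists (eta_bound r) => n; exact: ec_bound. Qed.
Lemma adm_ecoef : adm ecoef.
Proof. by move=> r hr; exists (eta_bound r) => n; exact: ec_bound. Qed.

Lemma ps_ec N q : absC q < 1 -> ps (ec N) q = \prod_(n < N) (1 - q ^+ n.+1).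
Proof.
move=> q1; elim: N => [|N IH].
  rewrite big_ord0; apply: psE; apply: ccvg_shift; apply: ccvg_eq (ccvg_cst 1) => N.
  by rewrite big_ord_recl /= expr0 mulr1 big1 ?addr0// => j _; rewrite mul0r.
rewrite big_ord_recr /= -IH.
have c := ps_cvg (adm_ec N) q1.
apply: psE => e e0.
have c' : ccvg (fun B => \sum_(j < B) ec N j * q ^+ j + (- q ^+ N.+1) * \sum_(j < B - N.+1) ec N j * q ^+ j)
   (ps (ec N) q * (1 - q ^+ N.+1)).
  rewrite mulrBr mulr1 [_ * q ^+ _]mulrC -mulNr; apply: ccvgD => //; apply: ccvgZ.
  move=> e' /c[B0 H]; exists (B0 + N.+1)%N => B hB; apply: H.
  by rewrite leq_subRL ?(leq_trans (leq_addl _ _) hB)// addnC.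
have [B0 H] := c' e e0; exists (maxn B0 N.+1) => B; rewrite geq_max => /andP[B1 B2].
apply: le_trans (H B B1); rewrite le_eqVlt; apply/orP; left; apply/eqP; congr (absC (_ - _)).
transitivity (\sum_(j < B) ec N j * q ^+ j - \sum_(j < B) (if (N.+1 <= j)%N then ec N (j - N.+1) * q ^+ j else 0)).
  rewrite -sumrB; apply: eq_bigr => j _; rewrite mulrBl; congr (_ - _).
  by case: ifP; rewrite ?mul0r.
congr (_ + _); rewrite mulNr; congr (- _).
rewrite -(big_mkord xpredT (fun j => if (N.+1 <= j)%N then ec N (j - N.+1) * q ^+ j else 0)).
rewrite -(big_mkord xpredT (fun j => ec N j * q ^+ j)) (big_cat_nat _ (n := N.+1))//=.
rewrite big1_seq ?add0r; last by move=> j; rewrite mem_index_iota /= => jN; rewrite leqNgt jN.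
rewrite -{1}(add0n N.+1) big_addn mulr_sumr; apply: eq_bigr => j _.
by rewrite leq_addl addnK exprD; ring.
Qed.

Lemma eta_prod_cvg q : absC q < 1 -> ccvg (fun N => \prod_(n < N) (1 - q ^+ n.+1)) (ps ecoef q).
Proof.
move=> q1; have [r [/andP[qr r1] r0]] := between q1 (absC_ge0 q).
have hr : 0 < r < 1 by rewrite r0.
(* The power [absC q ^+ j] is split as [r ^+ j * y ^+ j * y ^+ j]. The first factor controls the
   coefficients, the second gives the decay [y ^+ N] because coefficients of index at most N cancel,
   and the third is summed. *)
pose x := absC q / r; pose y := Num.sqrt x.
have x0 : 0 <= x by rewrite divr_ge0 ?absC_ge0// ltW.
have x1 : x < 1 by rewrite ltr_pdivrMr// mul1r.
have y0 : 0 <= y by exact: sqrtr_ge0.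
have yy : y * y = x by rewrite -expr2 sqr_sqrtr.
have y1 : y < 1 by rewrite -sqrtr1 ltr_sqrt.
pose C := eta_bound r; have C0 : 0 <= C by exact: expR_ge0.
have key N : absC (ps (ec N) q - ps ecoef q) <= 2 * C * (1 - y)^-1 * y ^+ N.
  rewrite -[X in absC X]subr0.
  have c := ccvgD (ps_cvg (adm_ec N) q1) (ccvgZ (-1) (ps_cvg adm_ecoef q1)).
  rewrite mulN1r in c; apply: (ccvg_bound (N0 := 0%N) c) => B _; rewrite subr0 mulr_sumr -big_split /=.
  rewrite (le_trans (absC_sum _ _ _))//.
  apply: le_trans (_ : \sum_(j < B) 2 * C * y ^+ N * y ^+ j <= _); last first.
    rewrite -mulr_sumr mulrAC ler_wpM2r ?exprn_ge0// ler_wpM2l ?mulr_ge0//.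
    by rewrite geo_sum_le// y0.
  apply: ler_sum => j _; have [jN|Nj] := leqP j N.
    by rewrite ec_stable// /ecoef mulN1r subrr absC0 !mulr_ge0// exprn_ge0.
  rewrite (_ : _ + _ = (ec N j - ecoef j) * q ^+ j); last by ring.
  rewrite absCM absCX (_ : absC q = r * x); last by rewrite /x mulrC divfK// gt_eqF.
  rewrite exprMn mulrA -yy exprMn mulrA.
  rewrite ler_wpM2r ?exprn_ge0//; apply: ler_pM => //.
  - by rewrite mulr_ge0 ?absC_ge0// exprn_ge0// ltW.
  - by rewrite exprn_ge0.
  - rewrite (le_trans (ler_wpM2r (exprn_ge0 _ (ltW r0)) (absCBle _ _)))// mulrDl.
    by rewrite mulrDl mul1r lerD// ec_bound.
  - by apply: ler_wiXn2l => //; [exact: ltW|exact: ltnW].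
have cy : ((fun n : nat => y ^+ n) @ \oo --> (0 : R))%classic by apply: cvg_expr; rewrite ger0_norm.
have K0 : 0 <= 2 * C * (1 - y)^-1 by rewrite mulr_ge0 ?mulr_ge0// invr_ge0 subr_ge0 ltW.
move=> e e0; have e1 : 0 < e / (2 * C * (1 - y)^-1 + 1) by rewrite divr_gt0// ltr_wpDl.
move/cvgrPdist_le: cy => /(_ _ e1)[N0 _ HN0].
exists N0 => n nN; rewrite -ps_ec//; apply: le_trans (key n) _.
have := HN0 n nN; rewrite sub0r normrN ger0_norm ?exprn_ge0// => h.
apply: le_trans (ler_wpM2l K0 h) _.
by rewrite mulrCA ler_piMr ?(ltW e0)// ler_pdivrMr ?mul1r ?lerDl// ltr_wpDl.
Qed.

(** Each factor satisfies 1 - r^(n+1) >= exp(- r^n / (1 - r)), and the exponents form a geometric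
    series. Being uniform for |q| <= r, the bound gives both the non-vanishing of eta and its lower
    bound at the cusp. *)
Lemma ecoef_low q r : 0 < r < 1 -> absC q <= r -> expR (- (1 - r)^-1 ^+ 2) <= absC (ps ecoef q).
Proof.
move=> /andP[r0 r1] qr; have d0 : 0 < 1 - r by rewrite subr_gt0.
have rn n : 0 <= r ^+ n by rewrite exprn_ge0// ltW.
have q1 := le_lt_trans qr r1.
have low N : expR (- (1 - r)^-1 ^+ 2) <= absC (\prod_(n < N) (1 - q ^+ n.+1)).
  apply: le_trans (_ : expR (- ((1 - r)^-1 * \sum_(n < N) r ^+ n)) <= _).
    rewrite ler_expR lerN2 expr2 ler_wpM2l ?invr_ge0 ?(ltW d0)//.
    by rewrite geo_sum_le// (ltW r0).
  elim: N => [|N IH]; first by rewrite !big_ord0 mulr0 oppr0 expR0 absC1.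
  rewrite !big_ord_recr /= mulrDr opprD expRD absCM ler_pM ?expR_ge0//.
  apply: le_trans (absC_sub _ _); rewrite absC1 absCX.
  have h1 : absC q ^+ N.+1 <= r ^+ N.+1 by rewrite lerXn2r// nnegrE ?absC_ge0// ltW.
  have h2 : r ^+ N.+1 <= r by rewrite exprS ler_piMr ?(ltW r0)// exprn_ile1// ltW.
  have h3 : r ^+ N.+1 <= r ^+ N by rewrite exprS ler_piMl// ltW.
  apply: le_trans (_ : 1 - r ^+ N.+1 <= _); last by rewrite lerD2l lerN2.
  set x := r ^+ N.+1 in h1 h2 h3 *; have x1 : 0 < 1 - x by lra.
  rewrite expRN -[leRHS]invrK lef_pV2 ?posrE ?expR_gt0 ?invr_gt0//.
  apply: le_trans (_ : 1 + (1 - r)^-1 * r ^+ N <= _); last exact: expR_ge1Dx.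
  rewrite -[leLHS]mul1r ler_pdivrMr//.
  have i0 : 1 <= (1 - r)^-1 by rewrite -[leLHS]invr1 lef_pV2 ?posrE//; lra.
  have i1 : (1 - r)^-1 * (1 - r) = 1 by rewrite mulVf// gt_eqF.
  have : 0 <= x by rewrite /x.
  have := rn N; move: i0 i1; set i := (1 - r)^-1; set t := r ^+ N => i0 i1 t0 x0.
  have : x <= t * (i * (1 - x)); last by nra.
  have : 1 <= i * (1 - x) by rewrite -i1 ler_wpM2l//; [lra|lra].
  by move=> /(ler_wpM2l t0); rewrite mulr1; apply: le_trans.
have c := eta_prod_cvg q1.
apply/ler_addgt0Pr => e e0; have [N H] := c _ e0.
have := H N (leqnn N); have := low N; set p := \prod_(n < N) _ => h1 h2.
have := absC_sub p (ps ecoef q); lra.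
Qed.

Lemma etaE z : upper z -> Defs.eta z = eC (z / 24%:R) * ps ecoef (eC z).
Proof.
move=> uz; rewrite /Defs.eta (ccvg_limn (l := ps ecoef (eC z)))//.
apply: ccvg_eq (eta_prod_cvg (eC_lt1 uz)) => N.
by rewrite -(big_mkord xpredT (fun n => 1 - eC z ^+ n.+1)) big_add1.
Qed.

End Eta.

(** * The logarithmic derivative of eta *)

Section EtaLog.
Context {R : realType}.
Implicit Types (z : CC R).

Local Notation eta := (@Defs.eta R).

Lemma eta_qform : qform 24%:R^-1 eta.
Proof.
exists ecoef; split; first exact: adm_ecoef.
by move=> z uz; rewrite etaE// [z / _]mulrC ofRV ofRn.
Qed.

Lemma ecoef_neq0 (q : CC R) : absC q < 1 -> ps ecoef q != 0.
Proof.
move=> q1; have [r [/andP[qr r1] r0]] := between q1 (absC_ge0 q).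
rewrite -absC_gt0; apply: lt_le_trans (ecoef_low _ (ltW qr)); first exact: expR_gt0.
by rewrite r0.
Qed.

Lemma eta_neq0 z : upper z -> eta z != 0.
Proof. by move=> uz; rewrite etaE// mulf_neq0 ?eC_neq0// ecoef_neq0// eC_lt1. Qed.

Lemma eta_low : exists2 dl : R, 0 < dl & forall z, 1 <= ImC z ->
  dl * expR (- (tpi * (24%:R^-1 * ImC z))) <= absC (eta z).
Proof.
exists (expR (- (1 - expR (- tpi))^-1 ^+ 2)) => [|z z1]; first exact: expR_gt0.
have uz : upper z := lt_le_trans ltr01 z1.
rewrite etaE// absCM [z / _]mulrC -ofRn -ofRV absC_eCl [leRHS]mulrC.
rewrite ler_wpM2r ?expR_ge0//; apply: ecoef_low (eC_le z1); exact: expNtpi.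
Qed.

(** The quasimodular Eisenstein series E2 times [tpii / 24]. *)
Definition ld z : CC R := cderiv eta z / eta z.

Lemma eta_hd z : upper z -> hd eta z (ld z * eta z).
Proof.
move=> uz; rewrite /ld divfK ?eta_neq0//; apply: derivable_hd.
exact: (qform_holo eta_qform).
Qed.

Lemma ld_holo : holo ld.
Proof.
move=> z uz; have h1 := derivable_hd (qform_holo (qform_deriv eta_qform) uz).
exact: hd_derivable (hd_div (eta_neq0 uz) h1 (eta_hd uz)).
Qed.

Lemma ldE z : upper z -> ld z = tpii / 24%:R + tpii * ps (fun n => n%:R * ecoef n) (eC z) / ps ecoef (eC z).
Proof.
move=> uz.
have h1 := @hdM _ (fun w => eC (24%:R^-1 * w)) _ z _ _ (hd_eCl _ z) (hd_ps_eC adm_ecoef uz).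
have E w : upper w -> eC (24%:R^-1 * w) * ps ecoef (eC w) = eta w by move=> uw; rewrite etaE// mulrC [_ / _]mulrC mulrC.
have h2 := hd_upper uz E h1.
rewrite /ld (hd_val h2) etaE// [z / _]mulrC.
have := ecoef_neq0 (eC_lt1 uz); have := eC_neq0 (24%:R^-1 * z).
move: (eC _) (ps _ _) (ps _ _) => a b c a0 c0; field.
by rewrite a0 c0.
Qed.

Lemma upper_add1 z : upper z -> upper (z + 1).
Proof. by rewrite /upper ImD Im1 addr0. Qed.

Lemma ld_per z : upper z -> ld (z + 1) = ld z.
Proof. by move=> uz; rewrite (ldE (upper_add1 uz)) (ldE uz) (eCD z) eC1 mulr1. Qed.

Lemma ld_lim : ford 1 (fun z => ld z - tpii / 24%:R).
Proof.
have hb := adm_nat (@adm_ecoef R).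
have [K [K0 [HK _]]] := ps_bound (adm_shift hb) expNtpi.
pose dl := expR (- (1 - expR (- tpi))^-1 ^+ 2) : R.
have dl0 : 0 < dl by exact: expR_gt0.
have KK : 0 <= tpi * K / dl by apply: divr_ge0; [apply: mulr_ge0 => //; exact: ltW (@tpi0 R)|exact: ltW].
exists (tpi * K / dl); split => //.
move=> z z1; have uz : upper z := lt_le_trans ltr01 z1.
rewrite ldE// addrC addKr mul1r -absC_eC.
have s := ps_shift hb (eC_lt1 uz); rewrite mul0r subr0 in s; rewrite -s.
rewrite absCM absCV absCM absC_tpii absCM ler_pdivrMr; last by rewrite absC_gt0 ecoef_neq0// eC_lt1.
have L : dl <= absC (ps ecoef (eC z)) by apply: ecoef_low (eC_le z1); exact: expNtpi.
have H1 := HK _ (eC_le z1).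
apply: le_trans (_ : tpi * K / dl * absC (eC z) * dl <= _); last first.
  by rewrite ler_wpM2l// mulr_ge0 ?absC_ge0.
rewrite (_ : tpi * K / dl * absC (eC z) * dl = tpi * (absC (eC z) * K)); last by field; rewrite gt_eqF.
by rewrite ler_wpM2l ?(ltW tpi0)// ler_wpM2l ?absC_ge0.
Qed.

Lemma PfunE z : Defs.Pfun z = ('i / ofR pi) * ld z. Proof. by []. Qed.

End EtaLog.

(** * The action of the modular group *)

Section Moebius.
Context {R : realType}.
Implicit Types (z w : CC R) (g h : 'M[int]_2) (s : R).

Lemma mulmx2E g h (i j : 'I_2) : (g *m h) i j = g i ord0 * h ord0 j + g i ord_max * h ord_max j.
Proof.
rewrite mxE !big_ord_recl big_ord0 addr0; congr (_ + g _ _ * h _ _); exact/val_inj.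
Qed.

Lemma SL2E g : SL2 g -> ma g * md g - mb g * mc g = 1.
Proof.
rewrite /SL2 (expand_det_row _ ord0) !big_ord_recl big_ord0 addr0 /cofactor !det_mx11 !mxE /= => <-.
rewrite expr0 expr1 mul1r mulN1r mulrN /ma /mb /mc /md.
have e1 : lift ord0 ord0 = ord_max :> 'I_2 by exact/val_inj.
have e2 : lift (lift ord0 ord0) ord0 = ord0 :> 'I_2 by exact/val_inj.
by rewrite ?e1 ?e2 -?e1 ?e2.
Qed.

Lemma SL2M g h : SL2 g -> SL2 h -> SL2 (g *m h).
Proof. by rewrite /SL2 det_mulmx => -> ->; rewrite mulr1. Qed.

Lemma jfac_neq0 g z : SL2 g -> upper z -> jfac g z != 0.
Proof.
move=> /SL2E dg uz; apply/eqP => /(congr1 (fun w => (ReC w, ImC w))).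
rewrite /jfac !simpRI => -[h1 h2].
have c0 : (mc g)%:~R = 0 :> R.
  by move: h2 => /eqP; rewrite mul0r !addr0 mulf_eq0 (gt_eqF uz) orbF => /eqP.
move: h1; rewrite c0 !mul0r subr0 add0r => /eqP; rewrite intr_eq0 => /eqP d0.
move/eqP: c0; rewrite intr_eq0 => /eqP c0.
by move: dg; rewrite c0 d0 !mulr0 subr0.
Qed.

Lemma absC_sqr_conj w : ofR (absC w ^+ 2) = w * mkC (ReC w) (- ImC w).
Proof. by rewrite absC_sqr; apply: eqC; rewrite !simpRI; ring. Qed.

Lemma mobius_Im g z : SL2 g -> upper z -> ImC (mobius g z) = ImC z / absC (jfac g z) ^+ 2.
Proof.
move=> sg uz; have j0 := jfac_neq0 sg uz; have n0 : absC (jfac g z) ^+ 2 != 0.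
  by rewrite expf_neq0// absC_eq0.
pose w := (ma g)%:~R * z + (mb g)%:~R; pose j := jfac g z.
have e : mobius g z * j = w by rewrite /mobius divfK.
have e2 : mobius g z * ofR (absC j ^+ 2) = w * mkC (ReC j) (- ImC j).
  by rewrite absC_sqr_conj mulrA e.
have := congr1 ImC e2; rewrite ImM Re_of Im_of mulr0 add0r => e3.
apply: (mulIf n0); rewrite divfK// -/j e3 /w /j /jfac !simpRI.
have := congr1 (fun n : int => n%:~R : R) (SL2E sg).
rewrite rmorphB !rmorphM /= => dg.
rewrite -[RHS]mulr1 -[1 in RHS]dg; ring.
Qed.

Lemma mobius_upper g z : SL2 g -> upper z -> upper (mobius g z).
Proof.
move=> sg uz; rewrite /upper mobius_Im// divr_gt0// exprn_gt0// absC_gt0.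
exact: jfac_neq0.
Qed.

Lemma jfacM g h z : SL2 g -> SL2 h -> upper z ->
  jfac (g *m h) z = jfac g (mobius h z) * jfac h z.
Proof.
move=> sg sh uz; have j0 := jfac_neq0 sh uz.
have e : mobius h z * jfac h z = (ma h)%:~R * z + (mb h)%:~R by rewrite divfK.
rewrite [jfac g _]/jfac mulrDl -mulrA e /jfac /ma /mb /mc /md !mulmx2E !rmorphD !rmorphM /=; ring.
Qed.

Lemma mobiusM g h z : SL2 g -> SL2 h -> upper z ->
  mobius (g *m h) z = mobius g (mobius h z).
Proof.
move=> sg sh uz; have j0 := jfac_neq0 sh uz.
have j1 := jfac_neq0 sg (mobius_upper sh uz).
have e : mobius h z * jfac h z = (ma h)%:~R * z + (mb h)%:~R by rewrite divfK.
have e2 : mobius g (mobius h z) * jfac g (mobius h z) = (ma g)%:~R * mobius h z + (mb g)%:~R.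
  by rewrite divfK.
have j2 := jfac_neq0 (SL2M sg sh) uz.
have e3 : mobius (g *m h) z * jfac (g *m h) z = (ma (g *m h))%:~R * z + (mb (g *m h))%:~R.
  by rewrite divfK.
apply: (mulIf j2); rewrite e3 jfacM// mulrA e2.
rewrite [in RHS]mulrDl -[in RHS]mulrA e /jfac /ma /mb /mc /md !mulmx2E !rmorphD !rmorphM /=; ring.
Qed.

Lemma hd_jfac g z : hd (jfac g) z (mc g)%:~R.
Proof.
apply: (hd_eq (hdD (hdZ _ (hd_id z)) (hd_cst (md g)%:~R z))); by rewrite mulr1 addr0.
Qed.

Lemma hd_mobius g z : SL2 g -> upper z -> hd (mobius g) z (jfac g z ^- 2).
Proof.
move=> sg uz; have j0 := jfac_neq0 sg uz.
have h1 := hdD (hdZ (ma g)%:~R (hd_id z)) (hd_cst (mb g)%:~R z).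
apply: (hd_eq (hd_div j0 h1 (hd_jfac g z))).
rewrite -[RHS]mul1r; congr (_ * _).
have := congr1 (fun n : int => n%:~R : CC R) (SL2E sg).
rewrite rmorphB !rmorphM rmorph1 /= => dg; rewrite -[RHS]dg /jfac; ring.
Qed.

Lemma TmatE : (ma Tmat = 1) * (mb Tmat = 1) * (mc Tmat = 0) * (md Tmat = 1).
Proof. by rewrite /ma /mb /mc /md !mxE. Qed.

Lemma SL2_T : SL2 Tmat.
Proof.
rewrite /SL2 (expand_det_row _ ord0) !big_ord_recl big_ord0 addr0 /cofactor !det_mx11 !mxE /=.
by [].
Qed.

Lemma mobiusT z : mobius Tmat z = z + 1.
Proof. by rewrite /mobius /jfac !TmatE mul1r mul0r add0r divr1. Qed.
Lemma jfacT z : jfac Tmat z = 1.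
Proof. by rewrite /jfac !TmatE mul0r add0r. Qed.

Lemma sin_atan (t : R) : sin (atan t) = t * cos (atan t).
Proof.
have h := atanK t; rewrite -{2}h /tan divfK//.
by rewrite gt_eqF// cos_gt0_pihalf// atan_gtNpi2 atan_ltpi2.
Qed.

Lemma absC_cos_atan w : ReC w != 0 -> absC w * cos (atan (ImC w / ReC w)) = `|ReC w|.
Proof.
move=> x0; set t := _ / _.
have c0 : 0 < cos (atan t) by rewrite cos_gt0_pihalf// atan_gtNpi2 atan_ltpi2.
have c2 : cos (atan t) ^+ 2 * (1 + t ^+ 2) = 1.
  rewrite cos_atan exprVn sqr_sqrtr ?mulVf ?addr_ge0 ?sqr_ge0//.
  by rewrite gt_eqF// ltr_pwDl// sqr_ge0.
apply/eqP; rewrite -(eqrXn2 (n := 2))// ?mulr_ge0 ?absC_ge0 ?(ltW c0)//.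
rewrite exprMn absC_sqr real_normK ?num_real// -[eqbRHS]mulr1 -c2 /t; apply/eqP; field.
by [].
Qed.

(** The polar form is what turns [cpow] with an integer exponent into the ordinary power. *)
Lemma cis_Arg w : w != 0 -> w = ofR (absC w) * cis (Arg w).
Proof.
move=> w0; have A := @absC_cos_atan w; rewrite /Arg /cis.
apply: eqC; rewrite !simpRI mul0r ?subr0 ?addr0; case: (ltgtP 0 (ReC w)) => x0.
- by rewrite A ?gt_eqF// gtr0_norm.
- have -> : (if 0 <= ImC w then atan (ImC w / ReC w) + pi else atan (ImC w / ReC w) - pi) =
    atan (ImC w / ReC w) + (if 0 <= ImC w then pi else - pi) by case: ifP.
  have {}A := A (negbT (lt_eqF x0)).
  have -> : cos (atan (ImC w / ReC w) + (if 0 <= ImC w then pi else - pi)) = - cos (atan (ImC w / ReC w)).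
    case: ifP => _; first exact: cosDpi.
    by have := cosDpi (atan (ImC w / ReC w) - pi); rewrite subrK => ->; rewrite opprK.
  by rewrite mulrN A ltr0_norm// opprK.
- case: (ltgtP 0 (ImC w)) => y0; rewrite ?cosN ?cos_pihalf ?mulr0 -?x0//.
  by move: w0; rewrite (eqC (z := w) (w := 0)) ?eqxx// -?x0 -?y0.
- by rewrite sin_atan mulrCA A ?gt_eqF// gtr0_norm// divfK// gt_eqF.
- have -> : (if 0 <= ImC w then atan (ImC w / ReC w) + pi else atan (ImC w / ReC w) - pi) =
    atan (ImC w / ReC w) + (if 0 <= ImC w then pi else - pi) by case: ifP.
  have x1 := negbT (lt_eqF x0); have {}A := A x1.
  have -> : sin (atan (ImC w / ReC w) + (if 0 <= ImC w then pi else - pi)) = - sin (atan (ImC w / ReC w)).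
    case: ifP => _; first exact: sinDpi.
    by have := sinDpi (atan (ImC w / ReC w) - pi); rewrite subrK => ->; rewrite opprK.
  by rewrite mulrN sin_atan mulrCA A ltr0_norm// mulrN opprK divfK.
- have aw : absC w = `|ImC w| by rewrite /absC -x0 expr0n add0r sqrtr_sqr.
  rewrite aw; case: (ltgtP 0 (ImC w)) => y0.
  + by rewrite sin_pihalf mulr1 gtr0_norm.
  + by rewrite sinN sin_pihalf mulrN1 ltr0_norm// opprK.
  + by rewrite -y0 normr0 mul0r.
Qed.

Lemma cpow_neq0 w s : w != 0 -> cpow w s != 0.
Proof.
move=> w0; rewrite /cpow (negbTE w0) mulf_neq0// -absC_gt0 ?absC_cis// absC_of.
by rewrite normr_gt0 gt_eqF// powR_gt0// absC_gt0.
Qed.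

Lemma absC_cpow w s : w != 0 -> absC (cpow w s) = powR (absC w) s.
Proof.
by move=> w0; rewrite /cpow (negbTE w0) absCM absC_cis mulr1 absC_of ger0_norm// powR_ge0.
Qed.

Lemma cpowD w s t : w != 0 -> cpow w (s + t) = cpow w s * cpow w t.
Proof.
move=> w0; rewrite /cpow (negbTE w0) mulrDl cisD powRD; last first.
  by apply/implyP => _; rewrite gt_eqF// absC_gt0.
by rewrite ofRM; ring.
Qed.

Lemma cpow0 w : w != 0 -> cpow w 0 = 1.
Proof. by move=> w0; rewrite /cpow (negbTE w0) mul0r cis0 powRr0 mulr1. Qed.

Lemma cpow1 w : w != 0 -> cpow w 1 = w.
Proof. by move=> w0; rewrite /cpow (negbTE w0) mul1r powRr1 ?absC_ge0// -cis_Arg. Qed.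

Lemma cpow1s s : cpow 1 s = 1 :> CC R.
Proof.
by rewrite /cpow oner_eq0 absC1 powR1 mul1r /Arg Re1 Im1 ltr01 mul0r atan0 mulr0 cis0.
Qed.

Lemma cpowN w s : w != 0 -> cpow w (- s) = (cpow w s)^-1.
Proof.
move=> w0; have := cpowD s (- s) w0; rewrite subrr cpow0// => e.
by apply/esym/mulr1_eq.
Qed.

Lemma cpow_nat w n : w != 0 -> cpow w n%:R = w ^+ n.
Proof.
move=> w0; elim: n => [|n IH]; first by rewrite cpow0.
by rewrite -natr1 cpowD// IH cpow1// exprSr.
Qed.

Lemma cpow_int w (n : int) : w != 0 -> cpow w n%:~R = w ^ n.
Proof.
move=> w0; case: n => n; first by rewrite -pmulrn cpow_nat.
by rewrite NegzE rmorphN /= cpowN// -pmulrn cpow_nat// exprnN.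
Qed.

End Moebius.

(** * Differential equations along segments *)

Section Segment.
Context {R : realType}.
Implicit Types (f : CC R -> CC R) (z w v : CC R) (t : R).

Lemma upper_segment z w t : upper z -> upper w -> 0 <= t <= 1 -> upper (z + ofR t * (w - z)).
Proof.
rewrite /upper !simpRI => z0 w0 /andP[t0 t1]; rewrite mul0r addr0.
have [->|t2] := eqVneq t 1; first by rewrite mul1r addrC subrK.
have : 0 < 1 - t by rewrite subr_gt0 lt_neqAle t2.
by move=> t3; have := mulr_gt0 t3 z0; have := mulr_ge0 t0 (ltW w0); lra.
Qed.

Lemma hd_sqr f z v t (D : CC R) : hd f (z + ofR t * v) D ->
  is_derive t 1 (fun s => absC (f (z + ofR s * v)) ^+ 2)
    (2 * (ReC (f (z + ofR t * v)) * ReC (D * v) + ImC (f (z + ofR t * v)) * ImC (D * v))).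
Proof.
move=> /hd_line[h1 h2].
rewrite (_ : (fun s => _) = (fun s => ReC (f (z + ofR s * v)) * ReC (f (z + ofR s * v)) + ImC (f (z + ofR s * v)) * ImC (f (z + ofR s * v)))).
  have h3 := is_deriveD (is_deriveM h1 h1) (is_deriveM h2 h2).
  refine (is_derive_eq h3 _).
  by rewrite /GRing.scale /=; ring.
by apply/funext => s; rewrite absC_sqr !expr2.
Qed.

Lemma segment_bounded f z w : holo f -> upper z -> upper w ->
  exists M : R, 0 <= M /\ forall t, 0 <= t <= 1 -> absC (f (z + ofR t * (w - z))) <= M.
Proof.
move=> hf uz uw.
pose g t := f (z + ofR (clamp 0 1 t) * (w - z)).
have cg : ccont g.
  apply: ccontP => t e e0; set p := z + ofR (clamp 0 1 t) * (w - z).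
  have up : upper p by apply: upper_segment => //; exact: clamp_in.
  have [d d0 H] := hd_cont (derivable_hd (hf p up)) e0.
  have K0 : 0 < absC (w - z) + 1 by rewrite ltr_wpDl ?absC_ge0.
  exists (d / (absC (w - z) + 1)); first exact: divr_gt0.
  move=> s; rewrite ltr_pdivlMr// => hs.
  rewrite /g; have := H (ofR (clamp 0 1 s - clamp 0 1 t) * (w - z)).
  rewrite (_ : p + _ = z + ofR (clamp 0 1 s) * (w - z)); last by rewrite ofRB /p; ring.
  apply; rewrite absCM absC_of; apply: le_lt_trans hs.
  by rewrite ler_pM ?absC_ge0// ?clamp_lip// lerDl.
have [M [M0 H]] := ccont_bounded cg ler01; exists M; split => // t ht.
by have := H t ht; rewrite /g clamp_id.
Qed.

Lemma gronwall (u u' : R -> R) (K : R) :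
  (forall t, 0 <= t <= 1 -> is_derive t 1 u (u' t)) ->
  (forall t, 0 <= t <= 1 -> u' t <= K * u t) -> u 0 <= 0 -> u 1 <= 0.
Proof.
move=> du le u0; pose e t := expR (- K * t).
have de t : is_derive t 1 e (- K * e t).
  have h := is_derive1_comp (is_derive_expR (- K * t)) (is_deriveZ (- K) (is_derive_id t 1)).
  by refine (is_derive_eq h _); rewrite /e /GRing.scale /= mulr1 mulrC.
have d t : 0 <= t <= 1 -> is_derive t 1 (fun s => u s * e s) (e t * (u' t - K * u t)).
  move=> ht; have h := is_deriveM (du t ht) (de t).
  by refine (is_derive_eq h _); rewrite /GRing.scale /=; ring.
have [c hc] := mvt_diff ltr01 d; rewrite subr0 mulr1 /e mulr0 expR0 mulr1 => E.
have : e c * (u' c - K * u c) <= 0.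
  by apply: mulr_ge0_le0; [exact: expR_ge0|rewrite subr_le0 le].
rewrite -E => h; have : u 1 * expR (- K * 1) <= 0 by lra.
by rewrite pmulr_lle0// expR_gt0.
Qed.

(** Uniqueness for linear systems: along the segment from [z0] to [z] the sum [u] of the squared
    moduli satisfies [u' <= K * u] and starts at 0, so Gronwall's inequality applies. *)
Lemma linear_ode_zero n (y : 'I_n -> CC R -> CC R) (A : 'I_n -> 'I_n -> CC R -> CC R) z0 z :
  (forall i j, holo (A i j)) ->
  (forall i w, upper w -> hd (y i) w (\sum_j A i j w * y j w)) ->
  upper z0 -> upper z -> (forall i, y i z0 = 0) -> forall i, y i z = 0.
Proof.
move=> hA dy uz0 uz y0.
have /choice[B /all_and2[B0 HB]] : forall ij : 'I_n * 'I_n, exists M : R, 0 <= M /\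
    forall t, 0 <= t <= 1 -> absC (A ij.1 ij.2 (z0 + ofR t * (z - z0))) <= M.
  by move=> ij; exact: segment_bounded.
pose M := \sum_i \sum_j B (i, j).
have BM i j : B (i, j) <= M.
  rewrite /M (bigD1 i)//= (bigD1 j)//= -addrA lerDl addr_ge0//.
    by apply: sumr_ge0 => ? _; exact: B0.
  by apply: sumr_ge0 => ? _; apply: sumr_ge0 => ? _; exact: B0.
have M0 : 0 <= M by apply: sumr_ge0 => ? _; apply: sumr_ge0 => ? _; exact: B0.
pose v := z - z0; pose g t := z0 + ofR t * v.
pose u t := \sum_i absC (y i (g t)) ^+ 2.
pose dd t i := \sum_j A i j (g t) * y j (g t).
pose u' t := \sum_i (2 * (ReC (y i (g t)) * ReC (dd t i * v) + ImC (y i (g t)) * ImC (dd t i * v))).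
pose V := absC v.
have V0 : 0 <= V by exact: absC_ge0.
have ug t : 0 <= t <= 1 -> upper (g t) by move=> ht; exact: upper_segment.
have du t : 0 <= t <= 1 -> is_derive t 1 u (u' t).
  move=> ht; have h i := hd_sqr (dy i _ (ug t ht)).
  have := is_derive_sum h; rewrite (_ : \sum_(i < n) _ = u)//.
  by apply/funext => s; rewrite fct_sumE.
have le t : 0 <= t <= 1 -> u' t <= (2 * n%:R * M * V) * u t.
  move=> ht.
  have key i : 2 * (ReC (y i (g t)) * ReC (dd t i * v) + ImC (y i (g t)) * ImC (dd t i * v)) <=
      \sum_j M * V * (absC (y i (g t)) ^+ 2 + absC (y j (g t)) ^+ 2).
    apply: le_trans (_ : 2 * (absC (y i (g t)) * absC (dd t i * v)) <= _).
      rewrite ler_pM2l//; set p := y i (g t); set q := dd t i * v.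
      pose p' := mkC (ReC p) (- ImC p).
      have -> : absC p = absC p' by rewrite /absC /p' Re_mk Im_mk sqrrN.
      rewrite -absCM; apply: le_trans (Re_absC _); apply: le_trans (ler_norm _).
      by rewrite ReM /p' Re_mk Im_mk; lra.
    rewrite absCM.
    apply: le_trans (_ : 2 * (absC (y i (g t)) * ((\sum_j M * absC (y j (g t))) * V)) <= _).
      rewrite ler_pM2l// ler_wpM2l ?absC_ge0// ler_wpM2r//.
      apply: le_trans (absC_sum _ _ _) _; apply: ler_sum => j _; rewrite absCM.
      by rewrite ler_wpM2r ?absC_ge0//; apply: le_trans (BM i j); exact: (HB (i, j)).
    rewrite mulr_suml !mulr_sumr; apply: ler_sum => j _.
    set p := absC _; set q := absC _.
    have MV0 : 0 <= M * V by exact: mulr_ge0.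
    (* The mixed products are bounded by [2 * p * q <= p ^+ 2 + q ^+ 2]. *)
    have : 0 <= M * V * (p - q) ^+ 2 by rewrite mulr_ge0// sqr_ge0.
    rewrite sqrrB; lra.
  apply: le_trans (ler_sum _ (fun i _ => key i)) _.
  rewrite le_eqVlt; apply/orP; left; apply/eqP.
  under eq_bigr do rewrite -mulr_sumr big_split /= sumr_const card_ord.
  rewrite -mulr_sumr big_split /= sumrMnl sumr_const card_ord /u.
  by move: (\sum_(i < n) absC (y i (g t)) ^+ 2) => S; rewrite -[S *+ n]mulr_natl; ring.
have u1 : u 1 <= 0.
  apply: gronwall du le _; rewrite /u big1// => i _.
  by rewrite /g ofR0 mul0r addr0 y0 absC0 expr0n.
move=> i; apply/eqP; rewrite -absC_eq0 -sqrf_eq0 eq_le sqr_ge0 andbT.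
have g1 : g 1 = z by rewrite /g /v ofR1 mul1r addrC subrK.
apply: le_trans u1; rewrite /u (bigD1 i)//= g1 lerDl sumr_ge0// => ? _; exact: sqr_ge0.
Qed.

(** The derivative of ln |f|^2 is twice the real part of the logarithmic derivative. The square
    keeps the modulus polynomial in real and imaginary parts. *)
Lemma hd_ln f z v t (D : CC R) : hd f (z + ofR t * v) D -> f (z + ofR t * v) != 0 ->
  is_derive t 1 (fun s => ln (absC (f (z + ofR s * v)) ^+ 2)) (2 * ReC (D * v / f (z + ofR t * v))).
Proof.
move=> h f0; have p0 : 0 < absC (f (z + ofR t * v)) ^+ 2 by rewrite exprn_gt0// absC_gt0.
have h1 := @is_derive1_comp R (@ln R) (fun s => absC (f (z + ofR s * v)) ^+ 2) t _ _ (is_derive1_ln p0) (hd_sqr h).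
refine (is_derive_eq h1 _).
set p := f _ in f0 p0 *; set q := D * v.
have e : q / p = ofR (absC p ^- 2) * (q * mkC (ReC p) (- ImC p)).
  have a0 : ofR (absC p ^+ 2) != 0 :> CC R by rewrite ofR_eq0 gt_eqF.
  apply: (mulIf a0); rewrite ofRV [in RHS]mulrAC mulVf// mul1r absC_sqr_conj.
  by rewrite mulrA divfK.
rewrite e ReM Re_of Im_of mul0r subr0 ReM Re_mk Im_mk; ring.
Qed.

Lemma hd0_const f z w : (forall z, upper z -> hd f z 0) -> upper z -> upper w -> f w = f z.
Proof.
move=> h uz uw; have d t : 0 <= t <= 1 -> hd f (z + ofR t * (w - z)) 0.
  by move=> ht; apply: h; exact: upper_segment.
have e0 : z + ofR 0 * (w - z) = z by rewrite ofR0 mul0r addr0.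
have e1 : z + ofR 1 * (w - z) = w by rewrite ofR1 mul1r addrC subrK.
apply: eqC.
  have := @derive0_const R (fun s => ReC (f (z + ofR s * (w - z)))) 0 1 _ ler01.
  by rewrite e0 e1; apply => t /d /hd_line[]; rewrite mul0r.
have := @derive0_const R (fun s => ImC (f (z + ofR s * (w - z)))) 0 1 _ ler01.
by rewrite e0 e1; apply => t /d /hd_line[]; rewrite mul0r.
Qed.

(* A holomorphic function with prescribed modulus [C * |j|^s] has the logarithmic
   derivative of [j^s]: only the modulus of the (branch dependent) power is used. *)
Lemma log_deriv_of_modulus f (j : CC R -> CC R) z (D D' : CC R) (s C : R) :
  upper z -> hd f z D -> hd j z D' -> f z != 0 -> j z != 0 -> 
  (forall w, upper w -> ln (absC (f w) ^+ 2) = C + s * ln (absC (j w) ^+ 2)) ->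
  D / f z = ofR s * (D' / j z).
Proof.
move=> uz hf hj f0 j0 E.
have key v : ReC (D * v / f z) = s * ReC (D' * v / j z).
  have z0 : z + ofR 0 * v = z by rewrite ofR0 mul0r addr0.
  have h1 := @hd_ln f z v 0 D; rewrite z0 in h1; have {}h1 := h1 hf f0.
  have h2 := @hd_ln j z v 0 D'; rewrite z0 in h2; have {}h2 := h2 hj j0.
  have [d d0 U] := upper_nbhs uz.
  have h3 : is_derive (0 : R) 1 (fun t : R => C + s * ln (absC (j (z + ofR t * v)) ^+ 2)) (s * (2 * ReC (D' * v / j z))).
    have := is_deriveD (is_derive_cst C (0 : R) (1 : R)) (is_deriveZ s h2).
    by rewrite add0r.
  have h4 : is_derive (0 : R) 1 (fun t : R => ln (absC (f (z + ofR t * v)) ^+ 2)) (s * (2 * ReC (D' * v / j z))).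
    apply/rdP => e /(proj1 (rdP _ _ _) h3)[dl dl0 H].
    have V0 : 0 < absC v + 1 by rewrite ltr_wpDl ?absC_ge0.
    exists (Num.min dl (d / (absC v + 1))); first by rewrite min_gt0 ?divr_gt0.
    move=> h; rewrite lt_min ltr_pdivlMr// => /andP[/H h5 h6].
    rewrite !E ?z0//.
      by rewrite z0 in h5.
    apply: U; rewrite add0r addrC addKr absCM absC_of; apply: le_lt_trans h6.
    by rewrite ler_wpM2l// lerDl.
  by have [_ e1] := h1; have [_ e2] := h4; rewrite e1 in e2; lra.
(* The directions 1 and i recover the real and the imaginary part of the quotients. *)
have k1 := key 1; have k2 := key 'i.
rewrite !mulr1 in k1; rewrite ![_ * 'i]mulrC -!mulrA in k2.
have := k1; have := k2; move: (D / f z) (D' / j z) => p q.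
rewrite !ReM Re_i Im_i !mul0r !mul1r !sub0r => k3 k4.
by apply: eqC; rewrite !simpRI; lra.
Qed.

End Segment.

(** * Determinants of three vectors *)

Section Det3.
Context {K : fieldType}.
Implicit Types (U V W X : 'cV[K]_3) (A B : 'M[K]_3).

Definition o0 : 'I_3 := @Ordinal 3 0 isT.
Definition o1 : 'I_3 := @Ordinal 3 1 isT.
Definition o2 : 'I_3 := @Ordinal 3 2 isT.

Lemma ord3P (i : 'I_3) : [\/ i = o0, i = o1 | i = o2].
Proof.
case: i => -[|[|[|//]]] h; [constructor 1|constructor 2|constructor 3]; exact/val_inj.
Qed.

Lemma sum3 (V : nmodType) (f : 'I_3 -> V) : \sum_i f i = f o0 + (f o1 + f o2).
Proof. by rewrite !big_ord_recl big_ord0 addr0; congr (f _ + (f _ + f _)); exact/val_inj. Qed.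

(** The determinant of the three columns, written out so that its identities are polynomial
    identities for [ring] and it can be differentiated term by term. *)
Definition det3 U V W : K :=
  U o0 ord0 * (V o1 ord0 * W o2 ord0 - V o2 ord0 * W o1 ord0)
  - U o1 ord0 * (V o0 ord0 * W o2 ord0 - V o2 ord0 * W o0 ord0)
  + U o2 ord0 * (V o0 ord0 * W o1 ord0 - V o1 ord0 * W o0 ord0).

Definition det3M A := det3 (col o0 A) (col o1 A) (col o2 A).

Lemma mulmxV_E A U i : (A *m U) i ord0 = A i o0 * U o0 ord0 + (A i o1 * U o1 ord0 + A i o2 * U o2 ord0).
Proof. by rewrite mxE sum3. Qed.

Lemma det3_mul A U V W : det3 (A *m U) (A *m V) (A *m W) = det3M A * det3 U V W.
Proof. by rewrite /det3M /det3 !mulmxV_E !mxE; ring. Qed.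

Lemma det3M_neq0 A : A \in unitmx -> det3M A != 0.
Proof.
move=> uA; have h := mulmxV uA.
have : det3M A * det3M (invmx A) = 1.
  rewrite {2}/det3M -det3_mul !colE !mulmxA h !mul1mx /det3 !mxE /=; ring.
by move=> e; apply/eqP => e0; move: e; rewrite e0 mul0r => /eqP; rewrite eq_sym oner_eq0.
Qed.

Lemma cramer3 X U V W : det3 U V W *: X =
  det3 X V W *: U + (det3 U X W *: V + det3 U V X *: W).
Proof.
apply/matrixP => i j; rewrite (ord1 j) !mxE /det3.
by case: (ord3P i) => ->; ring.
Qed.

(** The relation is taken among the rows: with F, F', F'' as columns, it is one combination of the
    components of F that vanishes at the point together with its first two derivatives. *)
Lemma det3_eq0 U V W : det3 U V W = 0 -> exists2 a : 'I_3 -> K, (exists i, a i != 0) &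
  [/\ \sum_i a i * U i ord0 = 0, \sum_i a i * V i ord0 = 0 & \sum_i a i * W i ord0 = 0].
Proof.
move=> d0.
pose A : 'M[K]_3 := \matrix_(i, j) (if j == o0 then U i ord0 else if j == o1 then V i ord0 else W i ord0).
have : \det A == 0.
  apply/eqP; rewrite -d0 (expand_det_col _ ord0) !big_ord_recl big_ord0 /cofactor.
  rewrite !(expand_det_row _ ord0) !big_ord_recl !big_ord0 /cofactor !det_mx11 !mxE /=.
  have e0 : ord0 = o0 by exact/val_inj.
  have e1 : lift ord0 ord0 = o1 by exact/val_inj.
  have e2 : lift ord0 (lift ord0 ord0) = o2 by exact/val_inj.
  have e3 : lift o1 ord0 = o0 by exact/val_inj.
  have e4 : lift o1 (lift ord0 ord0) = o2 by exact/val_inj.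
  have e5 : lift o2 ord0 = o0 by exact/val_inj.
  have e6 : lift o2 (lift ord0 ord0) = o1 by exact/val_inj.
  rewrite ?e2 ?e1 ?e0 ?e3 ?e4 ?e5 ?e6 /bump /= /det3; ring.
move/det0P => [v v0 vA]; exists (fun i => v ord0 i).
  apply: contrapT => h; case/eqP: v0; apply/rowP => i; rewrite mxE; apply/eqP/negPn/negP => vi.
  by apply: h; exists i.
have key j : \sum_i v ord0 i * A i j = 0 by have := congr1 (fun M : 'rV_3 => M ord0 j) vA; rewrite !mxE.
by split; [rewrite -[RHS](key o0)|rewrite -[RHS](key o1)|rewrite -[RHS](key o2)]; apply: eq_bigr => i _; rewrite mxE.
Qed.

End Det3.

(** * Generation of the modular group by S and T *)

Section Generation.
Implicit Types (g h : 'M[int]_2) (a b c d n : int).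

Definition mk2 a b c d : 'M[int]_2 :=
  \matrix_(i < 2, j < 2) (if i == ord0 then (if j == ord0 then a else b) else (if j == ord0 then c else d)).

Definition Smat := mk2 0 (-1) 1 0.
Definition Tn n := mk2 1 n 0 1.

Lemma mk2_eta g : g = mk2 (ma g) (mb g) (mc g) (md g).
Proof.
apply/matrixP => i j; rewrite !mxE /ma /mb /mc /md.
case: i => -[|[|//]] hi; case: j => -[|[|//]] hj /=; congr (g _ _); exact/val_inj.
Qed.

Lemma mk2E a b c d : (ma (mk2 a b c d) = a) * (mb (mk2 a b c d) = b) * (mc (mk2 a b c d) = c) * (md (mk2 a b c d) = d).
Proof. by rewrite /ma /mb /mc /md !mxE. Qed.

Lemma mulE g h : g *m h = mk2 (ma g * ma h + mb g * mc h) (ma g * mb h + mb g * md h)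
  (mc g * ma h + md g * mc h) (mc g * mb h + md g * md h).
Proof. by rewrite (mk2_eta (g *m h)) /ma /mb /mc /md !mulmx2E. Qed.

Lemma det2E g : \det g = ma g * md g - mb g * mc g.
Proof.
rewrite (expand_det_row _ ord0) !big_ord_recl big_ord0 addr0 /cofactor !det_mx11 !mxE /=.
rewrite expr0 expr1 mul1r mulN1r mulrN /ma /mb /mc /md.
have e1 : lift ord0 ord0 = ord_max :> 'I_2 by exact/val_inj.
have e2 : lift (lift ord0 ord0) ord0 = ord0 :> 'I_2 by exact/val_inj.
by rewrite ?e1 ?e2 -?e1 ?e2.
Qed.

Lemma SL2_mk2 a b c d : a * d - b * c = 1 -> SL2 (mk2 a b c d).
Proof. by rewrite /SL2 det2E !mk2E. Qed.

Lemma mk2_1 : mk2 1 0 0 1 = 1%:M.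
Proof. by rewrite [RHS]mk2_eta /ma /mb /mc /md !mxE. Qed.

Lemma SL2_S : SL2 Smat. Proof. by apply: SL2_mk2; rewrite mul0r mulN1r opprK add0r. Qed.
Lemma SL2_Tn n : SL2 (Tn n). Proof. by apply: SL2_mk2; rewrite mulr0 mulr1 subr0. Qed.
Lemma Tn1 : Tn 1 = Tmat. Proof. by rewrite [RHS]mk2_eta !TmatE. Qed.

(** Euclid's algorithm on the first column. Since [P] is closed only under products, inverses are
    written as positive words: S^(-1) = S^3 and T^(-1) = S^3 T S T S. *)
Lemma SL2_ind (P : 'M[int]_2 -> Prop) : P 1%:M -> P Smat -> P Tmat ->
  (forall g h, SL2 g -> SL2 h -> P g -> P h -> P (g *m h)) -> forall g, SL2 g -> P g.
Proof.
move=> P1 PS PT PM.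
have SS : SL2 (Smat *m Smat) := SL2M SL2_S SL2_S.
have PSS : P (Smat *m Smat) by apply: (PM) => //; exact: SL2_S.
have S3 : SL2 (Smat *m Smat *m Smat) := SL2M SS SL2_S.
have PS3 : P (Smat *m Smat *m Smat) by apply: (PM) => //; exact: SL2_S.
have sTi : SL2 (Tn (-1)) := SL2_Tn _.
have PTi : P (Tn (-1)).
  have -> : Tn (-1) = Smat *m Smat *m Smat *m (Tmat *m (Smat *m (Tmat *m Smat))).
    by rewrite -Tn1 /Tn !mulE !mk2E; congr mk2; ring.
  have s1 := SL2M SL2_T SL2_S; have s2 := SL2M SL2_S s1; have s3 := SL2M SL2_T s2.
  by apply: (PM) => //; apply: (PM) => //; [exact: SL2_T|apply: (PM) => //; [exact: SL2_S|apply: (PM) => //; [exact: SL2_T|exact: SL2_S]]].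
have PTn n : P (Tn n).
  elim/int_rect: n => [|n IH|n IH]; first by rewrite /Tn mk2_1.
    have -> : Tn n.+1%:Z = Tmat *m Tn n by rewrite -Tn1 /Tn !mulE !mk2E; congr mk2; rewrite ?intS; ring.
    by apply: (PM) => //; [exact: SL2_T|exact: SL2_Tn].
  have -> : Tn (- n.+1%:Z) = Tn (-1) *m Tn (- n%:Z) by rewrite /Tn !mulE !mk2E; congr mk2; rewrite ?intS; ring.
  by apply: (PM) => //; exact: SL2_Tn.
move=> g sg; have [N hN] := ubnP `|mc g|%N; elim: N g sg hN => // N IH g sg hN.
have dg : ma g * md g - mb g * mc g = 1 by rewrite -det2E.
(* With vanishing lower left entry [g] is T^n or -T^n, and -1 = S^2. *)
have [c0|c0] := eqVneq (mc g) 0.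
  move: dg; rewrite c0 mulr0 subr0 => ad.
  have /eqP := congr1 absz ad; rewrite abszM muln_eq1 => /andP[/eqP ua _].
  have [a1|a1] : ma g = 1 \/ ma g = -1.
    by case: (ma g) ua => [[|[|n]]|[|n]]//= _; [left|right].
    have d1 : md g = 1 by move: ad; rewrite a1 mul1r.
    by rewrite (mk2_eta g) a1 c0 d1; exact: PTn.
  have d1 : md g = -1 by move: ad; rewrite a1 mulN1r => /eqP; rewrite eqr_oppLR => /eqP.
  have -> : g = Smat *m Smat *m Tn (- mb g).
    by rewrite {1}(mk2_eta g) a1 c0 d1 /Tn !mulE !mk2E; congr mk2; ring.
  by apply: (PM) => //; exact: SL2_Tn.
pose q := (ma g %/ mc g)%Z.
(* The lower left entry of S T^(-q) g is the remainder of [ma g] modulo [mc g], so the measure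
   decreases. *)
pose g' := Smat *m (Tn (- q) *m g).
have sg' : SL2 g' by apply: SL2M SL2_S (SL2M (SL2_Tn _) sg).
have c' : mc g' = (ma g %% mc g)%Z.
  have -> : (ma g %% mc g)%Z = ma g - q * mc g.
    by rewrite [X in _ = X - _](divz_eq (ma g) (mc g)) addrC addKr.
  by rewrite /g' /Tn !mulE !mk2E; ring.
have -> : g = Tn q *m (Smat *m Smat *m Smat *m g').
  by rewrite {1}(mk2_eta g) /g' /Tn !mulE !mk2E; congr mk2; ring.
apply: (PM); [exact: SL2_Tn|exact: SL2M|exact: PTn|apply: (PM) => //].
apply: (IH) => //; rewrite c'; rewrite ltnS in hN; apply: leq_trans hN.
have := ltz_mod (ma g) c0; have := modz_ge0 (ma g) c0.
by move: (ma g %% mc g)%Z => [r|//] _; rewrite -abszE ltz_nat.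
Qed.

End Generation.

(** * Reduction to imaginary part above 1/2 *)

Section Reduction.
Context {R : realType}.
Implicit Types (z : CC R).

Lemma mobius_Tn (n : int) z : mobius (Tn n) z = z + n%:~R.
Proof. by rewrite /mobius /jfac !mk2E mul1r mul0r add0r divr1. Qed.

Lemma mobius_S z : mobius Smat z = - z^-1.
Proof. by rewrite /mobius /jfac !mk2E mul0r mul1r addr0 add0r mulN1r. Qed.
Lemma jfac_S z : jfac Smat z = z.
Proof. by rewrite /jfac !mk2E mul1r addr0. Qed.

Lemma mobius1 z : mobius 1%:M z = z.
Proof. by rewrite -mk2_1 /mobius /jfac !mk2E mul1r mul0r add0r divr1 addr0. Qed.
Lemma jfac1 z : jfac 1%:M z = 1.
Proof. by rewrite -mk2_1 /jfac !mk2E mul0r add0r. Qed.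

(** Translate to |Re z| <= 1/2. If also Im z <= 1/2, then |z|^2 <= 1/2 and S at least doubles the
    imaginary part; the exponent in [2 ^+ n * ImC z] bounds the number of doublings. The threshold
    1/2 suffices later and is easier to reach than that of the fundamental domain. *)
Lemma reduction z : upper z -> exists g, SL2 g /\ 1 / 2 < ImC (mobius g z).
Proof.
move=> uz.
have key n : forall z, upper z -> 1 / 2 < 2 ^+ n * ImC z -> exists g, SL2 g /\ 1 / 2 < ImC (mobius g z).
  elim: n => [|n IH] {uz z} z uz.
    rewrite expr0 [1 * ImC z]mul1r => h; exists 1%:M; split; first by rewrite /SL2 det1.
    by rewrite mobius1.
  move=> h; have [big|small] := ltP (1 / 2) (ImC z).
    by exists 1%:M; split; [rewrite /SL2 det1|rewrite mobius1].
  pose k := Num.floor (ReC z + 1 / 2).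
  have /andP[k1 k2] := floor_itv (ReC z + 1 / 2).
  rewrite -/k in k1 k2.
  pose z1 := z + (- k)%:~R.
  have re1 : ReC z1 = ReC z - k%:~R by rewrite /z1 !simpRI rmorphN.
  have im1 : ImC z1 = ImC z by rewrite /z1 !simpRI addr0.
  have uz1 : upper z1 by rewrite /upper im1.
  pose z2 := mobius Smat z1.
  have uz2 : upper z2 by apply: mobius_upper => //; exact: SL2_S.
  have n2 : absC z1 ^+ 2 <= 1 / 2.
    rewrite absC_sqr re1 im1.
    have h1 : (ReC z - k%:~R) ^+ 2 <= 1 / 4.
      have : `|ReC z - k%:~R| <= 1 / 2.
        by rewrite ler_norml; move: k2; rewrite intrD; lra.
      by move=> h1; rewrite -real_normK ?num_real//; have := normr_ge0 (ReC z - k%:~R); nra.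
    have h2 : ImC z ^+ 2 <= 1 / 4 by have : 0 < ImC z := uz; nra.
    lra.
  have n0 : 0 < absC z1 ^+ 2.
    rewrite exprn_gt0// absC_gt0; apply: contraTneq uz1 => ->.
    by rewrite /upper Im0 ltxx.
  have im2 : 2 * ImC z <= ImC z2.
    rewrite /z2 mobius_Im//; last exact: SL2_S.
    rewrite jfac_S im1 ler_pdivlMr//; have : 0 < ImC z := uz; nra.
  have [|g [sg hg]] := IH z2 uz2.
    apply: lt_le_trans h _; rewrite exprSr -mulrA ler_wpM2l// exprn_ge0.
  exists (g *m (Smat *m Tn (- k))); split; first exact: SL2M sg (SL2M SL2_S (SL2_Tn _)).
  by rewrite (mobiusM sg (SL2M SL2_S (SL2_Tn (- k))) uz) (mobiusM SL2_S (SL2_Tn (- k)) uz) mobius_Tn.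
have [n hn] := half_pow_small (1 / 2 : R) (uz : 0 < ImC z).
by apply: (key n) => //; rewrite -ltr_pdivrMl ?exprn_gt0// mulrC.
Qed.

End Reduction.

(** * Scalar modular forms *)

Section WeightZeroCusp.
Context {R : realType}.
Implicit Types (f : CC R -> CC R) (z w : CC R).

(** The coefficient is the same at every height, while its integrand is O(exp(-2 pi y)). *)
Lemma bcoef0_cusp f y0 : holo f -> (forall w, upper w -> f (w + 1) = f w) -> ford 1 f -> 0 < y0 ->
  bcoef f 0 y0 = 0.
Proof.
move=> hf per [K [K0 HK]] y00; apply/eqP; rewrite -absC_eq0; apply/negPn/negP => b0.
set be := absC _ in b0; have be0 : 0 < be by rewrite lt_def b0 absC_ge0.
(* At this height [1 + x <= expR x] already contradicts the bound. *)
pose y := 2 * K / be + 1; have y1 : 1 <= y by rewrite lerDr divr_ge0 ?mulr_ge0// ltW.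
have y2 : 0 < y := lt_le_trans ltr01 y1.
have h : be <= 2 * (K * expR (- (tpi * y))) * (1 - 0).
  rewrite /be (bcoef_const hf per 0 y00 y2); apply: cint_bound => //.
    exact: g_line_cont.
  move=> t _; rewrite absCM mulNr mul0r oppr0 eC0 absC1 mulr1 -[X in tpi * X]mul1r.
  exact: HK.
have t2 := @pi_ge2 R; have e1 := expR_ge1Dx (tpi * y); have e0 := expR_gt0 (tpi * y).
have : be * expR (tpi * y) <= 2 * K.
  rewrite -ler_pdivlMr// -expRN; apply: le_trans h _; rewrite subr0 mulr1; lra.
suff : 2 * K < be * expR (tpi * y) by move=> h1 h2; have := lt_le_trans h1 h2; rewrite ltxx.
have <- : (y - 1) * be = 2 * K by rewrite /y addrK mulfVK// gt_eqF.
rewrite mulrC ltr_pM2l//; apply: lt_le_trans e1; rewrite /tpi; nra.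
Qed.

(** The exponent is -24 pi / 25. Cut into eight equal parts, it is handled with [pi >= 2] and
    [1 + x <= expR x] alone, since (31/25)^8 exceeds 5. *)
Lemma expR_pi_lt : expR (- (tpi * (1 / 2))) * expR (tpi * (1 / 50)) <= 1 / 5 :> R.
Proof.
have p2 := @pi_ge2 R; rewrite -expRD; set s := (X in expR X); pose u : R := 3 / 25 * pi.
have -> : s = - (8%:R * u) by rewrite /s /u /tpi; field.
rewrite expRN expRM_natl -[leRHS]invrK lef_pV2 ?posrE ?exprn_gt0 ?expR_gt0//.
have h : 31 / 25 <= expR u by apply: le_trans (expR_ge1Dx u); rewrite /u; lra.
apply: le_trans (_ : (31 / 25) ^+ 8 <= _); first by rewrite div1r invrK !exprS expr0; lra.
by apply: lerXn2r => //; rewrite nnegrE ?expR_ge0//; lra.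
Qed.

(* Plays the part of the maximum principle: the q-coefficients are bounded by [2 M |q|^(-n)] on
   the line [Im z = 1/50], and the constant one is zero. *)
Lemma cusp_halve f (M : R) : holo f -> (forall w, upper w -> f (w + 1) = f w) -> ford 1 f ->
  (forall z, upper z -> absC (f z) <= M) -> forall z, 1 / 2 < ImC z -> absC (f z) <= M / 2.
Proof.
move=> hf per of1 HM z z2; pose y0 : R := 1 / 50.
have y00 : 0 < y0 by rewrite /y0; lra.
have uz : upper z by apply: lt_trans z2; lra.
have M0 : 0 <= M := le_trans (absC_ge0 _) (HM z uz).
have small : forall e : R, 0 < e -> exists Y : R, forall x y, Y < y ->
  absC (f (mkC x y)) <= e * expR (tpi * y).
  move=> e e0; have [K [K0 HK]] := of1; exists (1 + K / e) => x y hy.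
  have K1 : 0 <= K / e by rewrite divr_ge0// ltW.
  have y1 : 1 <= y by apply: le_trans (ltW hy); rewrite lerDl.
  apply: le_trans (HK (mkC x y) y1) _; rewrite Im_mk mul1r expRN ler_pdivrMr ?expR_gt0//.
  have t2 := @pi_ge2 R; have e1 := expR_ge1Dx (tpi * y).
  have h : K / e <= expR (tpi * y) by apply: le_trans e1; rewrite /tpi; nra.
  have h1 : 1 <= expR (tpi * y) by apply: le_trans e1; rewrite lerDl mulr_ge0 ?(ltW tpi0)//; lra.
  rewrite ler_pdivrMr// in h; nra.
have cv := bcoef_sum hf per small uz y00 _.
have {}cv := cv (lt_trans (_ : y0 < 1 / 2) z2); have {}cv := cv ltac:(rewrite /y0; lra).
pose X : R := expR (tpi * y0).
have bb n : absC (bcoef f n y0) <= 2 * (M * X ^+ n).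
  rewrite -[leRHS]mulr1 -[X in _ <= _ * X](subr0 1); apply: cint_bound => //; first exact: g_line_cont.
  move=> t _; rewrite absCM absC_eC.
  have -> : - (tpi * ImC (- n%:R * mkC t y0)) = n%:R * (tpi * y0) by rewrite mulNr !simpRI; ring.
  by rewrite expRM_natl ler_wpM2r ?exprn_ge0 ?expR_ge0// HM.
have x5 : X * absC (eC z) <= 1 / 5.
  rewrite absC_eC; apply: le_trans expR_pi_lt; rewrite mulrC ler_wpM2r ?expR_ge0//.
  by rewrite ler_expR lerN2 ler_wpM2l ?(ltW tpi0)// ltW.
rewrite -[f z]subr0; apply: (ccvg_bound (N0 := 1) cv) => -[//|N] _.
rewrite subr0 big_ord_recl expr0 bcoef0_cusp// mul0r add0r.
apply: le_trans (absC_sum _ _ _) _.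
(* The term of index n >= 1 is at most 2 M (1/5)^n, and the sum is (2 M / 5) (5 / 4) = M / 2. *)
apply: le_trans (_ : \sum_(i < N) (2 * M / 5) * (1 / 5) ^+ i <= _).
  apply: ler_sum => i _; rewrite absCM absCX lift0.
  apply: le_trans (ler_wpM2r _ (bb _)) _; first by rewrite exprn_ge0 ?absC_ge0.
  rewrite -!mulrA -exprMn exprS [X in _ <= 2 * X](_ : _ = M * ((1 / 5) * (1 / 5) ^+ i)); last by ring.
  rewrite ler_pM2l// ler_wpM2l//.
  have x0 : 0 <= X * absC (eC z) by rewrite mulr_ge0 ?expR_ge0 ?absC_ge0.
  by rewrite ler_pM// ?exprn_ge0// lerXn2r// nnegrE//; lra.
rewrite -mulr_sumr; apply: le_trans (ler_wpM2l _ (geo_sum_le _ _)) _; first by lra.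
  by apply/andP; split; lra.
have -> : (1 - 1 / 5)^-1 = 5 / 4 :> R.
  by apply: (mulfI (x := 1 - 1 / 5)); rewrite ?mulfV//; lra.
by lra.
Qed.

(** A bound valid above height 1/2 spreads over the half-plane by invariance, and is then halved
    above height 1/2 by [cusp_halve]; iterating leaves only 0. *)
Lemma weight0_cusp f : inMj 0 f -> ford 1 f -> forall z, upper z -> f z = 0.
Proof.
move=> [hf [gf inv]] of1.
have per w : upper w -> f (w + 1) = f w.
  by move=> uw; rewrite -mobiusT inv ?expr0z ?mul1r//; exact: SL2_T.
have [b [hb E]] := periodic_qform hf gf per.
have [] := @between R (expR (- (tpi * (1 / 2)))); rewrite ?expR_ge0//.
  by rewrite -expR0 ltr_expR oppr_lt0 mulr_gt0 ?tpi0//; lra.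
move=> r [/andP[r1 r2] r0].
have [M0 [M00 [HM _]]] := ps_bound hb (introT andP (conj r0 r2)).
have red (M : R) : (forall z, 1 / 2 < ImC z -> absC (f z) <= M) -> forall z, upper z -> absC (f z) <= M.
  move=> H z uz; have [g [sg hg]] := reduction uz.
  by have := H _ hg; rewrite inv// expr0z mul1r.
have bd n : forall z, upper z -> absC (f z) <= M0 / 2 ^+ n.
  elim: n => [|n IH]; last first.
    by rewrite exprSr invfM mulrA; apply: red => z hz; exact: cusp_halve.
  rewrite expr0 divr1; apply: red => z hz.
  have uz : upper z by apply: lt_trans hz; lra.
  rewrite E// ofR0 mul0r eC0 mul1r HM//; apply: le_trans (ltW r1).
  by rewrite absC_eC ler_expR lerN2 ler_wpM2l ?(ltW tpi0)// ltW.
move=> z uz; apply/eqP; rewrite -absC_eq0; apply/negPn/negP => f0.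
have f1 : 0 < absC (f z) by rewrite lt_def f0 absC_ge0.
have [n hn] := half_pow_small M0 f1.
by have := bd n z uz; rewrite leNgt hn.
Qed.

End WeightZeroCusp.

Section CuspLimit.
Context {R : realType}.
Implicit Types (f g : CC R -> CC R) (a b : CC R).

(** Convergence to [a] with error O(|q|): [a] is the constant term of the q-expansion. *)
Definition flim f a := ford 1 (fun z => f z - a).

Lemma flim_ext f g a : (forall z, upper z -> f z = g z) -> flim f a -> flim g a.
Proof. by move=> E; apply: ford_ext => z uz; rewrite E. Qed.

Lemma flim_ford0 f a : flim f a -> ford 0 f.
Proof.
move=> h; apply: (@ford_ext _ _ (fun z => (f z - a) + a)); first by move=> z _; rewrite subrK.
by apply: fordD (ford_cst a); apply: ford_le h; exact: ler01.
Qed.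

Lemma flim_cst a : flim (fun _ => a) a.
Proof. by apply: (@ford_ext _ _ (fun _ => 0)); [move=> z _; rewrite subrr|exact: ford0]. Qed.

Lemma flim0 f : ford 1 f <-> flim f 0.
Proof. by split; apply: ford_ext => z _; rewrite subr0. Qed.

Lemma flimD f g a b : flim f a -> flim g b -> flim (fun z => f z + g z) (a + b).
Proof.
by move=> h1 h2; apply: ford_ext (fordD h1 h2) => z _; rewrite opprD addrACA.
Qed.

Lemma flimZ (c : CC R) f a : flim f a -> flim (fun z => c * f z) (c * a).
Proof. by move=> h; apply: ford_ext (fordZ c h) => z _; rewrite mulrBr. Qed.

Lemma flimM f g a b : flim f a -> flim g b -> flim (fun z => f z * g z) (a * b).
Proof.
move=> h1 h2; have h3 := fordM (flim_ford0 h1) h2; rewrite add0r in h3.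
by apply: ford_ext (fordD h3 (fordZ b h1)) => z _; ring.
Qed.

Lemma flimX f a n : flim f a -> flim (fun z => f z ^+ n) (a ^+ n).
Proof.
move=> h; elim: n => [|n IH]; first exact: flim_cst.
by rewrite exprS; apply: flim_ext (flimM h IH) => z _; rewrite exprS.
Qed.

End CuspLimit.

(* Unfolding the infinite product makes failing unification attempts explode. *)
Local Opaque Defs.eta eC.

(** * Modular forms for the full modular group *)

Section ModularForms.
Context {R : realType}.
Implicit Types (f g : CC R -> CC R) (z w : CC R) (j k : int).

Lemma expfzB z j k : z != 0 -> z ^ (j - k) = z ^ j / z ^ k.
Proof. by move=> z0; rewrite expfzDr// invr_expz. Qed.

Lemma inMj_ext j f g : (forall z, upper z -> f z = g z) -> inMj j f -> inMj j g.
Proof.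
move=> E [hf [[N [c [N0 [c0 H]]]] inv]]; split; [|split].
- by move=> z uz; apply: (hd_derivable (hd_upper uz E (derivable_hd (hf z uz)))).
- exists N, c; split => //; split => // x y cy; rewrite -E ?H//.
  by rewrite /upper Im_mk; exact: lt_trans cy.
- by move=> h z sg uz; rewrite -!E ?inv//; exact: mobius_upper.
Qed.

Lemma inMj_per j f z : inMj j f -> upper z -> f (z + 1) = f z.
Proof. move=> [_ [_ inv]] uz; rewrite -mobiusT inv ?jfacT ?exp1rz ?mul1r//; exact: SL2_T. Qed.

Lemma inMj_qform j f : inMj j f -> qform 0 f.
Proof. by move=> h; case: (h) => hf [gf _]; apply: periodic_qform => // z; exact: inMj_per h. Qed.

Lemma inMj_ford0 j f : inMj j f -> ford 0 f.
Proof. by move=> /inMj_qform/qform_ford. Qed.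

Lemma inMj_lim j f : inMj j f -> exists a, flim f a.
Proof. by move=> /inMj_qform/qform_lim. Qed.

Lemma inMj_intro j f : holo f -> ford 0 f -> 
  (forall (h : 'M[int]_2) z, SL2 h -> upper z -> f (mobius h z) = (jfac h z) ^ j * f z) -> inMj j f.
Proof. by move=> h1 /ford_growth h2 h3. Qed.

Lemma inMj0 j : inMj j (fun _ : CC R => 0).
Proof.
apply: inMj_intro; [by move=> z _; exact: (hd_derivable (hd_cst 0 z))|exact: ford0|].
by move=> *; rewrite mulr0.
Qed.

Lemma inMj1 : inMj 0 (fun _ : CC R => 1).
Proof.
apply: inMj_intro; [by move=> z _; exact: (hd_derivable (hd_cst 1 z))|exact: ford_cst|].
by move=> *; rewrite expr0z mulr1.
Qed.

Lemma inMjD j f g : inMj j f -> inMj j g -> inMj j (fun z => f z + g z).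
Proof.
move=> h1 h2; have [hf [_ i1]] := h1; have [hg [_ i2]] := h2; apply: inMj_intro.
- by move=> z uz; apply: (hd_derivable (hdD (derivable_hd (hf z uz)) (derivable_hd (hg z uz)))).
- exact: fordD (inMj_ford0 h1) (inMj_ford0 h2).
- by move=> h z sg uz; rewrite i1// i2// mulrDr.
Qed.

Lemma inMjM j k f g : inMj j f -> inMj k g -> inMj (j + k) (fun z => f z * g z).
Proof.
move=> h1 h2; have [hf [_ i1]] := h1; have [hg [_ i2]] := h2; apply: inMj_intro.
- by move=> z uz; apply: (hd_derivable (hdM (derivable_hd (hf z uz)) (derivable_hd (hg z uz)))).
- by have := fordM (inMj_ford0 h1) (inMj_ford0 h2); rewrite addr0.
- by move=> h z sg uz; rewrite i1// i2// expfzDr ?jfac_neq0//; ring.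
Qed.

Lemma inMjZ j (c : CC R) f : inMj j f -> inMj j (fun z => c * f z).
Proof.
move=> h1; have [hf [_ i1]] := h1; apply: inMj_intro.
- by move=> z uz; apply: (hd_derivable (hdZ c (derivable_hd (hf z uz)))).
- exact: fordZ (inMj_ford0 h1).
- by move=> h z sg uz; rewrite i1//; ring.
Qed.

Lemma inMjB j f g : inMj j f -> inMj j g -> inMj j (fun z => f z - g z).
Proof.
by move=> h1 h2; apply: inMj_ext (inMjD h1 (inMjZ (-1) h2)) => z _; rewrite mulN1r.
Qed.

Lemma inMjX j f n : inMj j f -> inMj (j * n%:Z) (fun z => f z ^+ n).
Proof.
move=> h; elim: n => [|n IH]; first by rewrite mulr0; exact: inMj1.
have := inMjM h IH; rewrite intS mulrDr mulr1; apply: inMj_ext => z _.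
by rewrite exprS.
Qed.

Lemma hd_expz f z (D : CC R) (n : int) : f z != 0 -> hd f z D ->
  hd (fun w => f w ^ n) z (n%:~R * f z ^ (n - 1) * D).
Proof.
move=> f0 h; case: n => [n|n].
  apply: (hd_eq (hdX n h)); case: n => [|n]; first by rewrite !mul0r.
  by have -> : n.+1%:Z - 1 = n%:Z by lia.
have h1 := hdX n.+1 h.
have := @hdV _ (fun w => f w ^+ n.+1) z _ (expf_neq0 n.+1 f0) h1 => h2; apply: (hd_eq h2).
have -> : Negz n - 1 = - n.+2%:Z by lia.
rewrite NegzE -exprnN rmorphN /= -pmulrn !exprS; field; rewrite f0 expf_neq0//.
Qed.

Lemma eta24E z : upper z -> Defs.eta z ^+ 24 = eC z * ps ecoef (eC z) ^+ 24.
Proof.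
move=> uz; rewrite etaE//.
have h := eC_nat (z / 24%:R) 24; rewrite mulrC mulfVK ?pnatr_eq0// in h.
by rewrite h; move: (eC _) (ps _ _) => a b; rewrite exprMn.
Qed.

Lemma eta24 z : upper z -> Defs.eta (z + 1) ^+ 24 = Defs.eta z ^+ 24.
Proof. by move=> uz; rewrite (eta24E (upper_add1 uz)) (eta24E uz) eCD eC1 mulr1. Qed.

Definition Delta z : CC R := Defs.eta z ^+ 24.

Lemma Delta_neq0 z : upper z -> Delta z != 0.
Proof. by move=> uz; rewrite expf_neq0// eta_neq0. Qed.

Lemma Delta_hd z : upper z -> hd Delta z (24%:R * ld z * Delta z).
Proof.
move=> uz; apply: (hd_eq (hdX 24 (eta_hd uz))); rewrite /Delta [_ ^+ 24]exprS /=; ring.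
Qed.

Lemma Delta_ford : ford 1 Delta.
Proof.
have := fordX 24 (qform_ford (@eta_qform R)).
by rewrite mulfV// pnatr_eq0.
Qed.

Lemma Delta_low : exists2 dl : R, 0 < dl & forall z, 1 <= ImC z ->
  dl * expR (- (tpi * ImC z)) <= absC (Delta z).
Proof.
have [dl dl0 H] := @eta_low R; exists (dl ^+ 24); first exact: exprn_gt0.
move=> z z1; rewrite absCX.
have -> : - (tpi * ImC z) = 24%:R * - (tpi * (24%:R^-1 * ImC z)) by field.
rewrite expRM_natl -exprMn lerXn2r ?nnegrE ?absC_ge0 ?H// mulr_ge0 ?expR_ge0//; exact: ltW.
Qed.

Section QuasiModular.
(** The transformation law of E2. Within the section it is an assumption; the Wronskian discharges
    it in [ld_quasimodular]. *)
Hypothesis ldq : forall (g : 'M[int]_2) z, SL2 g -> upper z ->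
  ld (mobius g z) = jfac g z ^+ 2 * ld z + (mc g)%:~R * jfac g z / 2%:R :> CC R.

Lemma upper_i : upper ('i : CC R).
Proof. by rewrite /upper Im_i ltr01. Qed.

(** By [ldq] the quotient of the two sides has derivative 0; its value is found at the fixed point i
    of S, where i^12 = 1. *)
Lemma Delta_S z : upper z -> Delta (mobius Smat z) = jfac Smat z ^+ 12 * Delta z.
Proof.
move=> uz; have sS := SL2_S.
pose h w := Delta (mobius Smat w) / (jfac Smat w ^+ 12 * Delta w).
have den w : upper w -> jfac Smat w ^+ 12 * Delta w != 0.
  by move=> uw; rewrite mulf_neq0 ?Delta_neq0// expf_neq0// jfac_neq0.
have dh w : upper w -> hd h w 0.
  move=> uw; have um := mobius_upper sS uw.
  have h1 := hd_comp (Delta_hd um) (hd_mobius sS uw).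
  have h2 := hdM (hdX 12 (hd_jfac Smat w)) (Delta_hd uw).
  apply: (hd_eq (@hd_div _ _ (fun w => jfac Smat w ^+ 12 * Delta w) _ _ _ (den w uw) h1 h2)).
  rewrite ldq//; have j0 := jfac_neq0 sS uw; have D0 := Delta_neq0 uw.
  by move: j0 D0; move: (jfac Smat w) (Delta w) (Delta _) (ld w) => j D D' l j0 D0; field; rewrite j0 D0.
have := hd0_const dh upper_i uz => E.
have hi : h 'i = 1.
  rewrite /h mobius_S jfac_S.
  have -> : - ('i : CC R)^-1 = 'i by rewrite invCi opprK.
  have -> : ('i : CC R) ^+ 12 = 1 by rewrite (exprM _ 2 6) sqrCi -signr_odd.
  by rewrite mul1r divff//; exact: Delta_neq0 upper_i.
by rewrite hi in E; have := congr1 (fun u => u * (jfac Smat z ^+ 12 * Delta z)) E; rewrite /h mulfVK ?mul1r// den.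
Qed.

Lemma Delta_inMj : inMj 12 Delta.
Proof.
apply: inMj_intro.
- by move=> z uz; exact: hd_derivable (Delta_hd uz).
- by apply: ford_le Delta_ford; exact: ler01.
- move=> g z sg; move: g sg z; apply: SL2_ind.
  + by move=> z uz; rewrite mobius1 jfac1 exp1rz mul1r.
  + by move=> z uz; rewrite Delta_S.
  + by move=> z uz; rewrite mobiusT jfacT exp1rz mul1r /Delta eta24.
  + move=> g h sg sh Pg Ph z uz; have um := mobius_upper sh uz.
    by rewrite (mobiusM sg sh uz) (jfacM sg sh uz) Pg// Ph// expfzMl; ring.
Qed.

(** [Delta] has no zero in the half-plane and at the cusp is bounded below by a multiple of |q|, so
    the quotient stays holomorphic and bounded. *)
Lemma cusp_div_Delta j f : inMj j f -> ford 1 f -> inMj (j - 12) (fun z => f z / Delta z).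
Proof.
move=> [hf [_ inv]] [K [K0 HK]]; have [_ [_ invD]] := Delta_inMj; apply: inMj_intro.
- by move=> z uz; apply: (hd_derivable (hd_div (Delta_neq0 uz) (derivable_hd (hf z uz)) (Delta_hd uz))).
- have [dl dl0 H] := Delta_low; exists (K / dl); split; first by rewrite divr_ge0// ltW.
  move=> z z1; rewrite mul0r mulr0 oppr0 expR0 mulr1 absCM absCV.
  have h1 := HK z z1; have h2 := H z z1; rewrite mul1r in h1.
  have D0 : 0 < absC (Delta z) by apply: lt_le_trans h2; rewrite mulr_gt0 ?expR_gt0.
  rewrite ler_pdivrMr//; apply: le_trans h1 _.
  by rewrite -[leRHS]mulrA ler_wpM2l// [leRHS]mulrC ler_pdivlMr// mulrC.
- move=> g z sg uz; have j0 := jfac_neq0 sg uz; have D0 := Delta_neq0 uz.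
  rewrite inv// invD// expfzB//; move: (expfz_neq0 12 j0).
  by move: (jfac g z ^ 12) (jfac g z ^ j) D0; move: (Delta z) => D u v D0 u0; field; rewrite u0 D0.
Qed.

(** The product of [f ^ 12] and the power -j of [Delta] has weight 0 and vanishes at the cusp. *)
Lemma neg_weight j f : j < 0 -> inMj j f -> forall z, upper z -> f z = 0.
Proof.
case: j => [//|n] _ h; pose N := n.+1.
have h1 := inMjM (inMjX 12 h) (inMjX N Delta_inMj).
have w0 : Negz n * 12%:Z + 12 * N%:Z = 0 by rewrite NegzE /N; ring.
rewrite w0 in h1.
have c1 : ford 1 (fun z => f z ^+ 12 * Delta z ^+ N).
  have := fordM (fordX 12 (inMj_ford0 h)) (fordX N Delta_ford); apply: ford_le.
  by rewrite mulr0 add0r mulr1 ler1n.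
move=> z uz; have /eqP := weight0_cusp h1 c1 uz.
by rewrite mulf_eq0 (negbTE (expf_neq0 N (Delta_neq0 uz))) orbF expf_eq0 => /andP[_ /eqP].
Qed.

Lemma low_weight_cusp j f : j < 12 -> inMj j f -> ford 1 f -> forall z, upper z -> f z = 0.
Proof.
move=> j12 h c z uz; have := neg_weight _ (cusp_div_Delta h c) uz.
rewrite subr_lt0 => /(_ j12) /eqP; rewrite mulf_eq0 invr_eq0 (negbTE (Delta_neq0 uz)) orbF.
by move/eqP.
Qed.

(** This is [tpii] times D_k. The correction term cancels what the derivative of the automorphy
    factor contributes. *)
Definition serre k f z : CC R := cderiv f z - 2%:R * k%:~R * ld z * f z.

Lemma ld_flim : flim (@ld R) (tpii / 24%:R).
Proof. exact: ld_lim. Qed.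

Lemma ld_qform : qform 0 (@ld R).
Proof.
apply: periodic_qform; [exact: ld_holo|exact: (ford_growth (flim_ford0 ld_flim))|exact: ld_per].
Qed.

Lemma serre_flim k f a : qform 0 f -> flim f a -> flim (serre k f) (- (2%:R * k%:~R * (tpii / 24%:R) * a)).
Proof.
move=> qf lf; have l1 := qform_deriv_cusp qf.
have := flimD (proj1 (flim0 _) l1) (flimZ (-1) (flimM (flimZ (2%:R * k%:~R) ld_flim) lf)).
by rewrite add0r mulN1r; apply: flim_ext => z _; rewrite mulN1r.
Qed.

Lemma serre_inMj k f : inMj k f -> inMj (k + 2) (serre k f).
Proof.
move=> h; have [hf [_ inv]] := h; have qf := inMj_qform h.
have hd' := qform_holo (qform_deriv qf); apply: inMj_intro.
- move=> z uz; apply: (hd_derivable (hdB (derivable_hd (hd' z uz))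
   (hdM (hdZ _ (derivable_hd (ld_holo uz))) (derivable_hd (hf z uz))))).
- have [a la] := qform_lim qf; exact: flim_ford0 (serre_flim k qf la).
- move=> g z sg uz; have um := mobius_upper sg uz; have j0 := jfac_neq0 sg uz.
  have d1 := hd_comp (derivable_hd (hf _ um)) (hd_mobius sg uz).
  have d2 := hdM (hd_expz k j0 (hd_jfac g z)) (derivable_hd (hf z uz)).
  have {}d2 := hd_upper uz (fun w uw => esym (inv g w sg uw)) d2.
  have := hd_unique d1 d2; rewrite /serre inv// ldq// expfzB// (expfzDr k 2 j0) expr1z.
  have -> : jfac g z ^ 2 = jfac g z ^+ 2 by [].
  move: (jfac g z ^ k) (cderiv f z) (cderiv f _) (f z) (ld z) j0 => a f1 f1' f0 l.
  move: (jfac g z) => u u0 E.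
  have -> : f1' = u ^+ 2 * (f1' / u ^+ 2) by field.
  by rewrite E; field.
Qed.

(** Ramanujan's formula for the derivative of E2 makes this a multiple of E4. The coefficient is
    that of the Serre derivative in weight 1, not 2: quasimodularity contributes twice through the
    square. *)
Definition e4 z : CC R := cderiv ld z - 2%:R * ld z ^+ 2.

Lemma e4_inMj : inMj 4 e4.
Proof.
have hd' := qform_holo (qform_deriv ld_qform); apply: inMj_intro.
- move=> z uz; apply: (hd_derivable (hdB (derivable_hd (hd' z uz))
   (hdZ _ (hdX 2 (derivable_hd (ld_holo uz)))))).
- apply: fordB; first exact: qform_ford (qform_deriv ld_qform).
  by apply: fordZ; have := fordX 2 (flim_ford0 ld_flim); rewrite mulr0.
- move=> g z sg uz; have um := mobius_upper sg uz; have j0 := jfac_neq0 sg uz.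
  have d1 := hd_comp (derivable_hd (ld_holo um)) (hd_mobius sg uz).
  have d2 := hdD (hdM (hdX 2 (hd_jfac g z)) (derivable_hd (ld_holo uz)))
    (hdM (hdZ (mc g)%:~R (hd_jfac g z)) (hd_cst (2%:R^-1) z)).
  have {}d2 := hd_upper uz (fun w uw => esym (ldq sg uw)) d2.
  have := hd_unique d1 d2; rewrite /e4 ldq//.
  have -> : jfac g z ^ (4 : int) = jfac g z ^+ 4 by [].
  move: (cderiv ld z) (cderiv ld _) (ld z) j0 => l1 l1' l.
  move: (jfac g z) => u u0 E.
  have -> : l1' = u ^+ 2 * (l1' / u ^+ 2) by field.
  by rewrite E /=; field.
Qed.

Lemma e4_flim : flim e4 (- (2%:R * (tpii / 24%:R) ^+ 2)).
Proof.
have l1 := qform_deriv_cusp ld_qform.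
have := flimD (proj1 (flim0 _) l1) (flimZ (- 2%:R) (flimX 2 ld_flim)).
by rewrite add0r mulNr; apply: flim_ext => z _; rewrite mulNr.
Qed.

Lemma E4_ex : exists2 f : CC R -> CC R, inMj 4 f & flim f 1.
Proof.
set c : CC R := - (2%:R * (tpii / 24%:R) ^+ 2).
have c0 : c != 0 by rewrite oppr_eq0 mulf_neq0 ?pnatr_eq0// expf_neq0// mulf_neq0 ?tpii0// invr_eq0 pnatr_eq0.
exists (fun z => c^-1 * e4 z); first exact: inMjZ e4_inMj.
by rewrite -[1](mulVf c0); exact: flimZ e4_flim.
Qed.

Lemma E6_ex : exists2 f : CC R -> CC R, inMj 6 f & flim f 1.
Proof.
have [f hf lf] := E4_ex; have h := serre_inMj hf.
set c : CC R := - (2%:R * (4 : int)%:~R * (tpii / 24%:R) * 1).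
have lc : flim (serre 4 f) c := serre_flim 4 (inMj_qform hf) lf.
have c0 : c != 0.
  rewrite /c; move: (@tpii0 R); move: tpii => t t0.
  by rewrite oppr_eq0 mulr1 !mulf_neq0// ?invr_eq0 ?pnatr_eq0 ?intr_eq0.
exists (fun z => c^-1 * serre 4 f z); first exact: inMjZ h.
by have := flimZ c^-1 lc; rewrite mulVf.
Qed.

(* If [f] has constant term [a <> 0], the Serre derivative of [f] and [f^2] are proportional, both
   being in [M_4]; so [f] solves a first order equation, and [f(i) = i^2 f(i) = 0]. *)
Lemma weight2 f : inMj 2 f -> forall z, upper z -> f z = 0.
Proof.
move=> h; have [a la] := inMj_lim h; have [a0|a0] := eqVneq a 0.
  by apply: (low_weight_cusp _ h) => //; apply: (proj2 (flim0 _)); rewrite -a0.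
have h4 := serre_inMj h; have l4 := serre_flim 2 (inMj_qform h) la.
set b := - _ in l4; pose c : CC R := b / a ^+ 2.
have hh := inMjB h4 (inMjZ c (inMjX 2 h)).
have lh : ford 1 (fun z => serre 2 f z - c * f z ^+ 2).
  have := flimD l4 (flimZ (- c) (flimX 2 la)); rewrite mulNr /c mulfVK ?expf_neq0// subrr.
  by move/(proj2 (flim0 _)); apply: ford_ext => z _; rewrite mulNr.
have ode z (uz : upper z) : cderiv f z = (4%:R * ld z + c * f z) * f z.
  have := low_weight_cusp _ hh lh uz => /(_ isT)/eqP; rewrite subr_eq0 /serre => /eqP E.
  have -> : cderiv f z = c * f z ^+ 2 + 2%:R * (2 : int)%:~R * ld z * f z by rewrite -E subrK.
  by ring.
have fi : f 'i = 0.
  have [_ [_ inv]] := h; have := inv _ _ SL2_S upper_i.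
  rewrite mobius_S invCi opprK jfac_S.
  have -> : ('i : CC R) ^ (2 : int) = -1 by exact: sqrCi.
  rewrite mulN1r => /eqP; rewrite -addr_eq0 -mulr2n -mulr_natl mulf_eq0 pnatr_eq0 /=.
  by move/eqP.
have [hf _] := h; move=> z uz.
have := @linear_ode_zero R 1 (fun _ => f) (fun _ _ w => 4%:R * ld w + c * f w) 'i z _ _ upper_i uz (fun _ => fi) ord0.
apply.
- by move=> _ _ w uw; apply: (hd_derivable (hdD (hdZ _ (derivable_hd (ld_holo uw))) (hdZ _ (derivable_hd (hf w uw))))).
- by move=> _ w uw; rewrite big_ord_recl big_ord0 addr0 -ode//; exact: derivable_hd (hf w uw).
Qed.

Definition Mdim j d := exists B : 'I_d -> CC R -> CC R, 
  [/\ forall i, inMj j (B i),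
      (forall a : 'I_d -> CC R, (forall z, upper z -> \sum_i a i * B i z = 0) -> forall i, a i = 0) &
      forall f, inMj j f -> exists a : 'I_d -> CC R, forall z, upper z -> f z = \sum_i a i * B i z].

Lemma Mdim0 j : (forall f, inMj j f -> forall z, upper z -> f z = 0) -> Mdim j 0.
Proof.
move=> H; exists (fun i _ => 0); split => [[]|a _ []|f hf]//.
by exists (fun _ => 0) => z uz; rewrite big_ord0 H.
Qed.

(** The space of weight j + 12 is the line of [E] plus [Delta] times the space of weight j:
    subtracting the constant term leaves a cusp form, divisible by [Delta]. *)
Lemma MdimS j d (E : CC R -> CC R) : Mdim j d -> inMj (j + 12) E -> flim E 1 -> Mdim (j + 12) d.+1.
Proof.
move=> [B [hB indep span]] hE lE.
have hDB i : inMj (j + 12) (fun z => Delta z * B i z) by rewrite addrC; exact: inMjM Delta_inMj (hB i).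
have cDB i : ford 1 (fun z => Delta z * B i z).
  by have := fordM Delta_ford (inMj_ford0 (hB i)); rewrite addr0.
exists (fun i => if unlift ord0 i is Some i' then fun z => Delta z * B i' z else E); split.
- by move=> i; case: (unlift _ _).
- move=> a H.
  have H' z : upper z -> a ord0 * E z + Delta z * \sum_i a (lift ord0 i) * B i z = 0.
    move=> uz; rewrite -[RHS](H z uz) big_ord_recl unlift_none mulr_sumr; congr (_ + _).
    by apply: eq_bigr => i _; rewrite liftK mulrCA.
  have a0 : a ord0 = 0.
    have l : flim (fun z => a ord0 * E z + \sum_i a (lift ord0 i) * (Delta z * B i z)) (a ord0 * 1 + 0).
      by apply: flimD; [exact: flimZ lE|apply: (proj1 (flim0 _)); apply: ford_sum => i; exact: fordZ (cDB i)].
    have {}l : flim (fun _ => 0) (a ord0).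
      rewrite mulr1 addr0 in l; apply: flim_ext l => z uz; rewrite -[RHS](H' z uz) mulr_sumr.
      by congr (_ + _); apply: eq_bigr => i _; rewrite mulrCA.
    (* A constant function that is O(|q|) is a cusp form of weight 0, so it vanishes. *)
    have := @weight0_cusp R (fun _ => - a ord0); move=> /(_ _ _ 'i upper_i).
    move=> W; apply/eqP; rewrite -oppr_eq0; apply/eqP; apply: W.
      by apply: inMj_ext (inMjZ (- a ord0) inMj1) => z _; rewrite mulr1.
    by apply: ford_ext l => z _; rewrite sub0r.
  move=> i; case: (unliftP ord0 i) => [i' ->|-> //].
  apply: (indep (fun i => a (lift ord0 i))) => z uz; have /eqP := H' z uz.
  by rewrite a0 mul0r add0r mulf_eq0 (negbTE (Delta_neq0 uz)) => /eqP.
- move=> f hf; have [b lb] := inMj_lim hf.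
  have hg := inMjB hf (inMjZ b hE).
  have cg : ford 1 (fun z => f z - b * E z).
    have := flimD lb (flimZ (- b) lE); rewrite mulr1 subrr => /(proj2 (flim0 _)).
    by apply: ford_ext => z _; rewrite mulNr.
  have hq := cusp_div_Delta hg cg; rewrite addrK in hq.
  have [a Ha] := span _ hq.
  exists (fun i => if unlift ord0 i is Some i' then a i' else b) => z uz.
  rewrite big_ord_recl unlift_none.
  have -> : f z = b * E z + Delta z * ((f z - b * E z) / Delta z).
    by rewrite mulrCA divff ?Delta_neq0// mulr1 addrC subrK.
  rewrite Ha// mulr_sumr; congr (_ + _); apply: eq_bigr => i _.
  by rewrite liftK mulrCA.
Qed.

(** Every even weight at least 0 other than 2 has the form 4a or 4a + 6, realized by a power of E4,
    possibly times E6. *)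
Lemma weight_even_unit (n : nat) : n != 1%N -> exists2 f : CC R -> CC R, inMj (2 * n%:Z) f & flim f 1.
Proof.
move=> n1; have [f4 h4 l4] := E4_ex; have [f6 h6 l6] := E6_ex.
have f4n a : flim (fun z => f4 z ^+ a) 1 by rewrite -(expr1n _ a); exact: flimX.
have e := odd_double_half n; case on : (odd n) in e.
  case: n n1 on e => [//|[//|[//|n]]] _ _ e.
  exists (fun z => f4 z ^+ n./2 * f6 z); last by rewrite -[1]mulr1; exact: flimM.
  have -> : 2 * n.+3%:Z = 4 * (n./2)%:Z + 6.
    by rewrite -e /= -muln2 /= !PoszD PoszM; lia.
  exact: inMjM (inMjX _ h4) h6.
exists (fun z => f4 z ^+ n./2) => //.
have -> : 2 * n%:Z = 4 * (n./2)%:Z by rewrite -{1}e add0n -muln2 PoszM; lia.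
exact: inMjX.
Qed.

(* [dim M_(2p-12)]: the shift makes all weights in use nonnegative. *)
Definition mdim (p : nat) : nat := (if p %% 6 == 1 then (p %/ 6).-1 else p %/ 6)%N.

(** Induction in steps of 12 in the weight. Negative weights and weight 2 are the base; in all other
    cases a form of weight 2p - 12 with constant term 1 exists. *)
Lemma Mdim_even p : Mdim (2 * p%:Z - 12) (mdim p).
Proof.
elim/ltn_ind: p => p IH; have [p6|p6] := ltnP p 6.
  have -> : mdim p = 0%N by rewrite /mdim divn_small//; case: ifP.
  by apply: Mdim0 => f; apply: neg_weight; lia.
have [p7|p7] := eqVneq p 7.
  by rewrite p7; apply: Mdim0 => f; exact: weight2.
have -> : mdim p = (mdim (p - 6)).+1 by rewrite /mdim; do 2?case: ifP; lia.
have [E hE lE] : exists2 f : CC R -> CC R, inMj (2 * (p - 6)%N%:Z) f & flim f 1 by apply: weight_even_unit; lia.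
have w : 2 * p%:Z - 12 = 2 * (p - 6)%N%:Z - 12 + 12 by lia.
by rewrite w; apply: MdimS lE; [apply: IH; lia|rewrite subrK].
Qed.

End QuasiModular.
End ModularForms.

(** * The matrix of T *)

Section TMatrix.
Context {R : realType}.
Implicit Types (A P U : 'M[CC R]_3).

Lemma char_poly_conj (K : fieldType) n (A Q : 'M[K]_n) : Q \in unitmx ->
  char_poly (invmx Q *m A *m Q) = char_poly A.
Proof.
move=> uQ; rewrite /char_poly.
have -> : char_poly_mx (invmx Q *m A *m Q) =
  map_mx polyC (invmx Q) *m char_poly_mx A *m map_mx polyC Q.
  rewrite /char_poly_mx !map_mxM mulmxBr mulmxBl; congr (_ - _).
  by rewrite mul_mx_scalar -scalemxAl -map_mxM mulVmx// map_mx1 scalemx1.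
by rewrite !det_mulmx mulrAC -det_mulmx -map_mxM mulVmx// map_mx1 det1 mul1r.
Qed.

Lemma conj_conj (K : fieldType) n (P Q D : 'M[K]_n) : P \in unitmx -> Q \in unitmx ->
  invmx P *m (invmx Q *m D *m Q) *m P = invmx (Q *m P) *m D *m (Q *m P).
Proof.
move=> uP uQ; have uQP : Q *m P \in unitmx by rewrite unitmx_mul uQ.
by rewrite -[RHS]mulmxA; apply: (canRL (mulKmx uQP)); rewrite !mulmxA mulmxK// mulmxV// mul1mx.
Qed.

Lemma conj_mul (K : fieldType) n (Q D : 'M[K]_n) : Q \in unitmx ->
  Q *m (invmx Q *m D *m Q) = D *m Q.
Proof. by move=> uQ; rewrite !mulmxA mulmxV// mul1mx. Qed.

Lemma unitary_diag U : U *m (map_mx Num.conj U)^T = 1%:M ->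
  exists (Q : 'M[CC R]_3) (d : 'rV_3), Q \in unitmx /\ U = invmx Q *m diag_mx d *m Q.
Proof.
move=> h; have uU : U \is unitarymx.
  by apply/unitarymxP; rewrite -h map_trmx.
have nU : U \is normalmx.
  rewrite qualifE /=; have h1 := unitarymxP uU; rewrite h1.
  by rewrite (mulmx1C h1).
exists (spectralmx U), (spectral_diag U); split; first exact: spectral_unit.
exact: (orthomx_spectralP nU).
Qed.

(** The [r i] are known only as the roots of the characteristic polynomial, whereas the spectral
    theorem delivers the eigenvalues in an order of its own: hence the permutation. *)
Lemma T_diag (rho : 'M[int]_2 -> 'M[CC R]_3) (r : 'I_3 -> R) :
  T_unitarizable rho -> char_poly (rho Tmat) = \prod_(j < 3) ('X - (ee (r j))%:P) ->
  exists (Q : 'M[CC R]_3) (s : {perm 'I_3}), Q \in unitmx /\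
    Q *m rho Tmat = diag_mx (\row_i ee (r (s i))) *m Q.
Proof.
move=> [P [U [uP [hU E]]]] cp; have [Q [d [uQ dU]]] := unitary_diag hU.
have uQP : Q *m P \in unitmx by rewrite unitmx_mul uQ.
rewrite dU conj_conj// in E.
move: cp; rewrite E char_poly_conj// char_poly_trig ?diag_mx_is_trig// => cp.
have cp' : \prod_(x <- [tuple d ord0 i | i < 3]) ('X - x%:P) =
   \prod_(x <- [tuple ee (r i) | i < 3]) ('X - x%:P).
  by rewrite !big_tuple; under eq_bigr do rewrite tnth_mktuple; under [RHS]eq_bigr do rewrite tnth_mktuple;
    rewrite -cp; apply: eq_bigr => i _; rewrite mxE eqxx.
have /tuple_permP[s hs] := prod_XsubC_eq cp'.
exists (Q *m P), s; split; first by [].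
rewrite conj_mul//.
have -> : d = \row_i ee (r (s i)) by
  apply/rowP => i; rewrite mxE; have := congr1 (fun t => nth 0 t i) hs;
  cbv beta; rewrite -!tnth_nth !tnth_mktuple.
by [].
Qed.

(* If all eigenvalues coincide then [rho T] is scalar, so an eigenvector of [rho S] spans an
   invariant line because [S] and [T] generate. *)
Lemma irreducible_not_scalar (rho : 'M[int]_2 -> 'M[CC R]_3) (a : CC R) :
  is_rep rho -> rep_irreducible rho -> rho Tmat <> a%:M.
Proof.
move=> [mulr unit] irr sT.
have [b /eigenvalueP[v vb v0]] := eigenvalue_closed (rho Smat)^T (isT : (0 < 3)%N).
pose W : 'M[CC R]_3 := <<v>>%MS.
have inv g : SL2 g -> (v *m (rho g)^T <= v)%MS.
  move: g; apply: SL2_ind.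
  - have r1 : rho 1%:M = 1%:M.
      have s1 : SL2 1%:M by rewrite /SL2 det1.
      have := mulr _ _ s1 s1; rewrite mul1mx => h; have u := unit _ s1.
      by have := congr1 (mulmx (invmx (rho 1%:M))) h; rewrite mulVmx// mulmxA mulVmx// mul1mx.
    by rewrite r1 trmx1 mulmx1.
  - by rewrite vb scalemx_sub.
  - by rewrite sT tr_scalar_mx mul_mx_scalar scalemx_sub.
  - move=> g h sg sh ig ih; rewrite mulr// trmx_mul (mulmxA v).
    by apply: submx_trans (submxMr _ ih) ig.
have Winv : rep_invariant rho W.
  by move=> g sg; rewrite /W !genmxE; apply: submx_trans (inv g sg); apply: submxMr; rewrite genmxE.
have := irr W Winv; rewrite /W => -[/eqmxP e|/eqmxP e].
  have : (v <= (0 : 'M[CC R]_3))%MS by rewrite -e genmxE.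
  by rewrite submx0 (negbTE v0).
by have := rank_leq_row v; rewrite -mxrank_gen e mxrank1.
Qed.

Lemma fracR_bound (x : R) : 0 <= fracR x < 1.
Proof.
have /andP[h1 h2] := floor_itv x; rewrite intrD in h2.
by rewrite /fracR subr_ge0 h1 ltrBlDl.
Qed.

Lemma ee_fracR (x : R) : ee (fracR x) = ee x :> CC R.
Proof. by rewrite /fracR eeD -rmorphN ee_int mulr1. Qed.

(** If the sum vanished, every [r j + t] would be an integer, all eigenvalues would be e(-t), and
    the diagonalizable matrix [rho Tmat] would be scalar. *)
Lemma lam0_gt0 (rho : 'M[int]_2 -> 'M[CC R]_3) (r : 'I_3 -> R) (t : R) :
  is_rep rho -> rep_irreducible rho -> T_unitarizable rho ->
  char_poly (rho Tmat) = \prod_(j < 3) ('X - (ee (r j))%:P) ->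
  0 < \sum_(j < 3) fracR (r j + t).
Proof.
move=> hr irr uni cp; rewrite lt_def sumr_ge0 => [|i _]; last by case/andP: (fracR_bound (r i + t)).
rewrite andbT; apply/negP => /eqP s0.
have f0 j : fracR (r j + t) = 0.
  have := psumr_eq0P _ s0 => -> // i _; by case/andP: (fracR_bound (r i + t)).
have [Q [s [uQ E]]] := T_diag uni cp.
apply: (irreducible_not_scalar (a := ee (- t)) hr irr).
have e j : ee (r j) = ee (- t) :> CC R.
  have := ee_fracR (r j + t); rewrite f0 ee0 eeD => h; rewrite eeN.
  by apply: (mulIf (ee_neq0 t)); rewrite -h mulVf// ee_neq0.
have : diag_mx (\row_i ee (r (s i))) = (ee (- t))%:M :> 'M[CC R]_3.
  by apply/matrixP => i j; rewrite !mxE e.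
move=> D; rewrite D mul_scalar_mx in E.
have := congr1 (mulmx (invmx Q)) E; rewrite mulmxA mulVmx// mul1mx => ->.
by rewrite -scalemxAr mulVmx// scalemx1.
Qed.

End TMatrix.

(** * Vector-valued forms and the Wronskian *)

Section Growth.
Context {R : realType}.
Implicit Types (f g : CC R -> CC R).

Lemma growthP f : mod_growth f <-> exists N c : R, [/\ 0 < N, 0 < c &
  forall x y, c < y -> absC (f (mkC x y)) <= powR y N].
Proof.
split=> [[N [c [N0 [c0 H]]]]|[N [c [N0 c0 H]]]]; exists N, c.
  by split => // x y cy; rewrite -lecE' -normCE; exact: H.
by split => //; split => // x y cy; rewrite normCE lecE'; exact: H.
Qed.

Lemma growthD f g : mod_growth f -> mod_growth g -> mod_growth (fun z => f z + g z).
Proof.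
move=> /growthP[N [c [N0 c0 H]]] /growthP[N' [c' [N0' c0' H']]]; apply/growthP.
(* The extra exponent 1, together with [2 <= y], pays for the sum of two terms. *)
exists (N + N' + 1), (c + c' + 2); split; [lra|lra|move=> x y hy].
have y2 : 2 <= y by lra.
have y1 : 1 <= y by lra.
have h1 : powR y N <= powR y (N + N') by apply: ler_powR => //; lra.
have h2 : powR y N' <= powR y (N + N') by apply: ler_powR => //; lra.
have P0 := powR_ge0 y (N + N').
rewrite powRD; last by apply/implyP => _; rewrite gt_eqF//; lra.
rewrite powRr1; last by lra.
apply: le_trans (absCD _ _) _; have := H x y ltac:(lra); have := H' x y ltac:(lra); nra.
Qed.

Lemma growthZ (a : CC R) f : mod_growth f -> mod_growth (fun z => a * f z).
Proof.
move=> /growthP[N [c [N0 c0 H]]]; apply/growthP; have a0 := absC_ge0 a.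
exists (N + 1), (c + absC a); split; [lra|lra|move=> x y hy].
rewrite powRD; last by apply/implyP => _; rewrite gt_eqF//; lra.
rewrite powRr1; last by lra.
have P0 := powR_ge0 y N.
by rewrite absCM mulrC ler_pM ?absC_ge0 ?H//; lra.
Qed.

End Growth.

Section Det3Analysis.
Context {R : realType}.
Implicit Types (U V X : CC R -> 'cV[CC R]_3) (u v x : 'cV[CC R]_3).

Definition dV U z : 'cV[CC R]_3 := \col_i cderiv (Defs.comp U i) z.

Lemma comp_dV U i : Defs.comp (dV U) i = cderiv (Defs.comp U i).
Proof. by apply/funext => z; rewrite /Defs.comp mxE. Qed.

Lemma hd_det3 U V X u v x z :
  (forall i, hd (Defs.comp U i) z (u i ord0)) -> (forall i, hd (Defs.comp V i) z (v i ord0)) ->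
  (forall i, hd (Defs.comp X i) z (x i ord0)) ->
  hd (fun w => det3 (U w) (V w) (X w)) z
    (det3 u (V z) (X z) + det3 (U z) v (X z) + det3 (U z) (V z) x).
Proof.
move=> hu hv hx.
have h i j k : hd (fun w => Defs.comp U i w * (Defs.comp V j w * Defs.comp X k w - Defs.comp V k w * Defs.comp X j w)) z
  (u i ord0 * (Defs.comp V j z * Defs.comp X k z - Defs.comp V k z * Defs.comp X j z) +
   Defs.comp U i z * ((v j ord0 * Defs.comp X k z + Defs.comp V j z * x k ord0) -
                 (v k ord0 * Defs.comp X j z + Defs.comp V k z * x j ord0))).
  exact: hdM (hu i) (hdB (hdM (hv j) (hx k)) (hdM (hv k) (hx j))).
apply: (hd_eq (hdD (hdB (h o0 o1 o2) (h o1 o0 o2)) (h o2 o0 o1))).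
by rewrite /det3 /Defs.comp; ring.
Qed.

Lemma det3Z (K : fieldType) (u v x : 'cV[K]_3) (a b c : K) :
  det3 (a *: u) (b *: v) (c *: x) = a * b * c * det3 u v x.
Proof. by rewrite /det3 !mxE; ring. Qed.

End Det3Analysis.

Section VectorForms.
Context {R : realType}.
Variables (rho : 'M[int]_2 -> 'M[CC R]_3) (ups : 'M[int]_2 -> CC R).
Variables (Q : 'M[CC R]_3) (a lamq : 'I_3 -> R).
Hypothesis ups1 : forall g, SL2 g -> `|ups g| = 1.
Hypothesis uQ : Q \in unitmx.
Hypothesis QT : Q *m rho Tmat = diag_mx (\row_i ee (a i)) *m Q.
Hypothesis lamq01 : forall i, 0 <= lamq i < 1.
Hypothesis lamqE : forall i, ups Tmat * ee (a i) = ee (lamq i).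
Implicit Types (F U V X : CC R -> 'cV[CC R]_3) (z w : CC R) (g : 'M[int]_2) (k s : R).

Lemma ups_neq0 g : SL2 g -> ups g != 0.
Proof. by move=> sg; rewrite -normr_eq0 ups1// oner_eq0. Qed.

Lemma inHkP k F : inHk k rho ups F <-> (forall i, holo (Defs.comp F i) /\ mod_growth (Defs.comp F i)) /\
  (forall g z, SL2 g -> upper z -> F (mobius g z) = (ups g * cpow (jfac g z) k) *: (rho g *m F z)).
Proof.
rewrite /inHk; split=> -[h1 h2]; split => // g z sg uz; have u0 := ups_neq0 sg;
  have c0 := cpow_neq0 k (jfac_neq0 sg uz); have := h2 g z sg uz;
  rewrite cpowN ?jfac_neq0//; move: (rho g *m F z) => A.
  by move=> <-; rewrite scalerA -invfM mulfV ?scale1r// mulf_neq0.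
by move=> ->; rewrite scalerA -invfM mulVf ?scale1r// mulf_neq0.
Qed.

(** Coordinates in an eigenbasis of [rho Tmat]. Unlike membership in [inHk], this property survives
    plain differentiation, which makes F' and F'' accessible. *)
Definition qvec F := forall i, qform (lamq i) (fun z => (Q *m F z) i ord0).

Lemma QcompE F i z : (Q *m F z) i ord0 = \sum_(j < 3) Q i j * Defs.comp F j z.
Proof. by rewrite mxE. Qed.

Lemma compQE F i z : Defs.comp F i z = \sum_(j < 3) invmx Q i j * (Q *m F z) j ord0.
Proof. by rewrite /Defs.comp -{1}[F z](mulKmx uQ) [LHS]mxE. Qed.

Lemma inHk_qvec k F : inHk k rho ups F -> qvec F.
Proof.
move=> /inHkP[h1 h2] i; apply: qexp (lamq01 i) _.
- move=> z uz; rewrite (_ : (fun z => _) = fun z => \sum_(j < 3) Q i j * Defs.comp F j z); last first.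
    by apply/funext => w; rewrite QcompE.
  have [hf _] : (forall j, holo (Defs.comp F j)) /\ True by split => // j; case: (h1 j).
  exact: (hd_derivable (hd_sum (fun j => hdZ (Q i j) (derivable_hd (hf j z uz))))).
- rewrite (_ : (fun z => _) = fun z => Q i o0 * Defs.comp F o0 z + (Q i o1 * Defs.comp F o1 z + Q i o2 * Defs.comp F o2 z)).
    have gF j : mod_growth (Defs.comp F j) by case: (h1 j).
    exact: growthD (growthZ _ (gF o0)) (growthD (growthZ _ (gF o1)) (growthZ _ (gF o2))).
  by apply/funext => w; rewrite QcompE sum3.
- move=> z uz; rewrite -mobiusT (h2 _ _ SL2_T uz) jfacT cpow1s mulr1.
  rewrite -scalemxAr mulmxA QT -mulmxA mxE mul_diag_mx !mxE -lamqE; ring.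
Qed.

Lemma qvec_holo F i : qvec F -> holo (Defs.comp F i).
Proof.
move=> h z uz; rewrite (_ : Defs.comp F i = fun z => \sum_(j < 3) invmx Q i j * (Q *m F z) j ord0).
  apply: (hd_derivable (hd_sum (fun j => hdZ (invmx Q i j) (derivable_hd (qform_holo (h j) uz))))).
by apply/funext => w; rewrite compQE.
Qed.

Lemma qvec_hd F i z : qvec F -> upper z -> hd (Defs.comp F i) z (dV F z i ord0).
Proof. by move=> h uz; rewrite mxE; apply: derivable_hd (qvec_holo h uz). Qed.

Lemma qvec_dV F : qvec F -> qvec (dV F).
Proof.
move=> h i; apply: qform_ext (qform_deriv (h i)) => z uz.
have h1 := hd_sum (fun j => hdZ (Q i j) (qvec_hd j h uz)).
rewrite (_ : (fun w => _) = fun w => (Q *m F w) i ord0) in h1; last by apply/funext => w; rewrite QcompE.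
by rewrite (hd_val h1) QcompE.
Qed.

Lemma qvec_ford0 F i : qvec F -> ford 0 (Defs.comp F i).
Proof.
move=> h; apply: (@ford_ext _ _ (fun z => \sum_(j < 3) invmx Q i j * (Q *m F z) j ord0)).
  by move=> z _; rewrite compQE.
apply: ford_sum => j; apply: fordZ; apply: ford_le (qform_ford (h j)).
by case/andP: (lamq01 j).
Qed.

(** In the eigenbasis each of the six products of the determinant takes one entry from every row, so
    its exponents add up to the full sum; undoing the base change costs only the constant
    [det3M Q]. *)
Lemma qvec_det3 U V X : qvec U -> qvec V -> qvec X ->
  ford (\sum_i lamq i) (fun z => det3 (U z) (V z) (X z)).
Proof.
move=> hU hV hX; have d0 := det3M_neq0 uQ.
have t (i j l : 'I_3) (Y Y' Y'' : CC R -> 'cV[CC R]_3) :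
  lamq i + (lamq j + lamq l) = lamq o0 + (lamq o1 + lamq o2) ->
  qvec Y -> qvec Y' -> qvec Y'' ->
  ford (\sum_i lamq i) (fun z => (Q *m Y z) i ord0 * ((Q *m Y' z) j ord0 * (Q *m Y'' z) l ord0)).
  by rewrite sum3 => <- h h' h''; exact: fordM (qform_ford (h i)) (fordM (qform_ford (h' j)) (qform_ford (h'' l))).
have t1 := t o0 o1 o2 _ _ _ ltac:(ring) hU hV hX; have t2 := t o0 o2 o1 _ _ _ ltac:(ring) hU hV hX.
have t3 := t o1 o0 o2 _ _ _ ltac:(ring) hU hV hX; have t4 := t o1 o2 o0 _ _ _ ltac:(ring) hU hV hX.
have t5 := t o2 o0 o1 _ _ _ ltac:(ring) hU hV hX; have t6 := t o2 o1 o0 _ _ _ ltac:(ring) hU hV hX.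
have := fordD (fordB (fordB t1 t2) (fordB t3 t4)) (fordB t5 t6).
move=> /(fordZ (det3M Q)^-1); apply: ford_ext => z uz.
rewrite [X in _ * X](_ : _ = det3M Q * det3 (U z) (V z) (X z)); first by rewrite mulKf.
by rewrite -det3_mul /det3; ring.
Qed.

End VectorForms.

(** * The MLDE in terms of plain derivatives *)

Section ThirdOrder.
Context {R : realType}.
Implicit Types (f : CC R -> CC R) (z w : CC R) (k : R).

Lemma DkE k f z : Dk k f z = tpii^-1 * (cderiv f z - 2%:R * ofR k * ld z * f z).
Proof.
rewrite /Dk PfunE mulrBr; congr (_ + _).
have h : ('i / ofR pi : CC R) = - 2%:R * tpii^-1.
  have i0 : ('i : CC R) != 0 by exact: neq0Ci.
  have p0 : ofR (pi : R) != 0 by rewrite ofR_eq0 gt_eqF ?pi0.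
  have e : ('i : CC R) = - 'i^-1 by rewrite invCi opprK.
  by rewrite /tpii ofRM ofRn {1}e; move: (ofR pi) p0 ('i : CC R) i0 => p p0 i i0; field; rewrite p0 i0.
by rewrite h; ring.
Qed.

(** The coefficients arise by expanding [tpii ^+ 3] times the MLDE and solving for f'''. Here [a],
    [b], [c] are twice the successive weights k, k + 2, k + 4 at which D acts. *)
Definition mlde_coef0 k (M4 M6 : CC R -> CC R) z : CC R :=
  let a := 2%:R * ofR k in let b := 2%:R * (ofR k + 2%:R) in let c := 2%:R * (ofR k + 4%:R) in
  a * cderiv (cderiv ld) z - (2%:R * a * b + a * c) * ld z * cderiv ld z + a * b * c * ld z ^+ 3
  + tpii ^+ 2 * a * M4 z * ld z - tpii ^+ 3 * M6 z.

Definition mlde_coef1 k (M4 : CC R -> CC R) z : CC R :=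
  let a := 2%:R * ofR k in let b := 2%:R * (ofR k + 2%:R) in let c := 2%:R * (ofR k + 4%:R) in
  (2%:R * a + b) * cderiv ld z - (a * b + a * c + b * c) * ld z ^+ 2 - tpii ^+ 2 * M4 z.

(** The sum of 2k, 2(k + 2) and 2(k + 4), times [ld]; it decides Abel's formula. *)
Definition mlde_coef2 k z : CC R := 6%:R * (ofR k + 2%:R) * ld z.

Lemma ld1_hd z : upper z -> hd ld z (cderiv (@ld R) z).
Proof. by move=> uz; exact: derivable_hd (ld_holo uz). Qed.

Lemma ld2_hd z : upper z -> hd (cderiv ld) z (cderiv (cderiv (@ld R)) z).
Proof. by move=> uz; apply: derivable_hd; exact: qform_holo (qform_deriv ld_qform) _ uz. Qed.

Lemma mlde_third k M4 M6 f f1 f2 f3 :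
  (forall z, upper z -> hd f z (f1 z)) -> (forall z, upper z -> hd f1 z (f2 z)) ->
  (forall z, upper z -> hd f2 z (f3 z)) ->
  (forall z, upper z -> Dn k 3 f z + M4 z * Dn k 1 f z + M6 z * f z = 0) ->
  forall z, upper z -> f3 z = mlde_coef0 k M4 M6 z * f z + (mlde_coef1 k M4 z * f1 z + mlde_coef2 k z * f2 z).
Proof.
move=> h1 h2 h3 E; pose t : CC R := tpii; pose K : CC R := ofR k.
have t0 : t != 0 := tpii0; pose l := @ld R; pose l1 := cderiv l; pose l2 := cderiv l1.
have D1 z : upper z -> Dn k 1 f z = t^-1 * (f1 z - 2%:R * K * l z * f z).
  by move=> uz; rewrite /= mulr0 addr0 DkE (hd_val (h1 z uz)).
have D1' z : upper z -> hd (Dn k 1 f) z (t^-1 * (f2 z - 2%:R * K * (l1 z * f z + l z * f1 z))).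
  move=> uz; apply: (@hd_upper _ (fun z => t^-1 * (f1 z - 2%:R * K * (l z * f z)))) => //.
    by move=> w uw; rewrite D1// mulrA.
  exact: hdZ (hdB (h2 z uz) (hdZ _ (hdM (ld1_hd uz) (h1 z uz)))).
have k2 (n : nat) : ofR (k + 2 * n%:R) = K + 2%:R * n%:R.
  by rewrite ofRD ofRM !ofRn.
have D2 z : upper z -> Dn k 2 f z = t^-1 * (t^-1 * (f2 z - 2%:R * K * (l1 z * f z + l z * f1 z))
   - 2%:R * (K + 2%:R) * (l z * (t^-1 * (f1 z - 2%:R * K * (l z * f z))))).
  move=> uz; rewrite -[Dn k 2 f]/(Dk (k + 2 * 1%:R) (Dn k 1 f)) DkE (hd_val (D1' z uz)) D1// k2 -/t -/l.
  by rewrite mulr1 !mulrA.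
have D2' z : upper z -> hd (Dn k 2 f) z
   (t^-1 * (t^-1 * (f3 z - 2%:R * K * ((l2 z * f z + l1 z * f1 z) + (l1 z * f1 z + l z * f2 z)))
   - 2%:R * (K + 2%:R) * (l1 z * (t^-1 * (f1 z - 2%:R * K * (l z * f z))) +
      l z * (t^-1 * (f2 z - 2%:R * K * (l1 z * f z + l z * f1 z)))))).
  move=> uz; apply: (@hd_upper _ (fun z => t^-1 * (t^-1 * (f2 z - 2%:R * K * (l1 z * f z + l z * f1 z))
   - 2%:R * (K + 2%:R) * (l z * (t^-1 * (f1 z - 2%:R * K * (l z * f z))))))) => //.
    by move=> w uw; rewrite D2.
  have a1 := hdD (hdM (ld2_hd uz) (h1 z uz)) (hdM (ld1_hd uz) (h2 z uz)).
  have a2 := hdZ t^-1 (hdB (h2 z uz) (hdZ (2%:R * K) (hdM (ld1_hd uz) (h1 z uz)))).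
  exact: hdZ (hdB (hdZ t^-1 (hdB (h3 z uz) (hdZ (2%:R * K) a1))) (hdZ _ (hdM (ld1_hd uz) a2))).
move=> z uz; apply/eqP; rewrite -subr_eq0; apply/eqP.
rewrite -[RHS](mulr0 (t ^+ 3)) -(E z uz).
rewrite -[Dn k 3 f]/(Dk (k + 2 * 2%:R) (Dn k 2 f)) DkE (hd_val (D2' z uz)) D2// D1// k2.
rewrite /mlde_coef0 /mlde_coef1 /mlde_coef2 -/t -/K -/l -/l1 -/l2.
move: (M4 z) (M6 z) (f z) (f1 z) (f2 z) (f3 z) (l z) (l1 z) (l2 z) => m4 m6 y y1 y2 y3 x x1 x2.
by clearbody t K; field.
Qed.

Lemma mlde_coef_holo k M4 M6 : holo M4 -> holo M6 ->
  [/\ holo (mlde_coef0 k M4 M6), holo (mlde_coef1 k M4) & holo (mlde_coef2 k)].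
Proof.
move=> h4 h6.
have H4 z : upper z -> exists D, hd M4 z D by move=> uz; eexists; exact: derivable_hd (h4 z uz).
have H6 z : upper z -> exists D, hd M6 z D by move=> uz; eexists; exact: derivable_hd (h6 z uz).
have L2 z : upper z -> exists D, hd (cderiv (cderiv (@ld R))) z D.
  by move=> uz; eexists; apply: derivable_hd; exact: qform_holo (qform_deriv (qform_deriv ld_qform)) _ uz.
split => z uz; have [d4 {}H4] := H4 z uz; have [d6 {}H6] := H6 z uz; have [d {}L2] := L2 z uz;
  have L0 := ld1_hd uz; have L1 := ld2_hd uz.
- apply: hd_derivable (hdB (hdD (hdD (hdB (hdZ _ L2) (hdM (hdZ _ L0) L1)) (hdZ _ (hdX 3 L0)))
   (hdM (hdZ _ H4) L0)) (hdZ _ H6)).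
- exact: hd_derivable (hdB (hdB (hdZ _ L1) (hdZ _ (hdX 2 L0))) (hdZ _ H4)).
- exact: hd_derivable (hdZ _ L0).
Qed.

End ThirdOrder.

Lemma sum_lin3 (K : fieldType) (c0 c1 c2 : K) (a x0 x1 x2 x3 : 'I_3 -> K) :
  (forall i, x3 i = c0 * x0 i + (c1 * x1 i + c2 * x2 i)) ->
  \sum_i a i * x3 i = c0 * (\sum_i a i * x0 i) + (c1 * (\sum_i a i * x1 i) + c2 * \sum_i a i * x2 i).
Proof. by move=> E; rewrite !sum3 !E; ring. Qed.

Lemma det3_lin3 (K : fieldType) (c0 c1 c2 : K) (u v x y : 'cV[K]_3) :
  (forall i, y i ord0 = c0 * u i ord0 + (c1 * v i ord0 + c2 * x i ord0)) ->
  det3 v v x + det3 u x x + det3 u v y = c2 * det3 u v x.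
Proof. by move=> E; rewrite /det3 !E; ring. Qed.

Lemma det30 (K : fieldType) (v x : 'cV[K]_3) : det3 0 v x = 0.
Proof. by rewrite /det3 !mxE; ring. Qed.

(** * Field identities behind the transformation laws *)

Section TransformationAlgebra.
Variable K : fieldType.
Implicit Types (u x k c j : K).

(** Here and below [u] is the multiplier, [j] the factor cz + d, [c] its derivative, [x] the power
    j^k with derivative [k * (c / j) * x], and [a0], [a1], [a2] are components of [rho g] applied to
    F, F', F''. *)
Lemma first_deriv_alg u x k c j (a0 a1 f : K) : j != 0 ->
  f * j ^- 2 = u * (k * (c / j) * x * a0 + x * a1) ->
  f = u * (x * (k * c * (j * a0) + j ^+ 2 * a1)).
Proof. by move=> j0 E; rewrite -[f](divfK (expf_neq0 2 j0)) E; field. Qed.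

Lemma second_deriv_alg u x k c j (a0 a1 a2 f : K) : j != 0 ->
  f * j ^- 2 = u * (k * (c / j) * x * (k * c * (j * a0) + j ^+ 2 * a1) +
     x * (k * c * (c * a0 + j * a1) + (2%:R * j ^+ 2.-1 * c * a1 + j ^+ 2 * a2))) ->
  f = u * (x * ((k ^+ 2 + k) * c ^+ 2 * j ^+ 2 * a0 + (2%:R * k + 2%:R) * c * j ^+ 3 * a1 + j ^+ 4 * a2)).
Proof. by move=> j0 E; rewrite -[f](divfK (expf_neq0 2 j0)) E /=; field. Qed.

(** The passage to [v0], [v1], [v2] is triangular with diagonal [u * x], [u * x * j ^+ 2],
    [u * x * j ^+ 4], so the terms with [k], [p], [q] drop out. *)
Lemma wronskian_alg (A : 'M[K]_3) (f0 f1 f2 v0 v1 v2 : 'cV[K]_3) (u x k j p q : K) :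
  v0 = (u * x) *: (A *m f0) ->
  (forall i, v1 i ord0 = u * (x * (k * (j * (A *m f0) i ord0) + j ^+ 2 * (A *m f1) i ord0))) ->
  (forall i, v2 i ord0 =
    u * (x * (p * (A *m f0) i ord0 + q * (A *m f1) i ord0 + j ^+ 4 * (A *m f2) i ord0))) ->
  det3 v0 v1 v2 = det3M A * u ^+ 3 * (x ^+ 3 * j ^+ 6 * det3 f0 f1 f2).
Proof.
move=> -> E1 E2.
have -> : det3M A * u ^+ 3 * (x ^+ 3 * j ^+ 6 * det3 f0 f1 f2) =
  (u * x) * (u * x * j ^+ 2) * (u * x * j ^+ 4) * (det3M A * det3 f0 f1 f2) by ring.
rewrite -det3_mul; move: (A *m f0) (A *m f1) (A *m f2) E1 E2 => a0 a1 a2 E1 E2.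
by rewrite /det3 !E1 !E2 !mxE; ring.
Qed.

(** With [L] for lam0, the factors [x ^+ 3] and [j ^+ 6] contribute 3 (4 L - 2) + 6 = 12 L times c /
    j; division by 24 L produces the 1/2 of the law of E2. *)
Lemma log_deriv_alg x c j (C L l l' w : K) : j != 0 -> C != 0 -> x != 0 -> 24%:R * L != 0 -> w != 0 ->
  24%:R * L * l' * (C * (x ^+ 3 * j ^+ 6 * w)) * j ^- 2 =
  C * ((3%:R * x ^+ 3.-1 * ((4%:R * L - 2%:R) * (c / j) * x) * j ^+ 6 + x ^+ 3 * (6%:R * j ^+ 6.-1 * c)) * w
       + x ^+ 3 * j ^+ 6 * (24%:R * L * l * w)) ->
  l' = j ^+ 2 * l + c * j / 2%:R.
Proof.
move=> j0 C0 x0 L0 w0 E.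
have W0 : 24%:R * L * (C * (x ^+ 3 * j ^+ 6 * w)) != 0
  := mulf_neq0 L0 (mulf_neq0 C0 (mulf_neq0 (mulf_neq0 (expf_neq0 3 x0) (expf_neq0 6 j0)) w0)).
have two0 : 2%:R != 0 :> K.
  by apply: contraNneq L0 => e; rewrite (natrM _ 2 12) e !mul0r.
apply: (mulfI W0); rewrite -[LHS](divfK (expf_neq0 2 j0)).
rewrite [X in X / _](_ : _ = 24%:R * L * l' * (C * (x ^+ 3 * j ^+ 6 * w))); last by ring.
by rewrite E /=; field; rewrite j0 two0.
Qed.

End TransformationAlgebra.

(** * The Wronskian of F0 *)

Section Wronskian.
Context {R : realType}.
Variables (rho : 'M[int]_2 -> 'M[CC R]_3) (ups : 'M[int]_2 -> CC R).
Variables (Q : 'M[CC R]_3) (lamq : 'I_3 -> R).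
Variables (k0 lam0 : R) (F : CC R -> 'cV[CC R]_3).
Hypothesis hrep : is_rep rho.
Hypothesis ups1 : forall g, SL2 g -> `|ups g| = 1.
Hypothesis uQ : Q \in unitmx.
Hypothesis qF : qvec Q lamq F.
Hypothesis hF : inHk k0 rho ups F.
Hypothesis k0E : k0 = 4 * lam0 - 2.
Hypothesis lam0pos : 0 < lam0.
Hypothesis fs : fund_system3 k0 F.
Implicit Types (z w : CC R) (g : 'M[int]_2).

Let F1 := dV F.
Let F2 := dV F1.
Definition wr z := det3 (F z) (dV F z) (dV (dV F) z).

Let qF1 : qvec Q lamq F1. Proof. exact: (qvec_dV uQ qF). Qed.
Let qF2 : qvec Q lamq F2. Proof. exact: (qvec_dV uQ qF1). Qed.
Let hd0 i z : upper z -> hd (Defs.comp F i) z (F1 z i ord0). Proof. by move=> uz; exact: (qvec_hd uQ i qF uz). Qed.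
Let hd1 i z : upper z -> hd (Defs.comp F1 i) z (F2 z i ord0). Proof. by move=> uz; exact: (qvec_hd uQ i qF1 uz). Qed.
Let hd2 i z : upper z -> hd (Defs.comp F2 i) z (dV F2 z i ord0). Proof. by move=> uz; exact: (qvec_hd uQ i qF2 uz). Qed.

Lemma fund_third : exists M4 M6 : CC R -> CC R, [/\ holo M4, holo M6 &
  forall i z, upper z -> dV F2 z i ord0 = mlde_coef0 k0 M4 M6 z * F z i ord0 +
    (mlde_coef1 k0 M4 z * F1 z i ord0 + mlde_coef2 k0 z * F2 z i ord0)].
Proof.
have [M4 [M6 [[hM4 _] [[hM6 _] [sol _]]]]] := fs; exists M4, M6; split => // i z uz.
have [_ eqn] := sol i.
exact: (mlde_third (fun z uz => hd0 i uz) (fun z uz => hd1 i uz) (fun z uz => hd2 i uz) eqn uz).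
Qed.

(** At a zero of the Wronskian some nontrivial combination of the components vanishes together with
    two derivatives. The MLDE, read as a first order system, then makes it vanish identically,
    against linear independence. *)
Lemma wr_neq0 z : upper z -> wr z != 0.
Proof.
move=> uz; apply/eqP => /det3_eq0[a [i ai] [e0 e1 e2]].
have [M4 [M6 [hM4 hM6 third]]] := fund_third.
have [h0 h1 h2] := mlde_coef_holo k0 hM4 hM6.
pose y (j : 'I_3) w : CC R := if j == o0 then \sum_i a i * F w i ord0 else
  if j == o1 then \sum_i a i * F1 w i ord0 else \sum_i a i * F2 w i ord0.
pose A (j l : 'I_3) : CC R -> CC R := if j == o0 then (if l == o1 then fun _ => 1 else fun _ => 0) else
  if j == o1 then (if l == o2 then fun _ => 1 else fun _ => 0) else
  if l == o0 then mlde_coef0 k0 M4 M6 else if l == o1 then mlde_coef1 k0 M4 else mlde_coef2 k0.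
have [_ [_ [_ [_ [_ [indep _]]]]]] := fs.
suff y0 w : upper w -> y o0 w = 0.
  by move: ai; rewrite (indep a _ i) ?eqxx// => w uw; exact: (y0 w uw).
move=> uw; apply: (@linear_ode_zero R 3 y A z w _ _ uz uw _ o0).
- move=> j l v uv; rewrite /A; repeat case: eqP => _;
    [exact: hd_derivable (hd_cst 1 v)|exact: hd_derivable (hd_cst 0 v)|exact: hd_derivable (hd_cst 1 v)
    |exact: hd_derivable (hd_cst 0 v)|exact: h0|exact: h1|exact: h2].
- move=> j v uv; rewrite sum3; case: (ord3P j) => ->; rewrite /A /y /=.
  + rewrite !mul0r add0r addr0 mul1r.
    exact: (hd_sum (fun i => hdZ (a i) (hd0 i uv))).
  + rewrite !mul0r !add0r mul1r.
    exact: (hd_sum (fun i => hdZ (a i) (hd1 i uv))).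
  + apply: (hd_eq (hd_sum (fun i => hdZ (a i) (hd2 i uv)))).
    exact: (sum_lin3 a (fun l => third l v uv)).
- by move=> j; rewrite /y; case: (ord3P j) => ->; [exact: e0|exact: e1|exact: e2].
Qed.

Lemma wr_hd z : upper z -> hd wr z (24%:R * ofR lam0 * ld z * wr z).
Proof.
move=> uz; have [M4 [M6 [_ _ third]]] := fund_third.
apply: (hd_eq (hd_det3 (fun i => hd0 i uz) (fun i => hd1 i uz) (fun i => hd2 i uz))).
(* Here [k0 + 2 = 4 * lam0] is used. *)
have c2 : mlde_coef2 k0 z = 24%:R * ofR lam0 * ld z.
  by rewrite /mlde_coef2 k0E ofRB ofRM !ofRn; ring.
rewrite -c2; exact: det3_lin3 (fun i => third i z uz).
Qed.

Lemma F_neq0 z : upper z -> exists i, F z i ord0 != 0.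
Proof.
move=> uz; apply: contrapT => h; have /eqP := wr_neq0 uz; apply.
have f0 i : F z i ord0 = 0 by apply/eqP/negPn/negP => hi; apply: h; exists i.
have Fz : F z = 0 by apply/colP => i; rewrite mxE f0.
by rewrite /wr Fz det30.
Qed.

Section Transformation.
Variable g : 'M[int]_2.
Hypothesis sg : SL2 g.
Let A := rho g.
Let u := ups g.
Let J w := cpow (jfac g w) k0.
Let c : CC R := (mc g)%:~R.

Let F_mobius z : upper z -> F (mobius g z) = (u * J z) *: (A *m F z).
Proof. by have [_ h] := (proj1 (inHkP rho ups1 k0 F)) hF; exact: h. Qed.

Let mul_hd (U V : CC R -> 'cV[CC R]_3) i z : (forall i, hd (Defs.comp U i) z (V z i ord0)) ->
  hd (fun w => (A *m U w) i ord0) z ((A *m V z) i ord0).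
Proof.
move=> h; rewrite (_ : (fun w => _) = fun w => \sum_j A i j * Defs.comp U j w); last first.
  by apply/funext => w; rewrite mxE.
by rewrite mxE; exact: (hd_sum (fun j => hdZ (A i j) (h j))).
Qed.

(* [cpow] is not known to be holomorphic, but as a function of [z] it is a quotient of
   a component of [F (g z)] by one of [rho g *m F z]; only its modulus is then needed. *)
Lemma cpow_jfac_hd z : upper z -> hd (fun w => cpow (jfac g w) k0) z
  (ofR k0 * (c / jfac g z) * cpow (jfac g z) k0).
Proof.
move=> uz; have um := mobius_upper sg uz; have j0 := jfac_neq0 sg uz.
have [i hi] := F_neq0 um.
pose t w := (A *m F w) i ord0.
have ht := mul_hd i (fun i => hd0 i uz); rewrite -/t in ht.
have u0 : u != 0 := ups_neq0 ups1 sg.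
have E w : upper w -> Defs.comp F i (mobius g w) = u * J w * t w.
  by move=> uw; rewrite /Defs.comp F_mobius// mxE.
have t0 : t z != 0.
  by apply: contraNneq hi => tz; have := E z uz; rewrite tz mulr0 /Defs.comp => ->.
have tz0 : 0 < absC (t z) by rewrite absC_gt0.
(* Within this radius [t] moves by at most half of [absC (t z)], so it has no zero and the quotient
   represents [J]. *)
have [d d0 Hd] := hd_cont ht (divr_gt0 tz0 (ltr0Sn R 1)).
have [e e0 He] := upper_nbhs uz.
have hJ := hd_div t0 (hdZ u^-1 (hd_comp (hd0 i um) (hd_mobius sg uz))) ht.
set D := (_ / _) in hJ.
have {}hJ : hd J z D.
  apply: hd_near hJ; exists (Num.min d e); first by rewrite min_gt0.
  move=> h; rewrite lt_min => /andP[hd he].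
  have uw : upper (z + h) by apply: He; rewrite addrC addKr.
  have tw : t (z + h) != 0.
    apply: contraTneq (Hd h hd) => ->; rewrite sub0r absCN -ltNge ltr_pdivrMr// mulr_natr mulr2n.
    by rewrite ltrDl absC_gt0.
  by rewrite E// mulrA mulKf// mulfK.
have J0 : J z != 0 := cpow_neq0 k0 j0.
apply: (hd_eq hJ); apply: (mulIf (invr_neq0 J0)); rewrite mulfK//.
apply: (log_deriv_of_modulus (C := 0) uz hJ (hd_jfac g z) J0 j0).
move=> w uw; rewrite add0r absC_cpow ?jfac_neq0//.
have jw : 0 < absC (jfac g w) by rewrite absC_gt0 jfac_neq0.
by rewrite !lnXn ?powR_gt0// ln_powR mulrnAr.
Qed.

Lemma wr_mobius z : upper z ->
  wr (mobius g z) = det3M A * u ^+ 3 * (J z ^+ 3 * jfac g z ^+ 6 * wr z).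
Proof.
move=> uz; pose K : CC R := ofR k0.
have J1 w : upper w -> hd J w (K * (c / jfac g w) * J w) := @cpow_jfac_hd w.
have hj w : hd (jfac g) w c := hd_jfac g w.
have hA0 i w (uw : upper w) := mul_hd i (fun i => hd0 i uw).
have hA1 i w (uw : upper w) := mul_hd i (fun i => hd1 i uw).
have E0 i w : upper w -> F (mobius g w) i ord0 = u * (J w * (A *m F w) i ord0).
  by move=> uw; rewrite F_mobius// mxE mulrA.
have E1 i w : upper w -> F1 (mobius g w) i ord0 =
   u * (J w * (K * c * (jfac g w * (A *m F w) i ord0) + jfac g w ^+ 2 * (A *m F1 w) i ord0)).
  move=> uw; have um := mobius_upper sg uw; have j0 := jfac_neq0 sg uw.
  have h1 := hd_comp (hd0 i um) (hd_mobius sg uw).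
  have h2 := hdZ u (hdM (J1 w uw) (hA0 i w uw)).
  exact: (first_deriv_alg j0 (hd_unique (hd_upper uw (E0 i) h1) h2)).
have E2 i w : upper w -> F2 (mobius g w) i ord0 =
   u * (J w * ((K ^+ 2 + K) * c ^+ 2 * jfac g w ^+ 2 * (A *m F w) i ord0
     + (2%:R * K + 2%:R) * c * jfac g w ^+ 3 * (A *m F1 w) i ord0
     + jfac g w ^+ 4 * (A *m F2 w) i ord0)).
  move=> uw; have um := mobius_upper sg uw; have j0 := jfac_neq0 sg uw.
  have h1 := hd_comp (hd1 i um) (hd_mobius sg uw).
  have h2 := hdZ u (hdM (J1 w uw) (hdD (hdZ (K * c) (hdM (hj w) (hA0 i w uw)))
    (hdM (hdX 2 (hj w)) (hA1 i w uw)))).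
  exact: (second_deriv_alg j0 (hd_unique (hd_upper uw (E1 i) h1) h2)).
exact: (wronskian_alg (F_mobius uz) (fun i => E1 i z uz) (fun i => E2 i z uz)).
Qed.

(* Comparing the logarithmic derivatives of both sides of [wr_mobius]. *)
Lemma ld_mobius z : upper z ->
  ld (mobius g z) = jfac g z ^+ 2 * ld z + (mc g)%:~R * jfac g z / 2%:R :> CC R.
Proof.
move=> uz; have um := mobius_upper sg uz; have j0 := jfac_neq0 sg uz.
have C0 : det3M A * u ^+ 3 != 0.
  by rewrite mulf_neq0 ?expf_neq0 ?(ups_neq0 ups1 sg)// det3M_neq0//; case: hrep => _; apply.
have hj : hd (jfac g) z c := hd_jfac g z.
have h1 := hd_comp (wr_hd um) (hd_mobius sg uz).
have h2 := hdZ (det3M A * u ^+ 3) (hdM (hdM (hdX 3 (cpow_jfac_hd uz)) (hdX 6 hj)) (wr_hd uz)).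
have E := hd_unique (hd_upper uz wr_mobius h1) h2; rewrite (wr_mobius uz) in E.
have K0 : ofR k0 = 4%:R * ofR lam0 - 2%:R by rewrite k0E ofRB ofRM !ofRn.
have l0 : 24%:R * ofR lam0 != 0 by rewrite mulf_neq0 ?pnatr_eq0// ofR_eq0 gt_eqF.
rewrite K0 in E.
exact: (log_deriv_alg j0 C0 (cpow_neq0 k0 j0) l0 (wr_neq0 uz) E).
Qed.

End Transformation.
End Wronskian.

Section InHkClosure.
Context {R : realType}.
Variables (rho : 'M[int]_2 -> 'M[CC R]_3) (ups : 'M[int]_2 -> CC R).
Hypothesis ups1 : forall g, SL2 g -> `|ups g| = 1.
Implicit Types (X Y : CC R -> 'cV[CC R]_3) (z w : CC R) (g : 'M[int]_2) (k : R).

Lemma inHk0 k : inHk k rho ups (fun _ => 0).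
Proof.
split=> [i|g z sg uz]; last by rewrite scaler0 mulmx0.
rewrite (_ : Defs.comp _ i = fun _ => 0); last by apply/funext => z; rewrite /Defs.comp mxE.
by split; [move=> z _; exact: hd_derivable (hd_cst 0 z)|exact: ford_growth (ford0 0)].
Qed.

Lemma inHkD k X Y : inHk k rho ups X -> inHk k rho ups Y -> inHk k rho ups (fun z => X z + Y z).
Proof.
move=> [h1 h2] [h1' h2']; split=> [i|g z sg uz]; last by rewrite scalerDr mulmxDr h2// h2'.
rewrite (_ : Defs.comp _ i = fun z => Defs.comp X i z + Defs.comp Y i z); last first.
  by apply/funext => z; rewrite /Defs.comp mxE.
have [a b] := h1 i; have [a' b'] := h1' i; split; last exact: growthD.
by move=> z uz; exact: hd_derivable (hdD (derivable_hd (a z uz)) (derivable_hd (a' z uz))).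
Qed.

Lemma inHkZ k (c : CC R) X : inHk k rho ups X -> inHk k rho ups (fun z => c *: X z).
Proof.
move=> [h1 h2]; split=> [i|g z sg uz]; last by rewrite scalerA mulrC -scalerA h2// scalemxAr.
rewrite (_ : Defs.comp _ i = fun z => c * Defs.comp X i z); last first.
  by apply/funext => z; rewrite /Defs.comp mxE.
have [a b] := h1 i; split; last exact: growthZ.
by move=> z uz; exact: hd_derivable (hdZ c (derivable_hd (a z uz))).
Qed.

Lemma mod_growthM (f g : CC R -> CC R) : mod_growth f -> mod_growth g -> mod_growth (fun z => f z * g z).
Proof.
move=> /growthP[N [c [N0 c0 H]]] /growthP[N' [c' [N0' c0' H']]]; apply/growthP.
exists (N + N'), (c + c'); split; [lra|lra|move=> x y hy].
rewrite powRD; last by apply/implyP => _; rewrite gt_eqF//; lra.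
by rewrite absCM ler_pM ?absC_ge0 ?H ?H'//; lra.
Qed.

Lemma inHk_scale k (w : int) (M : CC R -> CC R) X : inMj w M -> inHk k rho ups X ->
  inHk (k + w%:~R) rho ups (fun z => M z *: X z).
Proof.
move=> [hM [gM iM]] /(inHkP rho ups1)[h1 h2]; apply/(inHkP rho ups1); split=> [i|g z sg uz].
  rewrite (_ : Defs.comp _ i = fun z => M z * Defs.comp X i z); last first.
    by apply/funext => z; rewrite /Defs.comp mxE.
  have [a b] := h1 i; split; last exact: mod_growthM.
  by move=> z uz; exact: hd_derivable (hdM (derivable_hd (hM z uz)) (derivable_hd (a z uz))).
rewrite iM// h2// cpowD ?jfac_neq0// cpow_int ?jfac_neq0// -scalemxAr !scalerA.
by congr (_ *: _); ring.
Qed.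

End InHkClosure.

(** * Stability under D *)

Section DerivedForms.
Context {R : realType}.
Variables (rho : 'M[int]_2 -> 'M[CC R]_3) (ups : 'M[int]_2 -> CC R).
Variables (Q : 'M[CC R]_3) (a lamq : 'I_3 -> R).
Hypothesis ups1 : forall g, SL2 g -> `|ups g| = 1.
Hypothesis uQ : Q \in unitmx.
Hypothesis QT : Q *m rho Tmat = diag_mx (\row_i ee (a i)) *m Q.
Hypothesis lamq01 : forall i, 0 <= lamq i < 1.
Hypothesis lamqE : forall i, ups Tmat * ee (a i) = ee (lamq i).
Hypothesis ldq : forall (g : 'M[int]_2) z, SL2 g -> upper z ->
  ld (mobius g z) = jfac g z ^+ 2 * ld z + (mc g)%:~R * jfac g z / 2%:R :> CC R.
Implicit Types (X Y : CC R -> 'cV[CC R]_3) (z w : CC R) (g : 'M[int]_2) (k : R).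

Definition DV k X z : 'cV[CC R]_3 := \col_i Dk k (Defs.comp X i) z.

Lemma comp_DV k X i : Defs.comp (DV k X) i = Dk k (Defs.comp X i).
Proof. by apply/funext => z; rewrite /Defs.comp mxE. Qed.

Lemma DVE k X z : DV k X z = tpii^-1 *: (dV X z - (2%:R * ofR k * ld z) *: X z).
Proof. by apply/matrixP => i j; rewrite (ord1 j) !mxE DkE. Qed.

Lemma serre_alg (K : fieldType) (t u x k c j l l' a0 a1 f0 f1 : K) : (2%:R : K) != 0 ->
  l' = j ^+ 2 * l + c * j / 2%:R -> f0 = u * (x * a0) ->
  f1 = u * (x * (k * c * (j * a0) + j ^+ 2 * a1)) ->
  t * (f1 - 2%:R * k * l' * f0) = u * (x * j ^+ 2) * (t * (a1 - 2%:R * k * l * a0)).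
Proof. by move=> n2 -> -> ->; field. Qed.

(** The derivative of the automorphy factor is a hypothesis because it is established only for
    weights exceeding [k0] by a natural number. *)
Lemma inHk_DV k X : inHk k rho ups X -> 
  (forall g z, SL2 g -> upper z -> hd (fun w => cpow (jfac g w) k) z
    (ofR k * ((mc g)%:~R / jfac g z) * cpow (jfac g z) k)) ->
  inHk (k + 2) rho ups (DV k X).
Proof.
move=> hX hJ; have qX := inHk_qvec ups1 QT lamq01 lamqE hX.
have hX0 i z (uz : upper z) := qvec_hd uQ i qX uz.
have qX1 := qvec_dV uQ qX.
have hX1 i z (uz : upper z) := qvec_hd uQ i qX1 uz.
have E i z : tpii^-1 * (Defs.comp (dV X) i z - 2%:R * ofR k * ld z * Defs.comp X i z) = Defs.comp (DV k X) i z.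
  by rewrite comp_DV DkE comp_dV.
have [_ tX] := (proj1 (inHkP rho ups1 _ _)) hX.
apply/(inHkP rho ups1); split=> [i|g z sg uz].
  split.
    move=> z uz; have h := hdZ tpii^-1 (hdB (hX1 i z uz) (hdM (hdZ (2%:R * ofR k) (ld1_hd uz)) (hX0 i z uz))).
    exact: hd_derivable (hd_upper uz (fun w _ => E i w) h).
  apply: ford_growth; apply: (ford_ext (fun w _ => E i w)); apply: fordZ; apply: fordB.
    exact: qvec_ford0 uQ lamq01 _ _ qX1.
  have := fordM (fordZ (2%:R * ofR k) (flim_ford0 (@ld_flim R))) (qvec_ford0 uQ lamq01 i qX).
  by rewrite addr0.
have um := mobius_upper sg uz; have j0 := jfac_neq0 sg uz.
rewrite !DVE -scalemxAr mulmxBr -scalemxAr cpowD// (cpow_nat 2 j0).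
apply/matrixP => i jj; rewrite (ord1 jj) {jj}.
have E0 w : upper w -> Defs.comp X i (mobius g w) = ups g * (cpow (jfac g w) k * (rho g *m X w) i ord0).
  by move=> uw; rewrite /Defs.comp tX// mxE mulrA.
have hA : hd (fun w => (rho g *m X w) i ord0) z ((rho g *m dV X z) i ord0).
  rewrite (_ : (fun w => _) = fun w => \sum_j rho g i j * Defs.comp X j w); last first.
    by apply/funext => w; rewrite mxE.
  by rewrite mxE; exact: (hd_sum (fun j => hdZ (rho g i j) (hX0 j z uz))).
have E1 := first_deriv_alg j0 (hd_unique (hd_upper uz E0 (hd_comp (hX0 i _ um) (hd_mobius sg uz)))
  (hdZ (ups g) (hdM (hJ g z sg uz) hA))).
have := serre_alg tpii^-1 _ (ldq sg uz) (E0 z uz) E1; rewrite pnatr_eq0 => /(_ isT).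
rewrite /Defs.comp; move: (rho g *m X z) (rho g *m dV X z) => a0 a1 h.
rewrite [LHS]mxE [X in _ * X = _]mxE [X in _ * (_ + X)]mxE [X in _ * (_ - X)]mxE h.
by rewrite !mxE.
Qed.

End DerivedForms.

(** * Structure of the module *)

Section QuotientAlgebra.
Variable K : fieldType.

Lemma deriv_mul_pow_alg (k x c j : K) n : j != 0 ->
  k * (c / j) * x * j ^+ n + x * (n%:R * j ^+ n.-1 * c) = (k + n%:R) * (c / j) * (x * j ^+ n).
Proof.
by move=> j0; case: n => [|n] /=; [rewrite !mul0r mulr0 !addr0; ring|rewrite exprS; field].
Qed.

Lemma quotient_alg (D c1 c2 c3 J j jw A u W : K) : c1 * c2 * c3 = J ^+ 3 * j ^+ 6 * jw ->
  A != 0 -> u != 0 -> J != 0 -> j != 0 -> W != 0 ->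
  u * c1 * (u * c2) * (u * c3) * (A * D) / (A * u ^+ 3 * (J ^+ 3 * j ^+ 6 * W)) = jw * (D / W).
Proof.
move=> E A0 u0 J0 j0 W0.
have -> : u * c1 * (u * c2) * (u * c3) * (A * D) = u ^+ 3 * (c1 * c2 * c3) * (A * D) by ring.
by rewrite E; field; rewrite A0 u0 J0 j0 W0.
Qed.

Lemma det3_DV_alg (t p q s : K) (f0 f1 f2 g1 d1 g2 : 'cV[K]_3) :
  g1 = t *: (f1 - p *: f0) -> d1 = t *: (f2 - (q *: f0 + p *: f1)) -> g2 = t *: (d1 - s *: g1) ->
  det3 f0 g1 g2 = t ^+ 3 * det3 f0 f1 f2.
Proof. by move=> E1 E2 E3; rewrite E3 E2 E1 /det3 !mxE; ring. Qed.

Lemma det3_indep (x0 x1 x2 : K) (u v w : 'cV[K]_3) : det3 u v w != 0 ->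
  x0 *: u + (x1 *: v + x2 *: w) = 0 -> [/\ x0 = 0, x1 = 0 & x2 = 0].
Proof.
move=> d0 E; have e i : x0 * u i ord0 + (x1 * v i ord0 + x2 * w i ord0) = 0.
  by have := congr1 (fun y : 'cV_3 => y i ord0) E; rewrite !mxE.
split; apply: (mulIf d0); rewrite mul0r.
- transitivity (det3 (x0 *: u + (x1 *: v + x2 *: w)) v w); first by rewrite /det3 !mxE; ring.
  by rewrite E det30.
- transitivity (det3 u (x0 *: u + (x1 *: v + x2 *: w)) w); first by rewrite /det3 !mxE; ring.
  by rewrite E /det3 !mxE; ring.
- transitivity (det3 u v (x0 *: u + (x1 *: v + x2 *: w))); first by rewrite /det3 !mxE; ring.
  by rewrite E /det3 !mxE; ring.
Qed.

End QuotientAlgebra.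

Section Structure.
Context {R : realType}.
Variables (rho : 'M[int]_2 -> 'M[CC R]_3) (ups : 'M[int]_2 -> CC R).
Variables (Q : 'M[CC R]_3) (a lamq : 'I_3 -> R).
Variables (k0 lam0 : R) (F : CC R -> 'cV[CC R]_3).
Hypothesis hrep : is_rep rho.
Hypothesis ups1 : forall g, SL2 g -> `|ups g| = 1.
Hypothesis uQ : Q \in unitmx.
Hypothesis QT : Q *m rho Tmat = diag_mx (\row_i ee (a i)) *m Q.
Hypothesis lamq01 : forall i, 0 <= lamq i < 1.
Hypothesis lamqE : forall i, ups Tmat * ee (a i) = ee (lamq i).
Hypothesis hF : inHk k0 rho ups F.
Hypothesis k0E : k0 = 4 * lam0 - 2.
Hypothesis lam0pos : 0 < lam0.
Hypothesis lam0E : lam0 = \sum_i lamq i.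
Hypothesis fs : fund_system3 k0 F.
Implicit Types (z w : CC R) (g : 'M[int]_2) (X U V : CC R -> 'cV[CC R]_3) (k : R).

Let inHkq k X : inHk k rho ups X -> qvec Q lamq X.
Proof. exact: (inHk_qvec ups1 QT lamq01 lamqE). Qed.
Let qF : qvec Q lamq F := inHkq hF.

Lemma ld_quasimodular (g : 'M[int]_2) z : SL2 g -> upper z ->
  ld (mobius g z) = jfac g z ^+ 2 * ld z + (mc g)%:~R * jfac g z / 2%:R :> CC R.
Proof. by move=> sg uz; exact: (ld_mobius hrep ups1 uQ qF hF k0E lam0pos fs sg uz). Qed.

(** The case of weight [k0] was extracted from F; the rest is multiplication by an ordinary power of
    [jfac]. *)
Lemma cpow_jfac_hd_add (n : nat) g z : SL2 g -> upper z -> hd (fun w => cpow (jfac g w) (k0 + n%:R)) z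
  (ofR (k0 + n%:R) * ((mc g)%:~R / jfac g z) * cpow (jfac g z) (k0 + n%:R)).
Proof.
move=> sg uz; have j0 := jfac_neq0 sg uz.
have h := hdM (cpow_jfac_hd ups1 uQ qF hF fs sg uz) (hdX n (hd_jfac g z)).
apply: (@hd_upper _ (fun w => cpow (jfac g w) k0 * jfac g w ^+ n)) => //.
  by move=> w uw; rewrite cpowD ?cpow_nat// jfac_neq0.
apply: (hd_eq h); rewrite cpowD// cpow_nat// ofRD ofRn; exact: deriv_mul_pow_alg.
Qed.

Lemma DnV_comp n i : Defs.comp (DnV k0 n F) i = Dn k0 n (Defs.comp F i).
Proof. by apply/funext => z; rewrite /Defs.comp mxE. Qed.

Lemma DnVS n : DnV k0 n.+1 F = DV (k0 + 2 * n%:R) (DnV k0 n F).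
Proof.
apply/funext => z; apply/matrixP => i j; rewrite [LHS]mxE [RHS]mxE DnV_comp.
by [].
Qed.

Lemma DnV0 : DnV k0 0 F = F.
Proof. by apply/funext => z; apply/matrixP => i j; rewrite (ord1 j) [LHS]mxE. Qed.

Lemma inHk_DnV n : inHk (k0 + 2 * n%:R) rho ups (DnV k0 n F).
Proof.
elim: n => [|n IH]; first by rewrite DnV0 mulr0 addr0.
have -> : k0 + 2 * n.+1%:R = k0 + 2 * n%:R + 2 by rewrite -natr1; ring.
rewrite DnVS; apply: (inHk_DV ups1 uQ QT lamq01 lamqE ld_quasimodular IH) => g z sg uz.
by rewrite -natrM; exact: cpow_jfac_hd_add.
Qed.

(** Abel's relation is integrated along segments from i, on logarithms of squared moduli, so that no
    real power of eta and no branch of its logarithm occurs. The lower bound for eta then transfers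
    with exponent 24 lam0. *)
Lemma wr_low : exists2 dl : R, 0 < dl & forall z, 1 <= ImC z ->
  dl * expR (- (tpi * (lam0 * ImC z))) <= absC (wr F z).
Proof.
have Wn := wr_neq0 uQ qF fs; have Wh := wr_hd uQ qF k0E fs.
pose L (f : CC R -> CC R) z := ln (absC (f z) ^+ 2).
pose C : R := L (wr F) 'i - 24 * lam0 * L Defs.eta 'i.
have E z : upper z -> L (wr F) z = C + 24 * lam0 * L Defs.eta z.
  move=> uz; pose v := z - 'i.
  have d (t : R) : 0 <= t <= 1 -> is_derive t 1 (fun s : R =>
     L (wr F) ('i + ofR s * v) - 24 * lam0 * L Defs.eta ('i + ofR s * v)) 0.
    move=> ht; have us : upper ('i + ofR t * v) := upper_segment upper_i uz ht.
    have h1 := hd_ln (Wh _ us) (Wn _ us); have h2 := hd_ln (eta_hd us) (eta_neq0 us).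
    have := is_deriveB h1 (is_deriveZ (24 * lam0) h2) => h; apply: is_derive_eq h _.
    have e1 : 24%:R * ofR lam0 * ld ('i + ofR t * v) * wr F ('i + ofR t * v) * v / wr F ('i + ofR t * v)
      = ofR (24 * lam0) * (ld ('i + ofR t * v) * v).
      by rewrite ofRM ofRn; move: (Wn _ us); move: (wr F _) (ld _) => x l x0; field.
    have e2 : ld ('i + ofR t * v) * Defs.eta ('i + ofR t * v) * v / Defs.eta ('i + ofR t * v)
      = ld ('i + ofR t * v) * v.
      by move: (eta_neq0 us); move: (Defs.eta _) (ld _) => x l x0; field.
    rewrite e1 e2 ReM Re_of Im_of mul0r subr0 /GRing.scale /=; ring.
  have := derive0_const d ler01.
  have v0 : 'i + ofR 0 * v = 'i by rewrite ofR0 mul0r addr0.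
  have v1 : 'i + ofR 1 * v = z by rewrite ofR1 mul1r /v addrC subrK.
  have st (p q r s : R) : p - q = r - s -> p = r - s + q by lra.
  cbv beta.
  rewrite v0.
  rewrite v1.
  move/st.
  by [].
have [d d0 Hd] := @eta_low R.
exists (expR (C / 2 + 24 * lam0 * ln d)); first exact: expR_gt0.
move=> z z1; have uz : upper z := lt_le_trans ltr01 z1.
have w0 : 0 < absC (wr F z) by rewrite absC_gt0 Wn.
have e0 : 0 < absC (Defs.eta z) by rewrite absC_gt0 eta_neq0.
have := E z uz; rewrite /L !lnXn// => E'.
have el : ln d - tpi * (24%:R^-1 * ImC z) <= ln (absC (Defs.eta z)).
  have := Hd z z1; rewrite -ler_ln ?posrE ?mulr_gt0 ?expR_gt0//.
  by rewrite lnM ?posrE ?expR_gt0// expRK.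
rewrite -[leRHS]lnK ?posrE// -expRD ler_expR.
have : 24 * lam0 * (ln d - tpi * (24%:R^-1 * ImC z)) <= 24 * lam0 * ln (absC (Defs.eta z)).
  by rewrite ler_wpM2l// mulr_ge0// ltW.
have -> : 24 * lam0 * (ln d - tpi * (24%:R^-1 * ImC z)) = 24 * lam0 * ln d - tpi * (lam0 * ImC z).
  by field.
move: E'; rewrite [ln (absC (wr F z)) *+ 2]mulr2n [ln (absC (Defs.eta z)) *+ 2]mulr2n; clearbody C.
move: (ln (absC (wr F z))) (ln (absC (Defs.eta z))) (24 * lam0) (tpi * _) (ln d) => p q s t v.
by rewrite mulrDr; move: (s * q) (s * v) => sq sv; lra.
Qed.

(** Numerator and denominator transform with the same constant, the determinant of [rho g] times
    [ups g ^+ 3], which cancels and leaves an integral power of [jfac]. At the cusp the numerator is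
    O(|q|^lam0), which is the lower bound for the Wronskian. *)
Lemma det3_div_wr k1 k2 k3 (w : int) U V X : inHk k1 rho ups U -> inHk k2 rho ups V ->
  inHk k3 rho ups X -> k1 + k2 + k3 = 3 * k0 + 6 + w%:~R ->
  inMj w (fun z => det3 (U z) (V z) (X z) / wr F z).
Proof.
move=> hU hV hX kE; have qU := inHkq hU; have qV := inHkq hV; have qX := inHkq hX.
have Wn := wr_neq0 uQ qF fs; have Wh := wr_hd uQ qF k0E fs.
apply: inMj_intro.
- move=> z uz; apply: hd_derivable (hd_div (Wn z uz)
    (hd_det3 (fun i => qvec_hd uQ i qU uz) (fun i => qvec_hd uQ i qV uz) (fun i => qvec_hd uQ i qX uz)) (Wh z uz)).
- have [K [K0 HK]] := qvec_det3 uQ qU qV qX; have [dl dl0 Hdl] := wr_low.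
  exists (K / dl); split; first by rewrite divr_ge0// ltW.
  move=> z z1; rewrite mul0r mulr0 oppr0 expR0 mulr1 absCM absCV.
  have h1 := HK z z1; have h2 := Hdl z z1; rewrite -lam0E in h1.
  have D0 : 0 < absC (wr F z) by apply: lt_le_trans h2; rewrite mulr_gt0 ?expR_gt0.
  rewrite ler_pdivrMr//; apply: le_trans h1 _.
  by rewrite -[leRHS]mulrA ler_wpM2l// [leRHS]mulrC ler_pdivlMr// mulrC.
- move=> g z sg uz; have j0 := jfac_neq0 sg uz; have u0 := ups_neq0 ups1 sg.
  have [_ tU] := (proj1 (inHkP rho ups1 _ _)) hU; have [_ tV] := (proj1 (inHkP rho ups1 _ _)) hV.
  have [_ tX] := (proj1 (inHkP rho ups1 _ _)) hX.
  rewrite tU// tV// tX// det3Z det3_mul (wr_mobius ups1 uQ qF hF fs sg uz).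
  have A0 : det3M (rho g) != 0 by apply: det3M_neq0; case: hrep => _; apply.
  have cE : cpow (jfac g z) k1 * cpow (jfac g z) k2 * cpow (jfac g z) k3 =
     cpow (jfac g z) k0 ^+ 3 * jfac g z ^+ 6 * jfac g z ^ w.
    have kE' : k1 + k2 + k3 = k0 + (k0 + k0) + 6 + w%:~R by rewrite kE; ring.
    rewrite -!cpowD// kE' (cpowD _ w%:~R j0) (cpowD _ 6 j0) (cpowD k0 (k0 + k0) j0) (cpowD k0 k0 j0).
    by rewrite cpow_int// (cpow_nat 6 j0) (exprS _ 2) expr2.
  exact: (quotient_alg _ cE A0 u0 (cpow_neq0 k0 j0) j0 (Wn z uz)).
Qed.

(** Replacing derivatives by D^j is triangular with diagonal 1, 1/[tpii], 1/[tpii ^+ 2]. *)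
Lemma det3_DnV z : upper z ->
  det3 (DnV k0 0 F z) (DnV k0 1 F z) (DnV k0 2 F z) = tpii ^- 3 * wr F z.
Proof.
move=> uz; rewrite DnV0 -exprVn.
have E1 w : DnV k0 1 F w = tpii^-1 *: (dV F w - (2%:R * ofR k0 * ld w) *: F w).
  by rewrite DnVS DnV0 mulr0 addr0 DVE.
apply: (det3_DV_alg (E1 z) _ (_ : _ = tpii^-1 *: (dV (DnV k0 1 F) z - (2%:R * ofR (k0 + 2 * 1%:R) * ld z) *: DnV k0 1 F z))).
  2: by rewrite DnVS DVE.
apply/matrixP => i j; rewrite (ord1 j) {j}.
have h1 := qvec_hd uQ i qF uz; have h2 := qvec_hd uQ i (qvec_dV uQ qF) uz.
have h := hdZ tpii^-1 (hdB h2 (hdM (hdZ (2%:R * ofR k0) (ld1_hd uz)) h1)).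
have EE w : upper w -> tpii^-1 * (Defs.comp (dV F) i w - 2%:R * ofR k0 * ld w * Defs.comp F i w)
  = Defs.comp (DnV k0 1 F) i w.
  move=> _; rewrite [RHS]/Defs.comp E1.
  by rewrite [RHS]mxE [X in _ = _ * X]mxE [X in _ = _ * (_ + X)]mxE [X in _ = _ * (_ - X)]mxE.
have {}h := hd_upper uz EE h.
rewrite [LHS]mxE (hd_val h) [RHS]mxE [X in _ = _ * X]mxE [X in _ = _ * (_ + X)]mxE.
by rewrite [X in _ = _ * (_ - X)]mxE; congr (_ * (_ - (_ + _))); rewrite [RHS]mxE.
Qed.

Lemma det3_DnV_neq0 z : upper z -> det3 (DnV k0 0 F z) (DnV k0 1 F z) (DnV k0 2 F z) != 0.
Proof.
move=> uz; rewrite det3_DnV// mulf_neq0 ?(wr_neq0 uQ qF fs uz)// invr_eq0.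
exact: expf_neq0 tpii0.
Qed.

Lemma DnV_span (d : int) X : inHk (k0 + d%:~R) rho ups X ->
  exists M : 'I_3 -> CC R -> CC R, (forall j : 'I_3, inMj (d - 2 * j%:Z) (M j)) /\
    forall z, upper z -> X z = \sum_(j < 3) M j z *: DnV k0 j F z.
Proof.
move=> hX.
(* Cramer's quotients: [X] replaces the column D^j F, which changes the total weight by d - 2j, and
   [tpii ^+ 3] accounts for dividing by the Wronskian instead of the determinant of the D^j F. *)
pose M (j : 'I_3) z : CC R := tpii ^+ 3 *
  (det3 (if j == o0 then X z else DnV k0 0 F z) (if j == o1 then X z else DnV k0 1 F z)
    (if j == o2 then X z else DnV k0 2 F z) / wr F z).
exists M; split.
  move=> j; apply: inMjZ; have h0 := inHk_DnV 0; have h1 := inHk_DnV 1; have h2 := inHk_DnV 2.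
  case: (ord3P j) => -> /=.
  - by apply: (det3_div_wr hX h1 h2); rewrite intrB intrM; ring.
  - by apply: (det3_div_wr h0 hX h2); rewrite intrB intrM; ring.
  - by apply: (det3_div_wr h0 h1 hX); rewrite intrB intrM; ring.
move=> z uz; have D0 := det3_DnV_neq0 uz; have D := det3_DnV uz.
rewrite sum3; apply: (scalerI D0); rewrite cramer3 !scalerDr !scalerA {1 2 3}D.
have t0 : (tpii ^+ 3 : CC R) != 0 := expf_neq0 3 tpii0.
have w0 := wr_neq0 uQ qF fs uz.
have e x : tpii ^- 3 * wr F z * (tpii ^+ 3 * (x / wr F z)) = x.
  by move: (tpii ^+ 3) (wr F z) t0 w0 => t w t0 w0; field; rewrite t0 w0.
by rewrite /M !e.
Qed.

End Structure.

(** * Dimension count *)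

Section Dimension.
Context {R : realType}.
Implicit Types (P : (CC R -> 'cV[CC R]_3) -> Prop) (G : CC R -> 'cV[CC R]_3) (z : CC R).

Lemma sum_split_inl (K : pzRingType) n p (a : 'I_(n + p) -> K) (f : 'I_n -> K) :
  \sum_i a i * (if fintype.split i is inl j then f j else 0) = \sum_j a (lshift p j) * f j.
Proof.
rewrite big_split_ord /= [X in _ + X]big1 ?addr0 => [|j _]; last first.
  by rewrite -[rshift _ _]/(unsplit (inr _)) unsplitK mulr0.
by apply: eq_bigr => j _; rewrite -[lshift _ _]/(unsplit (inl _)) unsplitK.
Qed.

Lemma sum_split_inr (K : pzRingType) n p (a : 'I_(n + p) -> K) (f : 'I_p -> K) :
  \sum_i a i * (if fintype.split i is inr j then f j else 0) = \sum_j a (rshift n j) * f j.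
Proof.
rewrite big_split_ord /= [X in X + _]big1 ?add0r => [|j _]; last first.
  by rewrite -[lshift _ _]/(unsplit (inl _)) unsplitK mulr0.
by apply: eq_bigr => j _; rewrite -[rshift _ _]/(unsplit (inr _)) unsplitK.
Qed.

Lemma has_dim_free3 P G0 G1 G2 (w0 w1 w2 : int) (d0 d1 d2 : nat) :
  @Mdim R w0 d0 -> @Mdim R w1 d1 -> @Mdim R w2 d2 ->
  (forall M0 M1 M2, inMj w0 M0 -> inMj w1 M1 -> inMj w2 M2 ->
     P (fun z => M0 z *: G0 z + (M1 z *: G1 z + M2 z *: G2 z))) ->
  (forall X, P X -> exists M0 M1 M2, [/\ inMj w0 M0, inMj w1 M1, inMj w2 M2 &
     forall z, upper z -> X z = M0 z *: G0 z + (M1 z *: G1 z + M2 z *: G2 z)]) ->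
  (forall z (x0 x1 x2 : CC R), upper z -> x0 *: G0 z + (x1 *: G1 z + x2 *: G2 z) = 0 ->
     [/\ x0 = 0, x1 = 0 & x2 = 0]) ->
  has_dim P (d0 + (d1 + d2)).
Proof.
move=> [B0 [m0 i0 s0]] [B1 [m1 i1 s1]] [B2 [m2 i2 s2]] PM MP free.
(* Coefficients of the i-th basis vector along [G0], [G1], [G2]; exactly one of them comes from a
   basis, and padding by 0 lets all three sums run over the same index set. *)
pose c0 (i : 'I_(d0 + (d1 + d2))) z : CC R := if fintype.split i is inl j then B0 j z else 0.
pose c1 (i : 'I_(d0 + (d1 + d2))) z : CC R :=
  if fintype.split i is inr i' then (if fintype.split i' is inl j then B1 j z else 0) else 0.
pose c2 (i : 'I_(d0 + (d1 + d2))) z : CC R :=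
  if fintype.split i is inr i' then (if fintype.split i' is inr j then B2 j z else 0) else 0.
pose b i z := c0 i z *: G0 z + (c1 i z *: G1 z + c2 i z *: G2 z).
have sb (a : 'I_(d0 + (d1 + d2)) -> CC R) z : \sum_i a i *: b i z =
  (\sum_j a (lshift _ j) * B0 j z) *: G0 z +
  ((\sum_j a (rshift _ (lshift _ j)) * B1 j z) *: G1 z +
   (\sum_j a (rshift _ (rshift _ j)) * B2 j z) *: G2 z).
  rewrite -(sum_split_inl (fun j => a (rshift d0 j))) -(sum_split_inr (fun j => a (rshift d0 j))).
  rewrite -(sum_split_inl a) -!(sum_split_inr a) !scaler_suml -!big_split /=.
  by apply: eq_bigr => i _; rewrite /b !scalerDr !scalerA.
exists b; split; [|split].
- move=> i; apply: PM.
  + by rewrite /c0; case: (fintype.split i) => j; [exact: m0|exact: inMj0].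
  + rewrite /c1; case: (fintype.split i) => [j|i']; first exact: inMj0.
    by case: (fintype.split i') => j; [exact: m1|exact: inMj0].
  + rewrite /c2; case: (fintype.split i) => [j|i']; first exact: inMj0.
    by case: (fintype.split i') => j; [exact: inMj0|exact: m2].
- move=> a H.
  have H' z (uz : upper z) := free z _ _ _ uz (etrans (esym (sb a z)) (H z uz)).
  move=> i; rewrite -(splitK i); case: (fintype.split i) => [j|i'] /=.
    by apply: (i0 (fun j => a (lshift _ j))) => z uz; case: (H' z uz).
  rewrite -(splitK i'); case: (fintype.split i') => [j|j] /=.
    by apply: (i1 (fun j => a (rshift _ (lshift _ j)))) => z uz; case: (H' z uz).
  by apply: (i2 (fun j => a (rshift _ (rshift _ j)))) => z uz; case: (H' z uz).
- move=> X /MP[M0 [M1 [M2 [/s0[a0 E0] /s1[a1 E1] /s2[a2 E2] E]]]].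
  pose a (i : 'I_(d0 + (d1 + d2))) : CC R := match fintype.split i with
    | inl j => a0 j | inr i' => match fintype.split i' with inl j => a1 j | inr j => a2 j end end.
  have a0E j : a (lshift _ j) = a0 j.
    by rewrite /a -[lshift _ _]/(unsplit (inl _)) unsplitK.
  have a1E j : a (rshift _ (lshift _ j)) = a1 j.
    by rewrite /a -[rshift _ _]/(unsplit (inr _)) unsplitK -[lshift _ _]/(unsplit (inl _)) unsplitK.
  have a2E j : a (rshift _ (rshift _ j)) = a2 j.
    by rewrite /a -[rshift d0 _]/(unsplit (inr _)) unsplitK -[rshift _ _]/(unsplit (inr _)) unsplitK.
  exists a => z uz; rewrite sb (E z uz) (E0 z uz) (E1 z uz) (E2 z uz).
  under [in RHS]eq_bigr do rewrite a0E.
  under [X in _ = _ + (X *: _ + _)]eq_bigr do rewrite a1E.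
  by under [X in _ = _ + (_ + X *: _)]eq_bigr do rewrite a2E.
Qed.

(** The summands are the dimensions in weights 2k, 2k - 2 and 2k - 4. On generating series: (1 + t +
    t^2) / ((1 - t^2)(1 - t^3)) = 1 / ((1 - t)(1 - t^2)). *)
Lemma mdim_sum kk : (mdim (kk + 6) + (mdim (kk + 5) + mdim (kk + 4)) = (kk %/ 2).+1)%N.
Proof. by rewrite /mdim; do 3?case: eqP; lia. Qed.

End Dimension.

(** * The graded sum H(rho, ups) *)

Section GradedSum.
Context {R : realType}.
Variables (rho : 'M[int]_2 -> 'M[CC R]_3) (ups : 'M[int]_2 -> CC R) (k : R).
Hypothesis ups1 : forall g, SL2 g -> `|ups g| = 1.
Implicit Types (X Y : CC R -> 'cV[CC R]_3) (z w : CC R).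

Lemma inH_ext X Y : (forall z, upper z -> X z = Y z) -> inH k rho ups X -> inH k rho ups Y.
Proof. by move=> E [s [Fs [h e]]]; exists s, Fs; split => // z uz; rewrite -E ?e. Qed.

Lemma inH0 : inH k rho ups (fun _ => 0).
Proof.
by exists [::], (fun _ _ => 0); split => [n|z _]; [exact: inHk0|rewrite big_nil].
Qed.

(* The index list may repeat [n]: the new summand is spread evenly over its occurrences. *)
Lemma inH_add1 (n : int) X Y : inH k rho ups X -> inHk (k + n%:~R) rho ups Y ->
  inH k rho ups (fun z => X z + Y z).
Proof.
move=> [s [Fs [h e]]] hY; have [ns|ns] := boolP (n \in s); last first.
  exists (n :: s), (fun p => if p == n then Y else Fs p); split.
    by move=> p; case: eqP => [->|_].
  move=> z uz; rewrite big_cons eqxx addrC e//; congr (_ + _).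
  by apply: eq_big_seq => p ps; case: eqP => // pn; rewrite -pn ps in ns.
pose c : CC R := (count_mem n s)%:R^-1.
exists s, (fun p => if p == n then fun z => Fs p z + c *: Y z else Fs p); split.
  by move=> p; case: eqP => [->|_] //; apply: inHkD => //; exact: inHkZ.
move=> z uz; rewrite e//.
have -> : \sum_(p <- s) (if p == n then fun z => Fs p z + c *: Y z else Fs p) z =
  \sum_(p <- s) (Fs p z + (if p == n then c else 0) *: Y z).
  by apply: eq_bigr => p _; case: eqP; rewrite ?scale0r ?addr0.
rewrite big_split /=; congr (_ + _).
rewrite -scaler_suml -big_mkcond /= big_const_seq iter_addr_0 -mulr_natl mulfV ?scale1r//.
by rewrite pnatr_eq0 -lt0n -has_count has_pred1.
Qed.

Lemma inH_inHk (n : int) X : inHk (k + n%:~R) rho ups X -> inH k rho ups X.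
Proof. by move=> h; apply: inH_ext (inH_add1 inH0 h) => z _; rewrite add0r. Qed.

Lemma inH_addM (n : int) (M : CC R -> CC R) X Y : inM M -> inHk (k + n%:~R) rho ups Y ->
  inH k rho ups X -> inH k rho ups (fun z => X z + M z *: Y z).
Proof.
move=> [s [fs [hf e]]] hY hX.
apply: (@inH_ext (fun z => X z + \sum_(j <- s) fs j z *: Y z)).
  by move=> z uz; rewrite e// scaler_suml.
elim: s {e} => [|j s IH]; first by apply: inH_ext hX => z _; rewrite big_nil addr0.
apply: (@inH_ext (fun z => (X z + \sum_(j <- s) fs j z *: Y z) + fs j z *: Y z)).
  by move=> z _; rewrite big_cons -addrA [X in _ + X]addrC.
apply: (inH_add1 (n := n + j)) IH _; rewrite intrD addrA.
exact: inHk_scale.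
Qed.

End GradedSum.

Unset Implicit Arguments.

Theorem theorem4p9 (R : realType) (rho : 'M[int]_2 -> 'M[CC R]_3)
  (ups : 'M[int]_2 -> CC R) (k m : R) (r : 'I_3 -> R)
  (F0 : CC R -> 'cV[CC R]_3) :
  is_rep rho -> T_determined rho -> T_unitarizable rho ->
  is_multiplier k ups -> cusp_param ups m ->
  (forall j, 0 <= r j < 1) ->
  char_poly (rho Tmat) = \prod_(j < 3) ('X - (ee (r j))%:P) ->
  let lam := fun j : 'I_3 => fracR (r j + m / 12) in
  let lam0 := \sum_(j < 3) lam j in
  let k0 := 4 * lam0 - 2 in
  (* H(rho,ups) = (+)_{j >= 0} H(k0 + 2j, rho, ups) *)
  (exists n : int, k0 = k + n%:~R) ->
  (forall n : int, (forall j : nat, k + n%:~R <> k0 + 2 * j%:R) ->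
     forall F, inHk (k + n%:~R) rho ups F -> eqH F (fun _ => 0)) ->
  inHk k0 rho ups F0 -> ~ eqH F0 (fun _ => 0) -> fund_system3 k0 F0 ->
  (* (i) free M-module of rank 3 with basis F0, D F0, D^2 F0 *)
  ((forall j : 'I_3, inH k rho ups (DnV k0 j F0)) /\
   (forall M : 'I_3 -> CC R -> CC R, (forall j, inM (M j)) ->
      inH k rho ups (fun z => \sum_(j < 3) M j z *: DnV k0 j F0 z)) /\
   (forall F, inH k rho ups F ->
      exists M : 'I_3 -> CC R -> CC R, (forall j, inM (M j)) /\
        eqH F (fun z => \sum_(j < 3) M j z *: DnV k0 j F0 z)) /\
   (forall M : 'I_3 -> CC R -> CC R, (forall j, inM (M j)) ->
      eqH (fun z => \sum_(j < 3) M j z *: DnV k0 j F0 z) (fun _ => 0) ->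
      forall j, eqH (M j) (fun _ => 0))) /\
  (* (ii) H(rho,ups) = R F0 *)
  (forall F, inH k rho ups F <->
     exists (n : nat) (M : nat -> CC R -> CC R), (forall j, inM (M j)) /\
       eqH F (fun z => \sum_(j < n) M j z *: DnV k0 j F0 z)) /\
  (* (iii) dimension formula *)
  (forall kk : nat, has_dim (inHk (k0 + 2 * kk%:R) rho ups) (kk %/ 2).+1).
Proof.
move=> hrep [irr _] uni [ups1 _] [m12 upsT] r01 cp lam lam0 k0 [n0 k0n] _ hF _ fs.
have [Q [s [uQ QT]]] := T_diag uni cp.
pose a i := r (s i); pose lamq i := lam (s i).
have lamq01 i : 0 <= lamq i < 1 by exact: fracR_bound.
have lamqE i : ups Tmat * ee (a i) = ee (lamq i) by rewrite /lamq /lam ee_fracR upsT -eeD addrC.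
have lam0E : lam0 = \sum_i lamq i by rewrite /lam0 (reindex_inj (@perm_inj _ s)).
have lam0pos : 0 < lam0 := lam0_gt0 (m / 12) hrep irr uni cp.
have k0E : k0 = 4 * lam0 - 2 by [].
have ldq (g : 'M[int]_2) z (sg : SL2 g) (uz : upper z) :=
  ld_quasimodular hrep ups1 uQ QT lamq01 lamqE hF k0E lam0pos fs sg uz.
have hG n : inHk (k0 + 2 * n%:R) rho ups (DnV k0 n F0) :=
  inHk_DnV hrep ups1 uQ QT lamq01 lamqE hF k0E lam0pos fs n.
have span := DnV_span hrep ups1 uQ QT lamq01 lamqE hF k0E lam0pos lam0E fs.
have G_neq0 z (uz : upper z) := det3_DnV_neq0 ups1 uQ QT lamq01 lamqE hF fs uz.
clearbody k0.
(* The weights are rewritten relative to the base weight [k] of the grading, from which [k0] differs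
   by [n0]. *)
have hGk n : inHk (k + (n0 + 2 * n%:Z)%:~R) rho ups (DnV k0 n F0).
  by have := hG n; rewrite {1}k0n intrD intrM addrA.
have comb n (M : nat -> CC R -> CC R) : (forall j, inM (M j)) ->
    inH k rho ups (fun z => \sum_(j < n) M j z *: DnV k0 j F0 z).
  move=> hM; elim: n => [|n IH].
    by apply: inH_ext (inH0 rho ups k) => z _; rewrite big_ord0.
  apply: inH_ext (inH_addM ups1 (hM n) (hGk n) IH) => z _.
  by rewrite [RHS]big_ord_recr.
have gen F : inH k rho ups F -> exists M : 'I_3 -> CC R -> CC R, (forall j, inM (M j)) /\
    eqH F (fun z => \sum_(j < 3) M j z *: DnV k0 j F0 z).
  move=> [t [Fs [hFs E]]].
  have /choice[Mc hMc] n : exists M : 'I_3 -> CC R -> CC R,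
      (forall j : 'I_3, inMj (n - n0 - 2 * j%:Z) (M j)) /\
      forall z, upper z -> Fs n z = \sum_(j < 3) M j z *: DnV k0 j F0 z.
    apply: span; rewrite k0n -addrA -intrD [n0 + _]addrC subrK; exact: hFs.
  exists (fun j z => \sum_(n <- t) Mc n j z); split.
    (* The piece of degree n contributes a form of weight n - n0 - 2j; the second witness inverts
       this relabelling. *)
    move=> j; exists [seq n - n0 - 2 * j%:Z | n <- t], (fun p => Mc (p + 2 * j%:Z + n0) j); split.
      move=> p; have [h _] := hMc (p + 2 * j%:Z + n0); have := h j.
      by rewrite addrK addrK.
    by move=> z uz; rewrite big_map; apply: eq_bigr => n _; rewrite !subrK.
  move=> z uz; rewrite E//; under eq_bigr do rewrite (proj2 (hMc _) z uz).
  by rewrite exchange_big /=; apply: eq_bigr => j _; rewrite scaler_suml.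
(* Families over ['I_3] are extended to [nat], the index type of the combinations in (ii). *)
have inMnat (M : 'I_3 -> CC R -> CC R) : (forall j, inM (M j)) ->
    exists M' : nat -> CC R -> CC R, (forall j, inM (M' j)) /\ forall j : 'I_3, M' j = M j.
  move=> hM; exists (fun p => M (inord p)); split => // j.
  by rewrite inord_val.
split; [split; [|split; [|split]]|split].
- by move=> j; exact: inH_inHk (hGk j).
- move=> M /inMnat[M' [hM' e]]; apply: inH_ext (comb 3 M' hM') => z _.
  by apply: eq_bigr => j _; rewrite e.
- exact: gen.
(* Independence holds pointwise, the three vectors being a basis at every point of the
   half-plane. *)
- move=> M _ E j z uz; have := E z uz; rewrite sum3 => /(det3_indep (G_neq0 z uz))[].
  by case: (ord3P j) => ->.
- move=> F; split=> [/gen[M [/inMnat[M' [hM' e]] E]]|[n [M [hM E]]]].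
    exists 3, M'; split => // z uz; rewrite E//.
    by apply: eq_bigr => j _; rewrite e.
  by apply: inH_ext (comb n M hM) => z uz; rewrite E.
move=> kk; rewrite -mdim_sum.
(* Translates the shifted index of [mdim]: n = 6, 5, 4 give the weights of the coefficients of F0, D
   F0 and D^2 F0. *)
have W n : 2 * (kk + n)%N%:Z - 12 = 2 * kk%:Z - 2 * (6 - n%:Z) by rewrite PoszD; ring.
apply: (has_dim_free3 (G0 := DnV k0 0 F0) (G1 := DnV k0 1 F0) (G2 := DnV k0 2 F0)
  (Mdim_even ldq (kk + 6)) (Mdim_even ldq (kk + 5)) (Mdim_even ldq (kk + 4))).
- move=> M0 M1 M2 h0 h1 h2.
  have cl n (w : int) M : w = 2 * kk%:Z - 2 * n%:Z -> inMj w M ->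
      inHk (k0 + 2 * kk%:R) rho ups (fun z => M z *: DnV k0 n F0 z).
    move=> -> hM; have := inHk_scale ups1 hM (hG n).
    by rewrite intrB !intrM addrCA [_ + (_ - _)]addrC addrAC; congr inHk; ring.
  by apply: inHkD (cl 0 _ _ _ h0) (inHkD (cl 1 _ _ _ h1) (cl 2 _ _ _ h2)); rewrite W; ring.
- move=> X hX; have [] := span (2 * kk%:Z) X; first by rewrite intrM.
  move=> M [hM E]; exists (M o0), (M o1), (M o2); split.
  + by have := hM o0; rewrite W.
  + by have := hM o1; rewrite W.
  + by have := hM o2; rewrite W.
  + by move=> z uz; rewrite E// sum3.
- by move=> z x0 x1 x2 uz; exact: det3_indep (G_neq0 z uz).
Qed.
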